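(* Fix a hypergeometric datum $(\alpha,\beta)$ with $\alpha=(\alpha_1,\dots,\alpha_r)$, $\beta=(\beta_1,\dots,\beta_r)$ and $0\notin\alpha$, and fix $z\in\mathbb{Q}\setminus\{0,1\}$. There is an algorithm which, given a bound $X$, correctly computes the residue $H_p(\alpha;\beta\,|\,z) \bmod p$ for all good primes $p\le X$, and which runs in time $$O\left(X\log(X)^3\right),$$ where the implied constant may depend on the fixed data $\alpha,\beta,z$.
   Context: Running time means bit complexity, with integer multiplication of $n$-bit integers performed in time $O(n\log n)$. A hypergeometric datum is a pair of disjoint tuples $\alpha=(\alpha_1,\dots,\alpha_r)$, $\beta=(\beta_1,\dots,\beta_r)$ with entries in $\mathbb{Q}\cap[0,1)$, each Galois-stable: within each tuple, any two reduced fractions with the same denominator occur with the same multiplicity. A prime $p$ is good (for $\alpha,\beta,z$) if $z$ and $z-1$ are both $p$-adic units and all $\alpha_j,\beta_j$ are $p$-integral. Let $Z_{\alpha,\beta}(x)=\#\{j:\alpha_j\le x\}-\#\{j:\beta_j\le x\}$ for $x\in[0,1]$, let $w=\max_{x\in[0,1]}Z_{\alpha,\beta}(x)-\min_{x\in[0,1]}Z_{\alpha,\beta}(x)-1$, and let $D=\frac{w+1-\#\{j:\beta_j=0\}}{2}$. Let $\{x\}=x-\lfloor x\rfloor$. Let $\Gamma_p:\mathbb{Z}_p\to\mathbb{Z}_p^\times$ be Morita's $p$-adic gamma function, the unique continuous function with $\Gamma_p(n+1)=(-1)^{n+1}\prod_{1\le i\le n,\,(i,p)=1} i$ for all integers $n\ge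 0$. For a good prime $p$ and an integer $m$, set $$(x)_m^*=\frac{\Gamma_p(\{x+\frac{m}{1-p}\})}{\Gamma_p(\{x\})},\qquad \eta_m(x_1,\dots,x_r)=\sum_{j=1}^r\left(\left\{x_j+\tfrac{m}{1-p}\right\}-\{x_j\}\right),$$ $$\xi_m(\beta)=\#\{j:\beta_j=0\}-\#\left\{j:\beta_j+\tfrac{m}{1-p}=0\right\}.$$ Let $[z]\in\mathbb{Z}_p$ be the unique $(p-1)$-st root of unity congruent to $z$ modulo $p$. Then $$H_p(\alpha;\beta\,|\,z)=\frac{1}{1-p}\sum_{m=0}^{p-2}(-p)^{\eta_m(\alpha)-\eta_m(\beta)}\,p^{D+\xi_m(\beta)}\left(\prod_{j=1}^r\frac{(\alpha_j)_m^*}{(\beta_j)_m^*}\right)[z]^m .$$ This quantity is an integer (it is the trace of Frobenius at $p$ on the hypergeometric motive attached to $(\alpha,\beta)$ specialized at $z$). *)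

(* Defs.v *)
From HB Require Import structures.
From mathcomp Require Import all_boot all_order all_algebra.
From mathcomp Require Import boolp classical_sets.
From mathcomp Require Import ring zify.

Set Implicit Arguments.
Unset Strict Implicit.
Unset Printing Implicit Defensive.

Import Order.TTheory GRing.Theory Num.Theory.
Local Open Scope ring_scope.

(** * The ring of p-adic integers and its field of fractions *)

(** Z_p is the inverse limit of the rings Z/p^n: [res x n] is the
    representative in [0, p^n) of [x] modulo p^n.  (Compatibility forces
    [res x n < p ^ n].) *)
Record padic_int (p : nat) (hp : prime p) := PadicInt {
  res :> nat -> nat;
  resP : `[< forall n, (res n.+1 %% p ^ n)%N = res n >] }.

HB.instance Definition _ p (hp : prime p) := [isSub for @res p hp].
HB.instance Definition _ p (hp : prime p) := [Choice of padic_int hp by <:].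

Section PadicRing.
Context (p : nat) (hp : prime p).
Local Notation Zp := (padic_int hp).
Implicit Types x y z : Zp.

Lemma resS x n : (x n.+1 %% p ^ n)%N = x n.
Proof. by have /asboolP := resP x. Qed.

Lemma res_mod x n : (x n %% p ^ n)%N = x n.
Proof. by rewrite -resS modn_mod. Qed.

Lemma resD x n k : (x (n + k)%N %% p ^ n)%N = x n.
Proof.
elim: k => [|k IH]; first by rewrite addn0 res_mod.
rewrite -[RHS]IH addnS -(resS x (n + k)) modn_dvdm //.
by rewrite dvdn_exp2l // leq_addr.
Qed.

Lemma padicP x y : (forall n, x n = y n) -> x = y.
Proof. by move=> h; apply/val_inj/funext. Qed.

(** The element of Z_p with the given family of residues. *)
Lemma mk_subproof (f : nat -> nat) :
  (forall n, f n.+1 = f n %[mod p ^ n])%N ->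
  `[< forall n, ((f n.+1 %% p ^ n.+1) %% p ^ n)%N = (f n %% p ^ n)%N >].
Proof.
move=> h; apply/asboolP => n.
by rewrite modn_dvdm ?h // dvdn_exp2l.
Qed.

Definition mk_padic f h : Zp := PadicInt hp (@mk_subproof f h).

Lemma add_subproof x y n : (x n.+1 + y n.+1 = x n + y n %[mod p ^ n])%N.
Proof. by rewrite -modnDm !resS. Qed.

Lemma mul_subproof x y n : (x n.+1 * y n.+1 = x n * y n %[mod p ^ n])%N.
Proof. by rewrite -modnMm !resS. Qed.

Lemma opp_subproof x n :
  (p ^ n.+1 - x n.+1 = p ^ n - x n %[mod p ^ n])%N.
Proof.
have lt m : (x m <= p ^ m)%N.
  by rewrite -(res_mod x m) ltnW // ltn_pmod // expn_gt0 prime_gt0.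
apply/eqP; rewrite -(eqn_modDr (x n)) subnK // modnn.
rewrite -modnDmr -(resS x n) modn_mod modnDmr subnK //.
by rewrite expnS modnMl.
Qed.

Definition padic_nat (k : nat) : Zp := @mk_padic (fun=> k) (fun=> erefl).
Definition padic_add x y : Zp := mk_padic (add_subproof x y).
Definition padic_mul x y : Zp := mk_padic (mul_subproof x y).
Definition padic_opp x : Zp := mk_padic (opp_subproof x).

Lemma padic_addA : associative padic_add.
Proof. by move=> x y z; apply: padicP => n /=; rewrite modnDml modnDmr addnA. Qed.

Lemma padic_addC : commutative padic_add.
Proof. by move=> x y; apply: padicP => n /=; rewrite addnC. Qed.

Lemma padic_add0 : left_id (padic_nat 0) padic_add.
Proof. by move=> x; apply: padicP => n /=; rewrite mod0n res_mod. Qed.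

Lemma padic_addN : left_inverse (padic_nat 0) padic_opp padic_add.
Proof.
move=> x; apply: padicP => n /=; rewrite modnDml subnK ?modnn ?mod0n //.
by rewrite -(res_mod x n) ltnW // ltn_pmod // expn_gt0 prime_gt0.
Qed.

HB.instance Definition _ := GRing.isZmodule.Build Zp
  padic_addA padic_addC padic_add0 padic_addN.

Lemma padic_mulA : associative padic_mul.
Proof. by move=> x y z; apply: padicP => n /=; rewrite modnMml modnMmr mulnA. Qed.

Lemma padic_mulC : commutative padic_mul.
Proof. by move=> x y; apply: padicP => n /=; rewrite mulnC. Qed.

Lemma padic_mul1 : left_id (padic_nat 1) padic_mul.
Proof. by move=> x; apply: padicP => n /=; rewrite modnMml mul1n res_mod. Qed.

Lemma padic_mulDl : left_distributive padic_mul padic_add.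
Proof.
by move=> x y z; apply: padicP => n /=; rewrite modnMml mulnDl modnDm.
Qed.

Lemma padic_oner_neq0 : padic_nat 1 != 0 :> Zp.
Proof.
apply/eqP => /(congr1 (fun x : Zp => x 1%N)) /=.
by rewrite mod0n expn1 modn_small // prime_gt1.
Qed.

HB.instance Definition _ := GRing.Zmodule_isComNzRing.Build Zp
  padic_mulA padic_mulC padic_mul1 padic_mulDl padic_oner_neq0.

Definition padic_unit : {pred Zp} := fun x => `[< exists y : Zp, y * x = 1 >].

Definition padic_inv x : Zp :=
  if pselect (exists y : Zp, y * x = 1) is left h then sval (cid h) else x.

Lemma padic_mulV : {in padic_unit, left_inverse 1 padic_inv *%R}.
Proof.
move=> x /asboolP hx; rewrite /padic_inv; case: pselect => // h.
exact: svalP (cid h).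
Qed.

Lemma padic_unitPl x y : y * x = 1 -> padic_unit x.
Proof. by move=> h; apply/asboolP; exists y. Qed.

Lemma padic_inv_out : {in [predC padic_unit], padic_inv =1 id}.
Proof.
move=> x /asboolPn hx; rewrite /padic_inv; case: pselect => // h.
Qed.

HB.instance Definition _ := GRing.ComNzRing_hasMulInverse.Build Zp
  padic_mulV padic_unitPl padic_inv_out.

Lemma res0 n : (0 : Zp) n = 0%N.
Proof. exact: mod0n. Qed.

Lemma resM x y n : (x * y) n = (x n * y n %% p ^ n)%N.
Proof. by []. Qed.

Lemma padic_neq0 x : x != 0 -> exists n, x n != 0%N.
Proof.
move=> hx; apply: contrapT => /forallNP h; case/eqP: hx.
by apply: padicP => n; rewrite res0; apply/eqP/negPn/negP/h.
Qed.

Lemma padic_logn x n k : x n != 0%N ->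
  (0 < x (n + k))%N /\ (logn p (x (n + k)%N) < n)%N.
Proof.
move=> xn0.
have x0 : (0 < x (n + k))%N.
  by rewrite lt0n; apply: contraNneq xn0 => e; rewrite -(resD x n k) e mod0n.
split=> //; rewrite ltnNge -pfactor_dvdn //.
by apply: contraNN xn0 => d; rewrite -(resD x n k).
Qed.

Lemma padic_mulf_eq0 : GRing.integral_domain_axiom Zp.
Proof.
move=> x y xy0; apply: contrapT => /negP; rewrite negb_or => /andP[].
move=> /padic_neq0[n xn] /padic_neq0[m ym].
have [x0 lx] := padic_logn m xn; have := padic_logn n ym.
rewrite [(m + n)%N]addnC => -[y0 ly].
have := congr1 (fun x : Zp => x (n + m)%N) xy0.
rewrite resM res0 => /eqP; rewrite -/(dvdn _ _) pfactor_dvdn ?muln_gt0 ?x0 //.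
rewrite lognM // leqNgt => /negP; apply.
by rewrite -addSn leq_add // ltnW.
Qed.

HB.instance Definition _ :=
  GRing.ComUnitRing_isIntegral.Build Zp padic_mulf_eq0.

End PadicRing.

Definition padic (p : nat) (hp : prime p) := {fraction padic_int hp}.

Notation "x %:Qp" := (FracField.tofrac x) (at level 2, format "x %:Qp").

(** [c] is the residue modulo p of the p-adic number [h]; in particular
    [h] lies in Z_p. *)
Definition is_residue p (hp : prime p) (h : padic hp) (c : nat) : Prop :=
  (c < p)%N /\
  exists u : padic_int hp, h - c%:R = p%:R * u%:Qp.

(** * Morita's gamma function and Teichmueller representatives *)

(** Continuity for the p-adic topology: [x n] is x mod p^n. *)
Definition padic_continuous p (hp : prime p)
    (f : padic_int hp -> padic_int hp) : Prop :=
  forall (x : padic_int hp) k, exists n,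
    forall y : padic_int hp, y n = x n -> f y k = f x k.

Definition is_morita_gamma p (hp : prime p)
    (f : padic_int hp -> padic_int hp) : Prop :=
  [/\ padic_continuous f,
      forall x, f x \is a GRing.unit &
      forall n : nat,
        f n.+1%:R = (-1) ^+ n.+1 * \prod_(1 <= i < n.+1 | coprime i p) i%:R].

(** There is exactly one such function (Morita), so the default value of
    [xget] is never used. *)
Definition morita_gamma p (hp : prime p) : padic_int hp -> padic_int hp :=
  xget (fun=> 1) [set f | is_morita_gamma f].

Arguments morita_gamma {p} hp _.

(** For p-integral [z], [ratr z] is the image of [z] in Z_p, and congruence
    modulo p is equality of the components of index 1. *)
Definition is_teichmuller p (hp : prime p) (z : rat) (t : padic_int hp) :=
  t ^+ p.-1 = 1 /\ t 1%N = (ratr z : padic_int hp) 1%N.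

Definition teichmuller p (hp : prime p) (z : rat) : padic_int hp :=
  xget 0 [set t | is_teichmuller z t].

(** * Hypergeometric data *)

Definition galois_stable (a : seq rat) : Prop :=
  forall x y : rat, 0 <= x < 1 -> 0 <= y < 1 -> denq x = denq y ->
    count_mem x a = count_mem y a.

Definition hypergeometric_datum r (alpha beta : r.-tuple rat) : Prop :=
  [/\ forall x, x \in alpha -> 0 <= x < 1,
      forall x, x \in beta -> 0 <= x < 1,
      forall x, x \in alpha -> x \notin beta,
      galois_stable alpha & galois_stable beta].

Definition p_integral (p : nat) (x : rat) : bool := ~~ (p %| `|denq x|)%N.

Definition p_unit (p : nat) (x : rat) : bool :=
  p_integral p x && ~~ (p %| `|numq x|)%N.

Definition good_prime r (alpha beta : r.-tuple rat) (z : rat) (p : nat) :=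
  [&& prime p, p_unit p z, p_unit p (z - 1),
      all (p_integral p) alpha & all (p_integral p) beta].

Section Trace.
Context (r : nat) (alpha beta : r.-tuple rat).

Definition zigzag (x : rat) : int :=
  (count (fun a => a <= x) alpha)%:Z - (count (fun b => b <= x) beta)%:Z.

(** The zigzag function only jumps at the entries of the datum, so its
    extrema on [0,1] are attained at 0 or at one of these entries; see
    [zigzag_maxP] and [zigzag_minP]. *)
Definition zigzag_max : int :=
  \big[Num.max/zigzag 0]_(x <- alpha ++ beta) zigzag x.

Definition zigzag_min : int :=
  \big[Num.min/zigzag 0]_(x <- alpha ++ beta) zigzag x.

Definition weight : int := zigzag_max - zigzag_min - 1.

Definition Dshift : rat := (weight + 1 - (count_mem 0 beta)%:Z)%:~R / 2.

Definition frac (x : rat) : rat := x - (Num.floor x)%:~R.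

Definition mshift (p : nat) (m : int) : rat := m%:~R / (1 - p%:R).

Definition eta (p : nat) (m : int) (x : r.-tuple rat) : rat :=
  \sum_(j < r) (frac (tnth x j + mshift p m) - frac (tnth x j)).

Definition xi (p : nat) (m : int) : int :=
  (count_mem 0 beta)%:Z - (count (fun b => b + mshift p m == 0) beta)%:Z.

Definition pochhammer p (hp : prime p) (m : int) (x : rat) : padic_int hp :=
  morita_gamma hp (ratr (frac (x + mshift p m))) /
  morita_gamma hp (ratr (frac x)).

(** The exponents are written as rational numbers but are integers ([eta_int]
    and [Dshift_int] below); [Num.floor] only serves to read them as elements
    of [int]. *)
Definition hgm_trace p (hp : prime p) (z : rat) : padic hp :=
  (1 - p%:R)^-1 *
  \sum_(m < p.-1)
    ((- p%:R) ^ Num.floor (eta p m alpha - eta p m beta) *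
     p%:R ^ Num.floor (Dshift + (xi p m)%:~R) *
     (\prod_(j < r) (pochhammer hp m (tnth alpha j) /
                     pochhammer hp m (tnth beta j)))%:Qp *
     (teichmuller hp z)%:Qp ^+ m).

Lemma eta_int p m : eta p m alpha - eta p m beta \is a Num.int.
Proof.
rewrite /eta -sumrB; apply: rpred_sum => j _.
set a := tnth alpha j; set b := tnth beta j; rewrite /frac.
set f1 := Num.floor (a + _); set f2 := Num.floor a.
set g1 := Num.floor (b + _); set g2 := Num.floor b.
suff -> : a + mshift p m - f1%:~R - (a - f2%:~R) -
    (b + mshift p m - g1%:~R - (b - g2%:~R)) =
    (f2 - f1 + (g1 - g2))%:~R :> rat by exact: intr_int.
rewrite !(rmorphD, rmorphN) /=; ring.
Qed.

Let zigzag_cut (P : pred rat) : P 0 -> (forall u v, u <= v -> P v -> P u) ->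
  exists2 y, y \in 0 :: alpha ++ beta &
    zigzag y = (count P alpha)%:Z - (count P beta)%:Z.
Proof.
move=> P0 Ple; pose s := [seq y <- 0 :: alpha ++ beta | P y].
pose y := \big[Num.max/0]_(u <- s) u.
have ys : y \in s.
  have s0 : 0 \in s by rewrite /s mem_filter P0 inE eqxx.
  rewrite /y big_seq; elim/big_ind: _ => // u v us vs.
  by case: (leP u v).
have /andP[Py yab] : P y && (y \in 0 :: alpha ++ beta).
  by rewrite -(mem_filter P).
exists y => //; rewrite /zigzag; congr (_%:Z - _%:Z);
  apply: eq_in_count => u uab; apply/idP/idP => ux;
  do ?[exact: Ple ux Py];
  by apply: le_bigmax_seq => //; rewrite /s mem_filter ux inE mem_cat uab ?orbT.
Qed.

Let zigzag_step x : 0 <= x ->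
  exists2 y, y \in 0 :: alpha ++ beta & zigzag y = zigzag x.
Proof. by move=> x0; apply: zigzag_cut => // u v; apply: le_trans. Qed.

Let zigzag_entry x : hypergeometric_datum alpha beta ->
  x \in 0 :: alpha ++ beta -> 0 <= x <= 1.
Proof.
case=> ha hb _ _ _; rewrite inE => /orP[/eqP-> //|].
by rewrite mem_cat => /orP[/ha|/hb] /andP[-> /ltW].
Qed.

Lemma zigzag_maxP : hypergeometric_datum alpha beta ->
  (exists2 x, 0 <= x <= 1 & zigzag x = zigzag_max) /\
  (forall x, 0 <= x <= 1 -> zigzag x <= zigzag_max).
Proof.
move=> hab; split=> [|x /andP[/zigzag_step[y yab <-] _]].
  rewrite /zigzag_max big_seq; elim/big_ind: _ => [|u v|x xab].
  - by exists 0.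
  - by case: (leP u v).
  - by exists x => //; apply: zigzag_entry => //; rewrite inE xab orbT.
move: yab; rewrite inE => /orP[/eqP->|yab].
  exact: bigmax_ge_id.
exact: le_bigmax_seq.
Qed.

Lemma zigzag_minP : hypergeometric_datum alpha beta ->
  (exists2 x, 0 <= x <= 1 & zigzag x = zigzag_min) /\
  (forall x, 0 <= x <= 1 -> zigzag_min <= zigzag x).
Proof.
move=> hab; split=> [|x /andP[/zigzag_step[y yab <-] _]].
  rewrite /zigzag_min big_seq; elim/big_ind: _ => [|u v|x xab].
  - by exists 0.
  - by case: (leP u v).
  - by exists x => //; apply: zigzag_entry => //; rewrite inE xab orbT.
move: yab; rewrite inE => /orP[/eqP->|yab].
  exact: bigmin_le_id.
exact: ge_bigmin_seq.
Qed.

(** The reflection x |-> {-x} of [0,1). *)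
Let refl (x : rat) : rat := if x == 0 then 0 else 1 - x.

Let refl01 x : 0 <= x < 1 -> 0 <= refl x < 1.
Proof.
rewrite /refl; case: eqP => [->//|/eqP x0 /andP[x1 x2]].
by rewrite subr_ge0 ltW //= ltrBlDr ltrDl lt_neqAle eq_sym x0.
Qed.

Let reflK x : 0 <= x < 1 -> refl (refl x) = x.
Proof.
rewrite /refl; case: (eqVneq x 0) => [->|x0 /andP[_ x1]]; first by rewrite eqxx.
by rewrite subr_eq0 gt_eqF // opprB addrC subrK.
Qed.

Let denq_refl x : denq (refl x) = denq x.
Proof.
rewrite /refl; case: eqP => [->//|_].
have -> : 1 - x = (denq x - numq x)%:~R / (denq x)%:~R.
  by rewrite rmorphB /= mulrBl divff ?intr_eq0 ?denq_neq0 // divq_num_den.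
rewrite coprimeq_den ?denq_eq0 ?normr_denq // -coprimezE.
rewrite coprimez_sym.
rewrite /coprimez gcdzDl gcdzN -/(coprimez _ _) coprimez_sym.
by rewrite coprimezE coprime_num_den.
Qed.

(** Reflecting a Galois-stable list. *)
Let count_refl (s : r.-tuple rat) (P : pred rat) :
  (forall x, x \in s -> 0 <= x < 1) -> galois_stable s ->
  count (P \o refl) s = count P s.
Proof.
move=> s01 gs; rewrite -count_map; apply/permP/allP => x _ /=.
rewrite count_map; apply/eqP; have [x01|xN] := boolP (0 <= x < 1); last first.
  rewrite [RHS](count_memPn _); last by apply: contra xN => /s01.
  apply/eqP; rewrite -leqn0 leqNgt -has_count; apply: contra xN.
  by case/hasP => y /s01/refl01 + /eqP => /[swap] ->.
rewrite -(gs (refl x) x) ?refl01 ?denq_refl //.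
apply: eq_in_count => y /s01 y01 /=.
by apply/eqP/eqP => [<-|->]; rewrite reflK.
Qed.

Let count_lt (s : r.-tuple rat) x : 0 <= x < 1 ->
  (forall y, y \in s -> 0 <= y < 1) -> galois_stable s ->
  (count (fun a : rat => (a < 1 - x)%R) s + count (fun a : rat => (a <= x)%R) s =
   r + count_mem 0%R s)%N.
Proof.
move=> /andP[x0 x1] s01 gs.
rewrite -[X in (_ + X)%N](count_refl _ s01 gs).
transitivity (count predT s + count_mem 0%R s)%N; last first.
  by rewrite count_predT size_tuple.
elim: (tval s) => //= a s' IH.
rewrite addnACA IH [in RHS]addnACA; congr (_ + _)%N.
rewrite /refl; case: eqP => [->|_]; first by rewrite subr_gt0 x1 x0.
by rewrite lerBlDr -lerBlDl ltNge; case: (_ <= _).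
Qed.

Let zigzag_refl x : hypergeometric_datum alpha beta -> 0 \notin alpha ->
  x \in 0 :: alpha ++ beta -> exists2 y, y \in 0 :: alpha ++ beta &
  zigzag y = - (count_mem 0 beta)%:Z - zigzag x.
Proof.
case=> ha hb _ ga gb a0 xab.
have x01 : 0 <= x < 1.
  move: xab; rewrite inE mem_cat.
  by case/orP => [/eqP->//|/orP[/ha|/hb]].
have [|u v uv|y yab ey] := @zigzag_cut (fun a => a < 1 - x).
- by rewrite subr_gt0; case/andP: x01.
- exact: le_lt_trans.
exists y => //; rewrite ey /zigzag.
have := count_lt x01 ha ga; have := count_lt x01 hb gb.
rewrite (count_memPn a0).
have arith (A A' B B' c : nat) : (B + B' = r + c)%N ->
    (A + A' = r + 0)%N -> A%:Z - B%:Z = - c%:Z - (A'%:Z - B'%:Z) by lia.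
exact: arith.
Qed.

Lemma Dshift_int : hypergeometric_datum alpha beta -> 0 \notin alpha ->
  Dshift \is a Num.int.
Proof.
move=> hab a0; suff e : zigzag_max + zigzag_min = - (count_mem 0 beta)%:Z.
  rewrite /Dshift /weight.
  have -> : zigzag_max - zigzag_min - 1 + 1 - (count_mem 0 beta)%:Z =
            zigzag_max * 2 by lia.
  by rewrite rmorphM /= mulfK // intr_int.
have [[x x01 <-] le_max] := zigzag_maxP hab.
have [[y y01 <-] ge_min] := zigzag_minP hab.
have /zigzag_step[x' x'ab ex] : 0 <= x by case/andP: x01.
have /zigzag_step[y' y'ab ey] : 0 <= y by case/andP: y01.
have [u /(zigzag_entry hab)/ge_min + eu] := zigzag_refl hab a0 x'ab.
have [v /(zigzag_entry hab)/le_max + ev] := zigzag_refl hab a0 y'ab.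
have [[x2 x201 ex2] le_max'] := zigzag_maxP hab.
lia.
Qed.

End Trace.

Arguments hgm_trace {r} alpha beta {p} hp z.

(** * Bit complexity

    A random-access machine over the integers with logarithmic cost: finitely
    many registers and arrays are named by a program, registers and array
    cells hold arbitrary integers, and each instruction is charged in terms of
    the bit lengths of all the integers (addresses included) it handles.
    Everything is linear except the multiplication of [n]-bit integers, which
    is charged [n log n].  There is no division other than by powers of 2. *)

Inductive instr : Type :=
| Const (x : nat) (c : int)      (* x := c *)
| Add (x y z : nat)              (* x := y + z *)
| Diff (x y z : nat)             (* x := y - z *)
| Mul (x y z : nat)              (* x := y * z *)
| Shl (x y z : nat)              (* x := y * 2 ^ |z| *)
| Shr (x y z : nat)              (* x := floor (y / 2 ^ |z|) *)
| ReadArr (x a y : nat)          (* x := a[y] *)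
| WriteArr (a y z : nat)         (* a[y] := z *)
| Output (x : nat).              (* append x to the output *)

Inductive program : Type :=
| Skip
| Do (i : instr)
| Seq (P Q : program)
| If (x : nat) (P Q : program)   (* if 0 < x then P else Q *)
| While (x : nat) (P : program). (* while 0 < x do P *)

Record state : Type := State {
  reg : nat -> int;
  arr : nat -> int -> int;
  out : seq int }.

Definition init (X : nat) : state :=
  State (fun x => if x == 0%N then X%:Z else 0) (fun _ _ => 0) [::].

Definition set_reg (s : state) (x : nat) (v : int) : state :=
  State (fun x' => if x' == x then v else reg s x') (arr s) (out s).

Definition set_arr (s : state) (a : nat) (k v : int) : state :=
  State (reg s)
    (fun a' k' => if (a' == a) && (k' == k) then v else arr s a' k') (out s).

Definition step (i : instr) (s : state) : state :=
  let v := reg s in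
  match i with
  | Const x c => set_reg s x c
  | Add x y z => set_reg s x (v y + v z)
  | Diff x y z => set_reg s x (v y - v z)
  | Mul x y z => set_reg s x (v y * v z)
  | Shl x y z => set_reg s x (v y * 2 ^+ `|v z|)
  | Shr x y z => set_reg s x (v y %/ 2 ^+ `|v z|)%Z
  | ReadArr x a y => set_reg s x (arr s a (v y))
  | WriteArr a y z => set_arr s a (v y) (v z)
  | Output x => State (reg s) (arr s) (rcons (out s) (v x))
  end.

Definition bits (n : nat) : nat := (trunc_log 2 n).+1.

Definition bitlen (x : int) : nat := bits `|x|.

Definition mul_cost (x y : int) : nat :=
  let n := maxn (bitlen x) (bitlen y) in (n * bits n)%N.

Definition cost (i : instr) (s : state) : nat :=
  let v := reg s in
  match i with
  | Const _ c => bitlen c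
  | Add _ y z | Diff _ y z | Shr _ y z => (bitlen (v y) + bitlen (v z))%N
  | Mul _ y z => mul_cost (v y) (v z)
  | Shl _ y z => (bitlen (v y) + bitlen (v z) + `|v z|)%N
  | ReadArr _ a y => (bitlen (v y) + bitlen (arr s a (v y)))%N
  | WriteArr _ y z => (bitlen (v y) + bitlen (v z))%N
  | Output x => bitlen (v x)
  end.

(** [exec P s t s']: started in [s], the program [P] halts in state [s'] after
    time [t]. *)
Inductive exec : program -> state -> nat -> state -> Prop :=
| ExecSkip s : exec Skip s 1 s
| ExecDo i s : exec (Do i) s (cost i s) (step i s)
| ExecSeq P Q s t s' t' s'' : exec P s t s' -> exec Q s' t' s'' ->
    exec (Seq P Q) s (t + t')%N s''
| ExecIfTrue x P Q s t s' : 0 < reg s x -> exec P s t s' ->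
    exec (If x P Q) s (bitlen (reg s x) + t)%N s'
| ExecIfFalse x P Q s t s' : reg s x <= 0 -> exec Q s t s' ->
    exec (If x P Q) s (bitlen (reg s x) + t)%N s'
| ExecWhileTrue x P s t s' t' s'' : 0 < reg s x -> exec P s t s' ->
    exec (While x P) s' t' s'' ->
    exec (While x P) s (bitlen (reg s x) + t + t')%N s''
| ExecWhileFalse x P s : reg s x <= 0 ->
    exec (While x P) s (bitlen (reg s x)) s.

(** The output [o] lists, in some order, each good prime p <= X exactly once,
    followed by the residue modulo p of the trace at p. *)
Definition correct_output r (alpha beta : r.-tuple rat) (z : rat) (X : nat)
    (o : seq int) : Prop :=
  exists ans : seq (nat * nat),
    [/\ o = flatten [seq [:: pc.1%:Z; pc.2%:Z] | pc <- ans],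
        perm_eq (unzip1 ans) [seq p <- iota 0 X.+1 | good_prime alpha beta z p]
      & forall p c (hp : prime p), (p, c) \in ans ->
          is_residue (hgm_trace alpha beta hp z) c].

(* Main.v *)
(** Let [N] be an even common denominator of the datum and let the prime [p]
    lie in a fixed class modulo [N], say [p = c + N * q].  Modulo [p] only the
    terms of the trace with vanishing exponent of [p] survive.  By the
    functional equation of Gamma_p the ratio of consecutive terms is a product
    of factors [y] or [1 / y] with [y = a / N + m], possibly shifted by 1, and
    which shifts occur only depends on the position of [m / (p - 1)] among
    the fractions [i / N].  On the [N] intervals of [q] consecutive
    indices [m = i * q + t + l], [l < q], the congruence [N * q = - c] turns
    the ratio into a quotient of polynomials in [l] that do not depend on [p];
    boundedly many indices remain between the intervals.  Hence the trace modulo [p]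
    can be read off from a product of [N] products of [q] triangular 2x2
    matrices, the [l]-th factor of each being the same for all primes of
    the class.

    An accumulating remainder tree computes such a product of the first [q]
    factors modulo [c + N * q] for all [q < 2 ^ h] at once.  Each level of the
    tree handles O(X log X) bits, in time O(X log(X)^2), and there are
    O(log X) levels.  As the machine divides only by powers of 2, the
    remainders are taken by Montgomery reduction; the scaling factors are
    units that multiply whole matrices and cancel in the final quotient, which
    is computed by a binary gcd.  Primality is tested by Wilson's theorem with the
    same trees.  The finitely many remaining good primes are tabulated in the
    program. *)

Require Import Defs.
From HB Require Import structures.
From mathcomp Require Import all_boot all_order all_algebra.
From mathcomp Require Import boolp classical_sets.
From mathcomp Require Import cyclic.
From mathcomp Require Import ring lra zify.

Set Implicit Arguments.
Unset Strict Implicit.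
Unset Printing Implicit Defensive.

Import Order.TTheory GRing.Theory Num.Theory.
Local Open Scope ring_scope.

(** * Running blocks and loops within a time bound *)

(** If consecutive terms satisfy u_(m+1) g_m = f_m u_m with u_0 = 1, the product of the matrices
    [[f_m, w_m g_m], [0, g_m]] over m < n is [[G u_n, G S], [0, G]], where G is the product of the
    g_m and S the sum of the w_m u_m. A weighted sum of ratios thus becomes a product of integer
    matrices followed by one division, and weights 0 and 1 select the terms that survive modulo p.
    The obstacle is uniformity in p. Besides the modulus and the number of factors, two things could
    depend on p: which fractional parts wrap around, and which factors the functional equation of
    Gamma_p replaces by 1 because p divides them. For large q both depend on c, i and t only: near
    the ends of the intervals a factor is so small an integer that p divides it only if it is 0, and
    inside the intervals p never divides it. As for time, each of the O(X) leaves may cost (log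
    X)^3, which leaves room for a Newton iteration credited with one bit per round and for a binary
    gcd at every leaf. *)

Definition block (l : seq instr) : program :=
  foldr (fun i P => Seq (Do i) P) Skip l.

Fixpoint run (l : seq instr) (s : state) : state :=
  if l is i :: l' then run l' (step i s) else s.

Fixpoint bcost (l : seq instr) (s : state) : nat :=
  if l is i :: l' then (cost i s + bcost l' (step i s))%N else 1%N.

Lemma exec_block l s : exec (block l) s (bcost l s) (run l s).
Proof.
elim: l s => [|i l IH] s /=; first exact: ExecSkip.
exact: ExecSeq (ExecDo i s) (IH _).
Qed.

Definition runs (P : program) (s : state) (T : nat) (Q : state -> Prop) :=
  exists t s', [/\ exec P s t s', (t <= T)%N & Q s'].

Lemma runs_weaken P s T T' (Q Q' : state -> Prop) :
  runs P s T Q -> (T <= T')%N -> (forall s', Q s' -> Q' s') -> runs P s T' Q'.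
Proof.
move=> [t [s' [h tT q]]] TT' QQ'; exists t, s'; split=> //; last exact: QQ'.
exact: leq_trans tT TT'.
Qed.

Lemma runs_seq P1 P2 s T1 T2 (R Q : state -> Prop) :
  runs P1 s T1 R -> (forall s1, R s1 -> runs P2 s1 T2 Q) ->
  runs (Seq P1 P2) s (T1 + T2) Q.
Proof.
move=> [t [s1 [h1 tT1 r]]] /(_ _ r)[t' [s2 [h2 tT2 q]]].
exists (t + t')%N, s2; split=> //; first exact: ExecSeq h1 h2.
exact: leq_add.
Qed.

Lemma runs_block l s T (Q : state -> Prop) :
  (bcost l s <= T)%N -> Q (run l s) -> runs (block l) s T Q.
Proof. by move=> lT q; exists (bcost l s), (run l s); split=> //; exact: exec_block. Qed.

Lemma runs_if x P1 P2 s T B (Q : state -> Prop) :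
  (bitlen (reg s x) <= B)%N ->
  (0 < reg s x -> runs P1 s T Q) -> (reg s x <= 0 -> runs P2 s T Q) ->
  runs (If x P1 P2) s (B + T) Q.
Proof.
move=> xB h1 h2; case: (ltP 0 (reg s x)) => hx.
  have [t [s' [h tT q]]] := h1 hx; exists (bitlen (reg s x) + t)%N, s'.
  by split=> //; [exact: ExecIfTrue | exact: leq_add].
have [t [s' [h tT q]]] := h2 hx; exists (bitlen (reg s x) + t)%N, s'.
by split=> //; [exact: ExecIfFalse | exact: leq_add].
Qed.

(** The index of the invariant is a rank that drops by 1 in each round, and the round that reaches
    rank [j] is charged [T j]. Rounds of very different cost, such as the nodes of a tree, can
    therefore be summed exactly. The loop may end before rank 0. *)
Lemma runs_while x P (I : nat -> state -> Prop) (T : nat -> nat) B n s :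
  (forall j s, I j s -> (bitlen (reg s x) <= B)%N) ->
  (forall j s, I j s -> 0 < reg s x ->
     exists2 j', j = j'.+1 & runs P s (T j') (I j')) ->
  I n s ->
  runs (While x P) s (\sum_(j < n) (T j + B) + B)
    (fun s' => exists2 j, I j s' & reg s' x <= 0).
Proof.
move=> hB hP; elim: n s => [|n IH] s hI; case: (ltP 0 (reg s x)) => hx.
- by have [j' //] := hP _ _ hI hx.
- exists (bitlen (reg s x)), s; split; [exact: ExecWhileFalse| |by exists 0%N].
  by rewrite big_ord0 add0n (hB _ _ hI).
- have [j' [<-] [t [s1 [h1 tT /IH[t' [s2 [h2 tT' q]]]]]]] := hP _ _ hI hx.
  exists (bitlen (reg s x) + t + t')%N, s2; split=> //.
    exact: ExecWhileTrue h1 h2.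
  rewrite big_ord_recr /= addnC.
  apply: leq_trans (leq_add tT' (leq_add (hB _ _ hI) tT)) _.
  by rewrite (addnC B) addnAC.
- exists (bitlen (reg s x)), s; split; [exact: ExecWhileFalse| |by exists n.+1].
  by apply: leq_trans (hB _ _ hI) _; rewrite leq_addl.
Qed.

(** The frame condition of the loops run for one residue class: registers 0 to 3 hold the parameters
    X, 2^h, h + 1 and k0; all higher registers are scratch. *)
Definition same (mods : seq nat) (s0 s : state) : Prop :=
  [/\ forall r, (r < 4)%N -> reg s r = reg s0 r, out s = out s0 &
      forall a, a \notin mods -> arr s a = arr s0 a].

Lemma same_trans mods s1 s0 s2 : same mods s0 s1 -> same mods s1 s2 -> same mods s0 s2.
Proof.
move=> [r1 o1 a1] [r2 o2 a2]; split; first by move=> r hr; rewrite r2 ?r1.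
  by rewrite o2.
by move=> a ha; rewrite a2 ?a1.
Qed.

Lemma same_sub mods mods' s0 s : {subset mods <= mods'} -> same mods s0 s -> same mods' s0 s.
Proof.
move=> h [r o a]; split=> // x hx; apply: a.
by apply: contra hx; apply: h.
Qed.

(** * Bit lengths, and the cost of straight-line code by abstract interpretation *)

Lemma bits_le n m : (0 < m)%N -> (n < 2 ^ m)%N -> (bits n <= m)%N.
Proof.
case: n => [|n] m0 nm; rewrite /bits; first by rewrite trunc_log0.
by rewrite -(@ltn_exp2l 2) //; apply: leq_ltn_trans nm; apply: trunc_logP.
Qed.

Lemma bits_mono m n : (m <= n)%N -> (bits m <= bits n)%N.
Proof. by move=> mn; rewrite /bits ltnS leq_trunc_log. Qed.

Lemma bits_ltn n : (n < 2 ^ bits n)%N.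
Proof. by rewrite /bits trunc_log_ltn. Qed.

Lemma bits_gt0 n : (0 < bits n)%N. Proof. by []. Qed.

Lemma bits_mul m n : (bits (m * n) <= bits m + bits n)%N.
Proof.
apply: bits_le; first by rewrite addn_gt0.
by rewrite expnD ltn_mul // bits_ltn.
Qed.

Lemma bits_leid n : (0 < n)%N -> (bits n <= n)%N.
Proof. by move=> n0; apply: bits_le => //; apply: ltn_expl. Qed.

(** Interval-style bounds, in units of a parameter [K]: [Bits c] stands for
    values of at most [c * K] bits, [Mag d] for values of size at most
    [d * K]; the latter may serve as shift amounts. *)
Inductive bnd := Bits of nat | Mag of nat.

Definition wid b := match b with Bits c => c | Mag d => d end.

Definition sat K b (v : int) : Prop :=
  match b with
  | Bits c => (`|v| < 2 ^ (c * K))%N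
  | Mag d => (`|v| <= d * K)%N
  end.

Lemma sat_wid K b v : sat K b v -> (`|v| < 2 ^ (wid b * K))%N.
Proof. by case: b => //= d h; apply: leq_ltn_trans h (ltn_expl _ _). Qed.

Lemma sat_bitlen K b v : (0 < K)%N -> sat K b v -> (bitlen v <= (wid b).+1 * K)%N.
Proof.
move=> K0 /sat_wid h; apply: bits_le; first by rewrite muln_gt0.
by apply: leq_trans h _; rewrite leq_exp2l // leq_mul2r leqnSn orbT.
Qed.

Definition env := seq (nat * bnd).

Fixpoint look (e : env) (r : nat) : option bnd :=
  if e is (r', b) :: e' then if r == r' then Some b else look e' r else None.

Definition env_ok K (e : env) (f : nat -> int) : Prop :=
  forall r b, look e r = Some b -> sat K b (f r).

(** A sum of two magnitudes stays a magnitude, so that a doubled exponent is still a legal shift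
    amount. *)
Definition bnd_add b1 b2 :=
  match b1, b2 with
  | Mag d1, Mag d2 => Mag (d1 + d2)
  | _, _ => Bits (maxn (wid b1) (wid b2)).+1
  end.

(** Neither the new bounds nor the returned coefficient, which counts multiples of [K * bits K],
    mentions [K]: one evaluation covers all sizes. Arrays are not tracked; [ea] is a bound to be
    justified at each read. *)
Definition abs_instr (ea : nat -> bnd) (i : instr) (e : env) : option (env * nat) :=
  match i with
  | Const x c => Some ((x, Bits (bitlen c)) :: e, bitlen c)
  | Add x y z | Diff x y z =>
      if look e y is Some by_ then if look e z is Some bz then
        Some ((x, bnd_add by_ bz) :: e, ((wid by_).+1 + (wid bz).+1)%N)
      else None else None
  | Mul x y z =>
      if look e y is Some by_ then if look e z is Some bz then
        let w := (maxn (wid by_) (wid bz)).+1 in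
        Some ((x, Bits (wid by_ + wid bz)) :: e, (w * w.+1)%N)
      else None else None
  | Shl x y z =>
      if look e y is Some by_ then if look e z is Some (Mag d) then
        Some ((x, Bits (wid by_ + d)) :: e, ((wid by_).+1 + d.+1 + d)%N)
      else None else None
  | Shr x y z =>
      if look e y is Some by_ then if look e z is Some bz then
        Some ((x, by_) :: e, ((wid by_).+1 + (wid bz).+1)%N)
      else None else None
  | ReadArr x a y =>
      if look e y is Some by_ then
        Some ((x, ea a) :: e, ((wid by_).+1 + (wid (ea a)).+1)%N)
      else None
  | WriteArr a y z =>
      if look e y is Some by_ then if look e z is Some bz then
        Some (e, ((wid by_).+1 + (wid bz).+1)%N)
      else None else None
  | Output x => if look e x is Some bx then Some (e, (wid bx).+1) else None
  end.

Fixpoint abs_block ea (l : seq instr) (e : env) : option (env * nat) :=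
  if l is i :: l' then
    if abs_instr ea i e is Some (e', c) then
      if abs_block ea l' e' is Some (e'', c') then Some (e'', (c + c')%N) else None
    else None
  else Some (e, 1%N).

Definition read_ok K (ea : nat -> bnd) (i : instr) (s : state) : Prop :=
  if i is ReadArr x a y then sat K (ea a) (arr s a (reg s y)) else True.

Fixpoint reads_ok K ea (l : seq instr) (s : state) : Prop :=
  if l is i :: l' then
    if i is ReadArr x a y then
      sat K (ea a) (arr s a (reg s y)) /\ reads_ok K ea l' (step i s)
    else reads_ok K ea l' (step i s)
  else True.

Lemma env_ok_set K e f x b v : env_ok K e f -> sat K b v ->
  env_ok K ((x, b) :: e) (fun r => if r == x then v else f r).
Proof.
move=> he hv r b' /=; case: eqP => _; first by case=> <-.
exact: he.
Qed.

Lemma absz_shr (v : int) k : (`|(v %/ 2 ^+ k)%Z| <= `|v|)%N.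
Proof.
have h : (0 < 2 ^+ k :> int) by rewrite exprn_gt0.
have := divz_eq v (2 ^+ k); have := modz_ge0 v (lt0r_neq0 h).
have := ltz_pmod v h.
set q := (v %/ _)%Z; set m := (v %% _)%Z; set w := 2 ^+ k in h * => m1 m2 e.
nia.
Qed.

Lemma abs_instr_ok K ea i e e' c s : (0 < K)%N ->
  abs_instr ea i e = Some (e', c) -> env_ok K e (reg s) -> read_ok K ea i s ->
  env_ok K e' (reg (step i s)) /\ (cost i s <= c * (K * bits K))%N.
Proof.
move=> K0 h he hr.
have KB : (K <= K * bits K)%N by rewrite leq_pmulr.
have lin2 w1 w2 b1 b2 : (b1 <= w1.+1 * K)%N -> (b2 <= w2.+1 * K)%N ->
    (b1 + b2 <= (w1.+1 + w2.+1) * (K * bits K))%N.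
  move=> h1 h2; apply: (@leq_trans ((w1.+1 + w2.+1) * K)).
    by rewrite mulnDl leq_add.
  by rewrite leq_mul2l KB orbT.
have bl y b : look e y = Some b -> (bitlen (reg s y) <= (wid b).+1 * K)%N.
  by move=> /he; apply: sat_bitlen.
have mx w1 w2 v : (`|v| < 2 ^ (w1 * K))%N \/ (`|v| < 2 ^ (w2 * K))%N ->
    (`|v| < 2 ^ (maxn w1 w2 * K))%N.
  by case=> hv; apply: leq_trans hv _; rewrite leq_exp2l // leq_mul2r ?leq_maxl ?leq_maxr orbT.
have addb (b1 b2 : bnd) (v1 v2 v : int) : (`|v| <= `|v1| + `|v2|)%N ->
    sat K b1 v1 -> sat K b2 v2 -> sat K (bnd_add b1 b2) v.
  move=> hv s1 s2.
  have gen : sat K (Bits (maxn (wid b1) (wid b2)).+1) v.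
    have h1 : (`|v1| < 2 ^ (maxn (wid b1) (wid b2) * K))%N.
      by apply: mx; left; exact: sat_wid.
    have h2 : (`|v2| < 2 ^ (maxn (wid b1) (wid b2) * K))%N.
      by apply: mx; right; exact: sat_wid.
    apply: leq_ltn_trans hv _; apply: (@leq_trans (2 ^ (maxn (wid b1) (wid b2) * K).+1)).
      by rewrite expnS mul2n -addnn; move: h1 h2; lia.
    by rewrite leq_exp2l // mulSn -add1n leq_add2r.
  case: b1 b2 s1 s2 gen => [c1|d1] [c2|d2] //= s1 s2 _.
  by rewrite mulnDl (leq_trans hv) // leq_add.
case: i h hr => [x v|x y z|x y z|x y z|x y z|x y z|x a y|a y z|x] /=.
- case=> <- <- _; split.
    apply: env_ok_set => //=; apply: leq_trans (bits_ltn _) _.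
    by rewrite leq_exp2l // leq_pmulr.
  by rewrite leq_pmulr // muln_gt0 K0.
- case ey: (look e y) => [b1|] //; case ez: (look e z) => [b2|] // [<- <-] _.
  split; last by apply: lin2; apply: bl.
  apply: env_ok_set => //; apply: addb (he _ _ ey) (he _ _ ez); lia.
- case ey: (look e y) => [b1|] //; case ez: (look e z) => [b2|] // [<- <-] _.
  split; last by apply: lin2; apply: bl.
  apply: env_ok_set => //; apply: addb (he _ _ ey) (he _ _ ez); lia.
- case ey: (look e y) => [b1|] //; case ez: (look e z) => [b2|] // [<- <-] _.
  split.
    apply: env_ok_set => //=; rewrite abszM mulnDl expnD.
    by apply: ltn_mul; apply: sat_wid; apply: he.
  (* The operands have at most [w * K] bits, and the logarithmic factor is at most bits w + bits K
     <= (w + 1) bits K; this gives the coefficient [w * w.+1]. *)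
  rewrite /mul_cost; set n := maxn _ _; set w := (maxn _ _).+1.
  have nw : (n <= w * K)%N.
    rewrite /n geq_max (leq_trans (bl _ _ ey)) ?(leq_trans (bl _ _ ez)) //.
      by rewrite leq_mul2r ltnS leq_maxr orbT.
    by rewrite leq_mul2r ltnS leq_maxl orbT.
  have bw : (bits n <= w.+1 * bits K)%N.
    apply: leq_trans (bits_mono nw) _; apply: leq_trans (bits_mul _ _) _.
    rewrite mulSn addnC leq_add2l; apply: leq_trans (bits_leid _) _ => //.
    by rewrite leq_pmulr.
  by apply: leq_trans (leq_mul nw bw) _; rewrite mulnACA.
- case ey: (look e y) => [b1|] //; case ez: (look e z) => [[//|d]|] // [<- <-] _.
  have dz := he _ _ ez; have dy := sat_wid (he _ _ ey); split.
    apply: env_ok_set => //=; rewrite abszM abszX mulnDl expnD.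
    apply: (@leq_trans (2 ^ (wid b1 * K) * 2 ^ `|reg s z|)).
      by rewrite ltn_mul2r dy expn_gt0.
    by rewrite leq_mul2l leq_exp2l ?dz ?orbT.
  apply: (@leq_trans (((wid b1).+1 + d.+1) * (K * bits K) + d * (K * bits K))).
    apply: leq_add; first by apply: lin2; [apply: bl | exact: (bl _ _ ez)].
    by apply: leq_trans dz _; rewrite leq_mul2l KB orbT.
  by rewrite -mulnDl.
- case ey: (look e y) => [b1|] //; case ez: (look e z) => [b2|] // [<- <-] _.
  split; last by apply: lin2; apply: bl.
  apply: env_ok_set => //; have := he _ _ ey; have := absz_shr (reg s y) `|reg s z|.
  case: (b1) => k /= h1 h2; [exact: leq_ltn_trans h1 h2 | exact: leq_trans h1 h2].
- case ey: (look e y) => [b1|] // [<- <-] hr.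
  split; last by apply: lin2; [apply: bl | apply: sat_bitlen].
  exact: env_ok_set.
- case ey: (look e y) => [b1|] //; case ez: (look e z) => [b2|] // [<- <-] _.
  by split=> //; apply: lin2; apply: bl.
- case ex: (look e x) => [b1|] // [<- <-] _; split=> //.
  by apply: leq_trans (bl _ _ ex) _; rewrite leq_mul2l KB orbT.
Qed.

Lemma abs_block_ok K ea l e e' c s : (0 < K)%N ->
  abs_block ea l e = Some (e', c) -> env_ok K e (reg s) -> reads_ok K ea l s ->
  env_ok K e' (reg (run l s)) /\ (bcost l s <= c * (K * bits K))%N.
Proof.
move=> K0; elim: l e e' s c => [|i l IH] e e' s c /=.
  by case=> <- <- he _; split=> //; rewrite mul1n muln_gt0 K0.
case h: (abs_instr ea i e) => [[e1 c1]|] //; case h2: (abs_block ea l e1) => [[e2 c2]|] //.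
case=> <- <- he hr.
have [r1 r2] : read_ok K ea i s /\ reads_ok K ea l (step i s).
  by case: (i) hr => //= x a y [].
have [he1 hc1] := abs_instr_ok K0 h he r1.
have [he2 hc2] := IH _ _ _ _ h2 he1 r2.
by split=> //; rewrite mulnDl leq_add.
Qed.

(** * Products of triangular matrices modulo a number *)

(** A triple [(f, s, g)] stands for the triangular matrix [[f, s], [0, g]]. *)
Definition tri (R : Type) := (R * R * R)%type.

Definition tone (R : comNzRingType) : tri R := (1, 0, 1).

Definition tmul (R : comNzRingType) (a b : tri R) : tri R :=
  (a.1.1 * b.1.1, a.1.1 * b.1.2 + a.1.2 * b.2, a.2 * b.2).

Section TriMonoid.
Context (R : comNzRingType).
Fact tmulA : associative (@tmul R).
Proof. by move=> [[a b] c] [[d e] f] [[g h] i]; rewrite /tmul /=; congr (_, _, _); ring. Qed.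
Fact tmul1l : left_id (@tone R) (@tmul R).
Proof. by move=> [[a b] c]; rewrite /tmul /=; congr (_, _, _); ring. Qed.
Fact tmul1r : right_id (@tone R) (@tmul R).
Proof. by move=> [[a b] c]; rewrite /tmul /=; congr (_, _, _); ring. Qed.
HB.instance Definition _ :=
  Monoid.isLaw.Build (tri R) (@tone R) (@tmul R) tmulA tmul1l tmul1r.
End TriMonoid.

Definition eqmod (n x y : int) : bool := (n %| x - y)%Z.

Lemma eqmod_refl n x : eqmod n x x.
Proof. by rewrite /eqmod subrr dvdz0. Qed.

Lemma eqmod_sym n x y : eqmod n x y -> eqmod n y x.
Proof. by rewrite /eqmod -rpredN opprB. Qed.

Lemma eqmod_trans n y x z : eqmod n x y -> eqmod n y z -> eqmod n x z.
Proof. by rewrite /eqmod => h1 h2; rewrite -(subrKA y) rpredD. Qed.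

Lemma eqmodM n x y x' y' : eqmod n x y -> eqmod n x' y' -> eqmod n (x * x') (y * y').
Proof.
rewrite /eqmod => h1 h2; have -> : x * x' - y * y' = x * (x' - y') + (x - y) * y' by ring.
by rewrite rpredD; [|exact: dvdz_mull|exact: dvdz_mulr].
Qed.

Lemma eqmodD n x y x' y' : eqmod n x y -> eqmod n x' y' -> eqmod n (x + x') (y + y').
Proof.
rewrite /eqmod => h1 h2; have -> : x + x' - (y + y') = (x - y) + (x' - y') by ring.
by rewrite rpredD.
Qed.

Lemma eqmod_dvd m n x y : (m %| n)%Z -> eqmod n x y -> eqmod m x y.
Proof. exact: dvdz_trans. Qed.

(** Only ratios of entries matter in the end, so triples are compared projectively. The unit sits on
    the side of the computed triple, where Montgomery reduction produces it. *)
Definition peq (n : nat) (a b : tri int) : Prop :=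
  exists2 u : int, coprimez u n &
    [/\ eqmod n (u * a.1.1) b.1.1, eqmod n (u * a.1.2) b.1.2 & eqmod n (u * a.2) b.2].

Lemma peq_refl n a : peq n a a.
Proof. by exists 1; rewrite ?coprimezE ?coprime1n // !mul1r !eqmod_refl. Qed.

Lemma peq_trans n b a c : peq n a b -> peq n b c -> peq n a c.
Proof.
move=> [u cu [u1 u2 u3]] [v cv [v1 v2 v3]]; exists (v * u); first by rewrite coprimezMl cv.
split; rewrite -mulrA;
  [apply: eqmod_trans v1 | apply: eqmod_trans v2 | apply: eqmod_trans v3];
  by apply: eqmodM; rewrite ?eqmod_refl.
Qed.

Lemma peq_dvd m n a b : (m %| n)%N -> peq n a b -> peq m a b.
Proof.
move=> mn [u cu [u1 u2 u3]]; exists u.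
  by move: cu; rewrite !coprimezE; apply: coprime_dvdr.
by split; [move: u1 | move: u2 | move: u3]; apply: eqmod_dvd.
Qed.

(** Each entry of [tmul] is bilinear in the two triples and is thus scaled by the product of the two
    units. *)
Lemma peqM n a b a' b' : peq n a b -> peq n a' b' -> peq n (tmul a a') (tmul b b').
Proof.
move=> [u cu [u1 u2 u3]] [v cv [v1 v2 v3]]; exists (u * v); first by rewrite coprimezMl cu.
rewrite /tmul /=; split; rewrite ?mulrDr.
- by rewrite mulrACA; apply: eqmodM.
- by rewrite (mulrACA u v a.1.1) (mulrACA u v a.1.2); apply: eqmodD; apply: eqmodM.
- by rewrite mulrACA; apply: eqmodM.
Qed.

(** Montgomery reduction: [redc n J k T * 2 ^ k = - T] modulo [n]; the scaling
    is harmless because triples only matter up to a unit. *)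
Definition redc (n J : int) (k : nat) (T : int) : int :=
  (((T * J - (T * J %/ 2 ^+ k)%Z * 2 ^+ k) * n - T)%R %/ 2 ^+ k)%Z.

Definition inv2 (k : nat) (n J : int) := eqmod (2 ^+ k) (n * J) 1.

Lemma pow2_gt0 k : 0 < 2 ^+ k :> int. Proof. by rewrite exprn_gt0. Qed.

(** With m = T J mod 2^k, the difference m n - T is divisible by 2^k and lies strictly between -2^k
    and (n + 1) 2^k. As T may have either sign, the result ranges over [0, n] with both ends
    included: zero modulo n has two representatives, which later tests must take into account. *)
Lemma redc_spec n J k T : 0 < n -> inv2 k n J -> `|T| < 2 ^+ k ->
  0 <= redc n J k T <= n /\ eqmod n (- 2 ^+ k * redc n J k T) T.
Proof.
move=> n0 hJ hT; rewrite /redc; have w0 := pow2_gt0 k; move: hJ hT w0.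
rewrite /inv2; set w := 2 ^+ k => hJ hT w0.
set m := T * J - _.
have em : m = (T * J %% w)%Z by [].
have m0 : 0 <= m by rewrite em modz_ge0 // lt0r_neq0.
have m1 : m < w by rewrite em ltz_pmod.
have d : (w %| m * n - T)%Z.
  have -> : m * n - T = T * (n * J - 1) - (T * J %/ w)%Z * n * w by rewrite /m; ring.
  by rewrite rpredB ?dvdz_mull.
have e := divzK d; set r := (_ %/ w)%Z in e *.
split; last first.
  rewrite /eqmod mulNr -mulrC; have -> : - (r * w) - T = - m * n by rewrite e; ring.
  by rewrite dvdz_mull.
by apply/andP; split; nia.
Qed.

Lemma redc_tri n J k (T : tri int) : (0 < n)%N -> odd n -> inv2 k n J ->
  `|T.1.1| < 2 ^+ k -> `|T.1.2| < 2 ^+ k -> `|T.2| < 2 ^+ k ->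
  peq n (redc n J k T.1.1, redc n J k T.1.2, redc n J k T.2) T.
Proof.
move=> n0 on hJ h1 h2 h3.
have [//|_ e1] := redc_spec _ hJ h1; have [//|_ e2] := redc_spec _ hJ h2.
have [//|_ e3] := redc_spec _ hJ h3.
by exists (- 2 ^+ k) => //; rewrite coprimezE abszN abszX coprimeXl // coprime2n.
Qed.

Definition newton (n : int) (k : nat) (y : int) : int :=
  let t := y * (2 - n * y) in t - (t %/ 2 ^+ k)%Z * 2 ^+ k.

(** The error is squared: n y (2 - n y) - 1 = - (n y - 1)^2. Here [j] is the old precision, [k'] the
    new one, and [k] the precision at which the result is truncated. *)
Lemma newtonP n k k' j y : (k' <= k)%N -> (k' <= j + j)%N -> inv2 j n y ->
  inv2 k' n (newton n k y) /\ 0 <= newton n k y < 2 ^+ k.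
Proof.
move=> k'k kj h; rewrite /newton /=; set t := y * _; have w0 := pow2_gt0 k.
split; last first.
  by rewrite -/((t %% _)%Z) modz_ge0 ?ltz_pmod // lt0r_neq0.
rewrite /inv2 /eqmod.
have -> : n * (t - (t %/ 2 ^+ k)%Z * 2 ^+ k) - 1 =
    - ((n * y - 1) * (n * y - 1)) - n * (t %/ 2 ^+ k)%Z * 2 ^+ k by rewrite /t; ring.
rewrite rpredB //; last by rewrite dvdz_mull // dvdz_exp2l.
by rewrite rpredN (dvdz_trans (dvdz_exp2l _ kj)) // exprD dvdz_mul.
Qed.

Lemma inv2M j n1 n2 y1 y2 : inv2 j n1 y1 -> inv2 j n2 y2 -> inv2 j (n1 * n2) (y1 * y2).
Proof. by move=> h1 h2; rewrite /inv2 mulrACA -[1]mulr1; apply: eqmodM. Qed.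

(** * Accumulating remainder trees *)

(** The tree is stored as a heap: the children of node [i] are [2 * i] and
    [2 * i + 1], the root is 1 and the leaf [q < 2 ^ h] is [2 ^ h + q]. *)
Section Heap.
Context (h : nat).

Definition hgt (i : nat) : nat := (h - trunc_log 2 i)%N.

Definition left_end (i : nat) : nat := (i * 2 ^ hgt i - 2 ^ h)%N.

Definition right_end (i : nat) : nat := (left_end i + 2 ^ hgt i)%N.

Lemma hgt_child i b : (0 < i < 2 ^ h)%N -> (b < 2)%N -> hgt i = (hgt (2 * i + b)).+1.
Proof.
move=> /andP[i0 ih] b2; rewrite /hgt.
have -> : trunc_log 2 (2 * i + b) = (trunc_log 2 i).+1.
  apply: trunc_log_eq => //; have := trunc_log_bounds (isT : (1 < 2)%N) i0.
  by move=> /=; rewrite !expnS; lia.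
suff : (trunc_log 2 i < h)%N by lia.
by rewrite -(@ltn_exp2l 2) //; apply: leq_ltn_trans ih; apply: trunc_logP.
Qed.

Lemma hgt_leaf q : (q < 2 ^ h)%N -> hgt (2 ^ h + q) = 0%N.
Proof.
move=> qh; rewrite /hgt (@trunc_log_eq 2 h) ?subnn // leq_addr expnS.
by move: qh; lia.
Qed.

Lemma hgt_lo i : (0 < i < 2 ^ h.+1)%N -> (2 ^ h <= i * 2 ^ hgt i)%N.
Proof.
move=> /andP[i0 ih]; have lh : (trunc_log 2 i <= h)%N.
  by rewrite -ltnS -(@ltn_exp2l 2) //; apply: leq_ltn_trans ih; apply: trunc_logP.
rewrite -{1}(subnKC lh) expnD leq_mul2r; apply/orP; right.
exact: trunc_logP.
Qed.

Lemma left_end_leaf q : (q < 2 ^ h)%N -> left_end (2 ^ h + q) = q.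
Proof. by move=> qh; rewrite /left_end hgt_leaf // muln1 addKn. Qed.

Lemma right_end_leaf q : (q < 2 ^ h)%N -> right_end (2 ^ h + q) = q.+1.
Proof. by move=> qh; rewrite /right_end left_end_leaf // hgt_leaf // addn1. Qed.

Lemma left_end_root : left_end 1 = 0%N.
Proof. by rewrite /left_end /hgt trunc_log1 subn0 mul1n subnn. Qed.

Lemma ends_child i : (0 < i < 2 ^ h)%N ->
  [/\ left_end (2 * i) = left_end i, right_end (2 * i) = left_end (2 * i + 1) &
      right_end (2 * i + 1) = right_end i].
Proof.
move=> hi; have /andP[i0 ih] := hi.
have h0 := hgt_child hi (isT : (0 < 2)%N); have h1 := hgt_child hi (isT : (1 < 2)%N).
rewrite addn0 in h0; have lo : (2 ^ h <= i * 2 ^ hgt i)%N.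
  by apply: hgt_lo; rewrite i0 expnS; lia.
rewrite /right_end /left_end; move: lo; rewrite h0.
have -> : hgt (2 * i + 1) = hgt (2 * i) by lia.
rewrite expnS => lo; set w := (2 ^ hgt _)%N in lo *.
have -> : ((2 * i + 1) * w = i * (2 * w) + w)%N by lia.
have -> : (2 * i * w = i * (2 * w))%N by lia.
by split; lia.
Qed.

Lemma heap_ind (P : nat -> Prop) :
  (forall q, (q < 2 ^ h)%N -> P (2 ^ h + q)%N) ->
  (forall i, (0 < i < 2 ^ h)%N -> P (2 * i)%N -> P (2 * i + 1)%N -> P i) ->
  forall i, (0 < i < 2 ^ h.+1)%N -> P i.
Proof.
move=> leaf node i; have [k] := ubnP (2 ^ h.+1 - i); elim: k i => // k IH i ik hi.
have [ih|ih] := ltnP i (2 ^ h).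
  have hi' : (0 < i < 2 ^ h)%N by lia.
  by apply: node => //; apply: IH; move: hi ih ik; rewrite expnS; lia.
rewrite -(subnKC ih); apply: leaf.
by move: hi ih; rewrite expnS; lia.
Qed.

Section Products.
Context (T : Type) (one : T) (op : Monoid.law one) (M : nat -> T).

Definition node_prod (i : nat) : T := \big[op/one]_(left_end i <= l < right_end i) M l.

Definition prefix_prod (i : nat) : T := \big[op/one]_(0 <= l < left_end i) M l.

Lemma node_prod_leaf q : (q < 2 ^ h)%N -> node_prod (2 ^ h + q) = M q.
Proof.
by move=> qh; rewrite /node_prod left_end_leaf // right_end_leaf // big_nat1.
Qed.

Lemma node_prod_node i : (0 < i < 2 ^ h)%N ->
  node_prod i = op (node_prod (2 * i)) (node_prod (2 * i + 1)).
Proof.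
move=> hi; have [e1 e2 e3] := ends_child hi.
rewrite /node_prod e1 e3 e2 -big_cat_nat //.
  by rewrite -e2 -e1 leq_addr.
by rewrite -e3 leq_addr.
Qed.

Lemma prefix_prod_root : prefix_prod 1 = one.
Proof. by rewrite /prefix_prod left_end_root big_geq. Qed.

Lemma prefix_prod_leaf q : (q < 2 ^ h)%N ->
  prefix_prod (2 ^ h + q) = \big[op/one]_(0 <= l < q) M l.
Proof. by move=> qh; rewrite /prefix_prod left_end_leaf. Qed.

Lemma prefix_prod_left i : (0 < i < 2 ^ h)%N -> prefix_prod (2 * i) = prefix_prod i.
Proof. by move=> hi; have [e1 _ _] := ends_child hi; rewrite /prefix_prod e1. Qed.

Lemma prefix_prod_right i : (0 < i < 2 ^ h)%N ->
  prefix_prod (2 * i + 1) = op (prefix_prod i) (node_prod (2 * i)).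
Proof.
move=> hi; have [e1 e2 _] := ends_child hi; rewrite /prefix_prod /node_prod -e1 -e2.
by rewrite -big_cat_nat // leq_addr.
Qed.

End Products.

(** Every level of the tree has total width 2^h. With a cost per node proportional to its width,
    this is the source of the factor [h] in the cost of a sweep. *)
Lemma sum_hgt d : (d <= h)%N ->
  (\sum_(j < 2 ^ d - 1) 2 ^ hgt j.+1 = d * 2 ^ h)%N.
Proof.
elim: d => [|d IH] dh; first by rewrite big_ord0.
have -> : (2 ^ d.+1 - 1 = (2 ^ d - 1) + 2 ^ d)%N.
  by have := expn_gt0 2 d; rewrite expnS; lia.
rewrite big_split_ord /= IH ?(ltnW dh) // mulSn addnC; congr (_ + _)%N.
rewrite (eq_bigr (fun=> 2 ^ (h - d))%N) => [|[j /= jd] _].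
  by rewrite sum_nat_const card_ord -expnD subnKC // ltnW.
rewrite /hgt (@trunc_log_eq 2 d) // expnS; have := expn_gt0 2 d; lia.
Qed.

End Heap.

(** The bit held back by [.-1] pays for the sum of two products in the middle entry: 2 * 2^(w-1) *
    2^(w-1) = 2^(2w-1), so the bound reproduces itself at the parent. *)
Lemma tri_prod_bound (h a0 : nat) (M : nat -> tri int) : (0 < a0)%N ->
  (forall q, (q < 2 ^ h)%N ->
     [/\ `|(M q).1.1| < 2 ^ a0.-1, `|(M q).1.2| < 2 ^ a0.-1 & `|(M q).2| < 2 ^ a0.-1]%N) ->
  forall i, (0 < i < 2 ^ h.+1)%N ->
    let T := node_prod h (@tmul int) M i in let B := (2 ^ (a0 * 2 ^ hgt h i).-1)%N in
    [/\ `|T.1.1| < B, `|T.1.2| < B & `|T.2| < B]%N.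
Proof.
move=> a00 hM; apply: heap_ind => [q qh|i hi] /=.
  by rewrite node_prod_leaf // hgt_leaf // muln1; apply: hM.
rewrite (node_prod_node _ _ hi) (hgt_child hi (isT : (1 < 2)%N)) (_ : hgt h (2 * i) = hgt h (2 * i + 1)); last first.
  by have := hgt_child hi (isT : (1 < 2)%N); have := hgt_child hi (isT : (0 < 2)%N); rewrite addn0; lia.
set w := (a0 * 2 ^ hgt h (2 * i + 1))%N.
have w0 : (0 < w)%N by rewrite muln_gt0 a00 expn_gt0.
have -> : (2 ^ (a0 * 2 ^ (hgt h (2 * i + 1)).+1).-1 = 2 * (2 ^ w.-1 * 2 ^ w.-1))%N.
  by rewrite expnS mulnCA -/w -expnD -expnS; congr (2 ^ _)%N; lia.
move: (2 ^ w.-1)%N (node_prod _ _ _ (2 * i)) (node_prod _ _ _ (2 * i + 1)) => B a b.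
move=> [a1 a2 a3] [b1 b2 b3]; rewrite /tmul /=; split; rewrite ?abszM.
- by apply: leq_trans (ltn_mul a1 b1) _; lia.
- have tr (x y : int) : (`|(x + y)%R| <= `|x| + `|y|)%N by lia.
  apply: leq_ltn_trans (tr _ _) _; rewrite !abszM [(2 * (B * B))%N]mul2n -addnn -addSn.
  by apply: leq_add; [|apply: ltnW]; apply: ltn_mul.
- by apply: leq_trans (ltn_mul a3 b3) _; lia.
Qed.

Lemma node_prod_lt (h b0 : nat) (n_ : nat -> nat) :
  (forall q, (q < 2 ^ h)%N -> (n_ q < 2 ^ b0)%N) ->
  forall i, (0 < i < 2 ^ h.+1)%N -> (node_prod h muln n_ i < 2 ^ (b0 * 2 ^ hgt h i))%N.
Proof.
move=> hn; apply: heap_ind => [q qh|i hi h1 h2].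
  by rewrite node_prod_leaf // hgt_leaf // muln1; apply: hn.
rewrite (node_prod_node _ _ hi) (hgt_child hi (isT : (1 < 2)%N)) expnS mulnCA (mul2n (b0 * _)) -addnn expnD.
move: h1; rewrite (_ : hgt h (2 * i) = hgt h (2 * i + 1)); first by move=> h1; apply: ltn_mul.
by have := hgt_child hi (isT : (1 < 2)%N); have := hgt_child hi (isT : (0 < 2)%N); rewrite addn0; lia.
Qed.

Lemma node_prod_odd (h : nat) (n_ : nat -> nat) : (forall q, odd (n_ q)) ->
  forall i, odd (node_prod h muln n_ i).
Proof.
move=> hn i; rewrite /node_prod; elim/big_ind: _ => // x y.
by rewrite oddM => -> ->.
Qed.

(** * The leaves: moduli, their inverses modulo a power of 2, and the triples *)

Record component := Component {
  numc : int; nums : seq int; wt : int; denc : int; dens : seq int; bdry : tri int }.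

Definition lin (N : nat) (q : nat) (cst : int) (l : seq int) : int :=
  cst * \prod_(a <- l) ((N * q)%:Z + a).

(** One step of the recursion inside an interval: [numc] and [nums] give the numerator f as a
    product of linear factors in the index, [denc] and [dens] the denominator g, and [wt] the weight
    of the term. The field [bdry] is a fixed triple multiplied in after the last step. *)
Definition leaf (N : nat) (cp : component) (q : nat) : tri int :=
  let g := lin N q (denc cp) (dens cp) in
  (lin N q (numc cp) (nums cp), wt cp * g, g).

Definition lin_block (x : nat) (cst : int) (l : seq int) : seq instr :=
  Const x cst :: flatten [seq [:: Const 13 a; Add 13 13 8; Mul x x 13] | a <- l].

Definition bcoef ea l e : nat := if abs_block ea l e is Some (_, c) then c else 0%N.

Lemma runs_abs K ea l e s (Q : state -> Prop) : (0 < K)%N ->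
  isSome (abs_block ea l e) -> env_ok K e (reg s) -> reads_ok K ea l s -> Q (run l s) ->
  runs (block l) s (bcoef ea l e * (K * bits K)) Q.
Proof.
move=> K0; rewrite /bcoef; case h: abs_block => [[e' c]|] // _ he hr q.
by have [_ h'] := abs_block_ok K0 h he hr; apply: runs_block.
Qed.

Fixpoint env_all K (e : env) (f : nat -> int) : Prop :=
  if e is (x, b) :: e' then sat K b (f x) /\ env_all K e' f else True.

Lemma env_allP K e f : env_all K e f -> env_ok K e f.
Proof.
elim: e => [|[x b] e IH] //= [h1 /IH h2] r b' /=.
by case: eqP => [->|_]; [case=> <-|exact: h2].
Qed.

Lemma sat_const K v : (0 < K)%N -> sat K (Bits (bitlen v)) v.
Proof.
move=> K0 /=; apply: leq_trans (bits_ltn _) _.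
by rewrite leq_exp2l // leq_pmulr.
Qed.

(** The length of this block depends on the datum, so its analysis cannot be evaluated outright;
    induction on the list shows that it succeeds once register 8 has a bound. *)
Lemma abs_lin ea x cst l e b : x != 13%N -> x != 8%N -> look e 8 = Some b ->
  exists e' c, [/\ abs_block ea (lin_block x cst l) e = Some (e', c), isSome (look e' x) &
    forall r, r != 13%N -> r != x -> look e' r = look e r].
Proof.
move=> x13 x8 h8; rewrite /lin_block /=.
pose e1 := (x, Bits (bitlen cst)) :: e.
suff: forall l e1, isSome (look e1 x) -> look e1 8 = Some b ->
    exists e' c, [/\ abs_block ea (flatten [seq [:: Const 13 a; Add 13 13 8; Mul x x 13] | a <- l]) e1
      = Some (e', c), isSome (look e' x) & forall r, r != 13%N -> r != x -> look e' r = look e1 r].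
  case/(_ l e1) => [||e' [c [-> h1 h2]]].
  - by rewrite /= eqxx.
  - by rewrite /= eq_sym (negPf x8).
  - exists e', (bitlen cst + c)%N; split=> // r r13 rx; rewrite h2 //=.
    by rewrite (negPf rx).
elim=> {l e1} [|a l IH] e1 hx h81; first by exists e1, 1%N.
rewrite /= h81 /= (negPf x13).
move: hx; case ex: (look e1 x) => [bx|] // _.
set e2 := (x, _) :: _; case: (IH e2) => [||e' [c [h1 h2 h3]]].
- by rewrite /= eqxx.
- by rewrite /= eq_sym (negPf x8).
rewrite h1; eexists _, _; split; [reflexivity|by []|].
move=> r r13 rx; rewrite h3 //= (negPf rx) (negPf r13) //.
Qed.

Lemma run_lin x cst l s : x != 13%N -> x != 8%N ->
  let s' := run (lin_block x cst l) s in
  [/\ reg s' x = cst * \prod_(a <- l) (reg s 8 + a),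
      forall r, r != x -> r != 13%N -> reg s' r = reg s r, arr s' = arr s & out s' = out s].
Proof.
move=> x13 x8; rewrite /lin_block /=.
suff: forall l s, let s' := run (flatten [seq [:: Const 13 a; Add 13 13 8; Mul x x 13] | a <- l]) s in
  [/\ reg s' x = reg s x * \prod_(a <- l) (reg s 8 + a),
      forall r, r != x -> r != 13%N -> reg s' r = reg s r, arr s' = arr s & out s' = out s].
  case/(_ l (set_reg s x cst)) => -> h2 -> ->; split=> //=.
    by rewrite eqxx eq_sym (negPf x8).
  by move=> r rx r13; rewrite h2 //= (negPf rx).
elim=> {l s} [|a l IH] s /=; first by split=> //; rewrite big_nil mulr1.
set s1 := set_reg _ x _; have [h1 h2 h3 h4] := IH s1.
have e8 : reg s1 8 = reg s 8 by rewrite /= (eq_sym 8%N) (negPf x8).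
have ex : reg s1 x = reg s x * (reg s 8 + a).
  by rewrite /= eqxx (negPf x13) addrC.
split; [|by move=> r rx r13; rewrite h2 //= (negPf rx) (negPf r13)|by rewrite h3|by rewrite h4].
by rewrite h1 e8 ex big_cons mulrA.
Qed.

Lemma lin_block_coef ea x cst l e b K s : (0 < K)%N -> x != 13%N -> x != 8%N ->
  look e 8 = Some b -> env_ok K e (reg s) ->
  (bcost (lin_block x cst l) s <= bcoef ea (lin_block x cst l) e * (K * bits K))%N.
Proof.
move=> K0 x13 x8 h8 he; have [e' [c [h _ _]]] := abs_lin ea cst l x13 x8 h8.
rewrite /bcoef h; have [|_ //] := abs_block_ok K0 h he.
rewrite /lin_block /=; elim: (l) (set_reg _ _ _) => //= a l' IH s'; exact: IH.
Qed.

Definition leaf_a (N c : nat) : seq instr :=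
  [:: Const 7 1; Diff 5 4 7; Add 6 1 5; Const 8 N%:Z; Mul 8 8 5; Const 9 c%:Z;
      Add 9 8 9; WriteArr 0 6 9; WriteArr 2 6 3; Const 10 2; Const 11 1;
      Const 12 0; Add 12 12 3].

Definition newton_body : seq instr :=
  [:: Mul 13 9 11; Diff 13 10 13; Mul 11 11 13; Shr 13 11 3; Shl 13 13 3;
      Diff 11 11 13; Diff 12 12 7].

Definition leaf_b (w : int) : seq instr :=
  [:: Const 13 w; Mul 16 13 15; WriteArr 1 6 11; WriteArr 3 6 14; WriteArr 4 6 16;
      WriteArr 5 6 15; Diff 4 4 7].

Definition leaf_body N c cp : program :=
  Seq (block (leaf_a N c))
  (Seq (While 12 (block newton_body))
  (Seq (block (lin_block 14 (numc cp) (nums cp)))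
  (Seq (block (lin_block 15 (denc cp) (dens cp)))
       (block (leaf_b (wt cp)))))).

Definition leaf_loop N c cp : program :=
  Seq (block [:: Const 4 0; Add 4 4 1]) (While 4 (leaf_body N c cp)).

Definition nmod (N c q : nat) : nat := (N * q + c)%N.

(** Throughout, registers 1 and 3 hold [2 ^ h] and [k0].  At node [i], arrays
    0 to 2 hold the product of the moduli, its inverse modulo [2 ^ k], and
    [k]; arrays 3 to 5 the product of the triples, arrays 6 to 8 the prefix
    product modulo the modulus of the node.  At leaf [q], arrays 9 to 11 hold
    the product accumulated over the components, and array 12 is 0 precisely
    when the modulus is prime. *)
Definition node_ok h k0 (n_ : nat -> nat) (M : nat -> tri int) (s : state) (i : nat) : Prop :=
  [/\ arr s 0 i%:Z = (node_prod h muln n_ i)%:Z,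
      arr s 2 i%:Z = (k0 * 2 ^ hgt h i)%:Z,
      inv2 (k0 * 2 ^ hgt h i) (node_prod h muln n_ i)%:Z (arr s 1 i%:Z),
      0 <= arr s 1 i%:Z < 2 ^+ (k0 * 2 ^ hgt h i) &
      (arr s 3 i%:Z, arr s 4 i%:Z, arr s 5 i%:Z) = node_prod h (@tmul int) M i].

Lemma sat1_nat K n : (n < 2 ^ K)%N -> sat K (Bits 1) n%:Z.
Proof. by rewrite /= mul1n. Qed.

Lemma sat1_mag K n : (n <= K)%N -> sat K (Mag 1) n%:Z.
Proof. by rewrite /= mul1n. Qed.

Lemma sat1_int K (v : int) : (`|v| < 2 ^ K)%N -> sat K (Bits 1) v.
Proof. by rewrite /= mul1n. Qed.

Lemma pow2Z k : (2 ^ k)%N%:Z = 2 ^+ k.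
Proof. by rewrite -natz natrX. Qed.

Lemma absz_lt (v : int) k : 0 <= v < 2 ^+ k -> (`|v| < 2 ^ k)%N.
Proof.
by move=> /andP[v0 vk]; rewrite -ltz_nat gez0_abs // pow2Z.
Qed.

Definition newton_env : env :=
  [:: (9, Bits 1); (11, Bits 1); (10, Bits (bitlen 2)); (3, Mag 1); (12, Mag 1);
      (7, Bits (bitlen 1))].

Lemma newton_loop_runs (k0 n : nat) s : (0 < k0)%N -> odd n -> (n < 2 ^ k0)%N ->
  reg s 3 = k0%:Z -> reg s 9 = n%:Z -> reg s 10 = 2 -> reg s 11 = 1 ->
  reg s 12 = k0%:Z -> reg s 7 = 1 ->
  runs (While 12 (block newton_body)) s
    ((bcoef (fun=> Bits 1) newton_body newton_env + 4) * (k0 * (k0 * bits k0)))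
    (fun s' => [/\ forall r, r \notin [:: 11; 12; 13]%N -> reg s' r = reg s r,
      arr s' = arr s, out s' = out s, inv2 k0 n%:Z (reg s' 11) &
      0 <= reg s' 11 < 2 ^+ k0]).
Proof.
move=> k00 on nk h3 h9 h10 h11 h12 h7.
(* The invariant records one more correct bit per round, although a round doubles the precision:
   [k0] rounds are affordable at a leaf. The starting value 1 is an inverse modulo 2 because [n] is
   odd. *)
pose I j s' := [/\ (j <= k0)%N, reg s' 12 = j%:Z,
  forall r, r \notin [:: 11; 12; 13]%N -> reg s' r = reg s r,
  arr s' = arr s /\ out s' = out s &
  inv2 (minn k0 (k0 - j).+1) n%:Z (reg s' 11) /\ 0 <= reg s' 11 < 2 ^+ k0].
apply: runs_weaken (@runs_while 12 _ I
  (fun=> bcoef (fun=> Bits 1) newton_body newton_env * (k0 * bits k0))%N (2 * k0) k0 _ _ _ _) _ _.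
- move=> j s' [jk -> _ _ _]; apply: (@sat_bitlen _ (Mag 1)) => //; exact: sat1_mag.
- move=> [|j] s' [jk h12' hr [ha ho] [hi hb]]; rewrite h12' // => _.
  exists j => //; apply: runs_abs => //.
    apply: env_allP; rewrite /env_all /newton_env h12'.
    rewrite (hr 9%N) // (hr 10%N) // (hr 3%N) // (hr 7%N) // h3 h9 h10 h7.
    split; first exact: sat1_nat.
    split; first by apply: sat1_int; apply: absz_lt.
    split; first exact: sat_const.
    split; first exact: sat1_mag.
    split; first exact: sat1_mag.
    by split; first exact: sat_const.
  split=> /=; first exact: ltnW.
  + by rewrite h12' (hr 7%N) // h7; lia.
  + move=> r hr0; move: (hr0); rewrite !inE !negb_or => /and3P[/negPf-> /negPf-> /negPf->].
    exact: hr.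
  + by [].
  rewrite (hr 9%N) // (hr 10%N) // (hr 3%N) // h3 h9 h10 absz_nat -/(newton _ _ _).
  by apply: newtonP hi; rewrite ?geq_minl //; lia.
- split=> //; rewrite h11 subnn; split; last first.
    by rewrite -pow2Z ltz_nat -{1}(expn0 2) ltn_exp2l.
  rewrite (minn_idPr k00) /inv2 /eqmod mulr1 expr1; case: n on {nk h9 I} => // n /= on.
  by rewrite (_ : n.+1%:Z - 1 = n%:Z) ?dvdzE /= ?dvdn2 //; lia.
- rewrite sum_nat_const card_ord; move: (bcoef _ _ _) (bits k0) (bits_gt0 k0) => a b b0.
  have e1 : (k0 <= k0 * k0)%N by rewrite leq_pmulr.
  have e2 : (k0 * k0 <= k0 * (k0 * b))%N by rewrite leq_mul2l leq_pmulr ?orbT.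
  by rewrite mulnDr mulnCA mulnDl -addnA leq_add2l mulnCA; lia.
- move=> s' [[|j] [jk h12' hr [ha ho] [hi hb]]]; rewrite h12' // => _.
  by split=> //; move: hi; rewrite subn0 (minn_idPl (leqnSn _)).
Qed.

Definition frame_at (mods : nat) (i : int) (s s' : state) : Prop :=
  [/\ forall r, (r < 4)%N -> reg s' r = reg s r, out s' = out s &
      forall a k, (a < mods)%N && (k == i) = false -> arr s' a k = arr s a k].

Lemma node_ok_ext h k0 n_ M s s' (i : nat) :
  (forall a, (a < 6)%N -> arr s' a i = arr s a i) ->
  node_ok h k0 n_ M s i -> node_ok h k0 n_ M s' i.
Proof. by move=> e; rewrite /node_ok !e. Qed.

Definition leaf_a_env : env := [:: (1, Bits 1); (3, Mag 1); (4, Bits 1)].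
Definition lin_env : env := [:: (8, Bits 1)].
Definition ea1 : nat -> bnd := fun=> Bits 1.

(* [leaf_b] runs right after the two products, whose widths only
   [abs_block] knows. *)
Definition prod_env cp : env :=
  if abs_block ea1 (lin_block 14 (numc cp) (nums cp)) lin_env is Some (e, _) then e else [::].
Definition prod_env2 cp : env :=
  if abs_block ea1 (lin_block 15 (denc cp) (dens cp)) lin_env is Some (e, _) then e else [::].

Definition leaf_b_env cp : env :=
  [:: (1, Bits 1); (4, Bits 1); (6, Bits 1); (7, Bits (bitlen 1)); (11, Bits 1);
      (14, odflt (Bits 1) (look (prod_env cp) 14));
      (15, odflt (Bits 1) (look (prod_env2 cp) 15))].

Lemma lin_sat K x cst l s : (0 < K)%N -> x != 13%N -> x != 8%N ->
  sat K (Bits 1) (reg s 8) ->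
  let e := if abs_block ea1 (lin_block x cst l) lin_env is Some (e, _) then e else [::] in
  sat K (odflt (Bits 1) (look e x)) (cst * \prod_(a <- l) (reg s 8 + a)).
Proof.
move=> K0 x13 x8 h8.
have [e' [c [h hx _]]] := abs_lin ea1 cst l x13 x8 (erefl : look lin_env 8 = Some (Bits 1)).
rewrite h /=; case e: (look e' x) hx => [b|] // _.
have [||he _] := abs_block_ok (s := s) K0 h.
- by apply: env_allP.
- by rewrite /lin_block /=; elim: (l) (set_reg _ _ _) => //= a l' IH s'; exact: IH.
have [<- _ _ _] := run_lin cst l s x13 x8.
exact: he.
Qed.

Lemma leaf_body_runs (N c : nat) (cp : component) : ~~ odd N -> odd c -> exists C, forall h k0 q s,
  (h < k0)%N -> (forall q, (q < 2 ^ h)%N -> (nmod N c q < 2 ^ k0)%N) -> (q < 2 ^ h)%N ->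
  reg s 1 = (2 ^ h)%N%:Z -> reg s 3 = k0%:Z -> reg s 4 = q.+1%:Z ->
  runs (leaf_body N c cp) s (C * (k0 * (k0 * bits k0)))
    (fun s' => [/\ reg s' 4 = q%:Z, frame_at 6 (2 ^ h + q)%N s s' &
       node_ok h k0 (nmod N c) (leaf N cp) s' (2 ^ h + q)]).
Proof.
move=> eN oc; pose c1 := bcoef ea1 (leaf_a N c) leaf_a_env.
pose c2 := bcoef ea1 newton_body newton_env.
pose c3 := bcoef ea1 (lin_block 14 (numc cp) (nums cp)) lin_env.
pose c4 := bcoef ea1 (lin_block 15 (denc cp) (dens cp)) lin_env.
pose c5 := bcoef ea1 (leaf_b (wt cp)) (leaf_b_env cp).
exists (c1 + ((c2 + 4) + (c3 + (c4 + c5))))%N => h k0 q s hk hn qh h1 h3 h4.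
have k00 : (0 < k0)%N by apply: leq_ltn_trans hk.
have hpow : (2 ^ h + 2 ^ h <= 2 ^ k0)%N by rewrite addnn -mul2n -expnS leq_exp2l.
have sNq : (N * q < 2 ^ k0)%N by apply: leq_ltn_trans (hn _ qh); rewrite leq_addr.
set U := (k0 * (k0 * bits k0))%N.
have UT T P s0 (Q : state -> Prop) : runs P s0 (T * (k0 * bits k0)) Q -> runs P s0 (T * U) Q.
  by move=> hr; apply: runs_weaken hr _ _ => //; rewrite leq_mul2l leq_pmull ?orbT.
have -> : ((c1 + ((c2 + 4) + (c3 + (c4 + c5)))) * U =
  c1 * U + ((c2 + 4) * U + (c3 * U + (c4 * U + c5 * U))))%N by rewrite !mulnDl.
apply: (@runs_seq _ _ _ _ _ (fun s1 =>
  [/\ [/\ reg s1 6 = (2 ^ h + q)%N%:Z, reg s1 8 = (N * q)%N%:Z, reg s1 9 = (nmod N c q)%:Z &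
      reg s1 10 = 2],
      [/\ reg s1 11 = 1, reg s1 12 = k0%:Z & reg s1 7 = 1], reg s1 4 = q.+1%:Z,
      frame_at 6 (2 ^ h + q)%N s s1 &
      arr s1 0 (2 ^ h + q)%N%:Z = (nmod N c q)%:Z /\ arr s1 2 (2 ^ h + q)%N%:Z = k0%:Z])).
  apply: UT; apply: runs_abs => //.
    apply: env_allP; rewrite /env_all /leaf_a_env h1 h3 h4.
    split; first by apply: sat1_nat; lia.
    split; first exact: sat1_mag.
    by split=> //; apply: sat1_nat; lia.
  have e1 : q.+1%:Z - 1 = q%:Z by lia.
  rewrite /= h1 h3 h4 e1 add0r /nmod !PoszD PoszM; split=> //.
    split=> //=; first by move=> [|[|[|[|r]]]].
    by move=> a k; case: (k == _); rewrite ?andbF // !andbT; case: a => [|[|[|a]]].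
  by rewrite !eqxx.
move=> s1 [[r6 r8 r9 r10] [r11 r12 r7] r4 [f1 f2 f3] [a0 a2]].
have r3 : reg s1 3 = k0%:Z by rewrite f1.
apply: (@runs_seq _ _ _ _ _ (fun s2 =>
  [/\ [/\ reg s2 6 = (2 ^ h + q)%N%:Z, reg s2 8 = (N * q)%N%:Z & reg s2 7 = 1],
      inv2 k0 (nmod N c q)%:Z (reg s2 11), 0 <= reg s2 11 < 2 ^+ k0, reg s2 4 = q.+1%:Z &
      frame_at 6 (2 ^ h + q)%N s s2 /\ arr s2 = arr s1])).
  have on : odd (nmod N c q) by rewrite /nmod oddD oddM (negPf eN) oc.
  apply: runs_weaken (newton_loop_runs k00 on (hn _ qh) r3 r9 r10 r11 r12 r7) _ _ => //.
  move=> s2 [g1 g2 g3 g4 g5]; split=> //; rewrite ?g1 //.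
  by split=> //; split=> [r hr||a k hk']; rewrite ?g1 ?g2 ?g3 ?f1 ?f2 ?f3 //; case: r hr => [|[|[|[]]]].
move=> s2 [{r6 r8 r9 r10 r11 r12 r7 r4 f1 f2 f3 r3}[r6 r8 r7] hi hb r4 [[f1 f2 f3] ea]].
have sat8 s0 : reg s0 8 = (N * q)%N%:Z -> sat k0 (Bits 1) (reg s0 8).
  by move=> ->; apply: sat1_nat.
apply: (@runs_seq _ _ _ _ _ (fun s3 =>
  [/\ reg s3 14 = lin N q (numc cp) (nums cp), forall r, r != 13%N -> r != 14%N -> reg s3 r = reg s2 r,
      arr s3 = arr s2 & out s3 = out s2])).
  apply: UT; have [//|//|g1 g2 g3 g4] := run_lin (x := 14) (numc cp) (nums cp) s2.
  apply: runs_block; last by split=> //; [rewrite g1 r8|move=> r ??; apply: g2].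
  by apply: (@lin_block_coef _ _ _ _ _ (Bits 1)) => //; apply: env_allP; split=> //; apply: sat8.
move=> s3 [r14 g1 g2 g3].
apply: (@runs_seq _ _ _ _ _ (fun s4 =>
  [/\ reg s4 15 = lin N q (denc cp) (dens cp), forall r, r != 13%N -> r != 15%N -> reg s4 r = reg s3 r,
      arr s4 = arr s3 & out s4 = out s3])).
  have r8' : reg s3 8 = (N * q)%N%:Z by rewrite g1.
  apply: UT; have [//|//|k1 k2 k3 k4] := run_lin (x := 15) (denc cp) (dens cp) s3.
  apply: runs_block; last by split=> //; [rewrite k1 r8'|move=> r ??; apply: k2].
  by apply: (@lin_block_coef _ _ _ _ _ (Bits 1)) => //; apply: env_allP; split=> //; apply: sat8.
move=> s4 [r15 k1 k2 k3].
have R r : r \notin [:: 13; 14; 15]%N -> reg s4 r = reg s2 r.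
  by rewrite !inE !negb_or => /and3P[r1 r2 r5]; rewrite k1 // g1.
have r14' : reg s4 14 = lin N q (numc cp) (nums cp) by rewrite k1.
have s8 : sat k0 (Bits 1) (reg s2 8) by apply: sat8.
apply: UT; apply: runs_abs => //.
  apply: env_allP; rewrite /env_all /leaf_b_env r14' r15 (R 1%N) // (R 4%N) // (R 6%N) // (R 7%N) // (R 11%N) //.
  rewrite r4 r6 r7 f1 // h1.
  split; first by apply: sat1_nat; lia.
  split; first by apply: sat1_nat; lia.
  split; first by apply: sat1_nat; lia.
  split; first exact: sat_const.
  split; first by apply: sat1_int; apply: absz_lt.
  split; first by rewrite /lin -r8; apply: lin_sat.
  by split=> //; rewrite /lin -r8; apply: lin_sat.
split.
- by rewrite /= (R 4%N) // (R 7%N) // r4 r7; lia.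
- split=> [r hr||a k hk'].
  + by case: r hr => [|[|[|[|r]]]] // _; rewrite /= R ?f1.
  + by rewrite /= k3 g3 f2.
  rewrite -(f3 _ _ hk') -g2 -k2 /= (R 6%N) // r6; move: hk'.
  by case: (k == _); rewrite ?andbF // !andbT; case: a => [|[|[|[|[|[|a]]]]]].
rewrite /node_ok /= hgt_leaf // !muln1 !node_prod_leaf // (R 6%N) // (R 11%N) // r6 !eqxx r14' r15.
by rewrite k2 g2 ea.
Qed.

Lemma frame_at_same m i s s' : frame_at m i s s' -> same (iota 0 m) s s'.
Proof.
move=> [f1 f2 f3]; split=> // a; rewrite mem_iota /= add0n => am.
by apply/funext => k; apply: f3; rewrite (negPf am).
Qed.

Lemma node_ok_frame h k0 n_ M s s' (i i' : nat) : i <> i' -> frame_at 6 i s s' ->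
  node_ok h k0 n_ M s i' -> node_ok h k0 n_ M s' i'.
Proof.
move=> ii' [_ _ f]; apply: node_ok_ext => a _; apply: f.
by rewrite eqz_nat; case: eqP => [e|_]; [case: ii'|rewrite andbF].
Qed.

Lemma leaf_loop_runs (N c : nat) (cp : component) : ~~ odd N -> odd c -> exists C, forall h k0 s,
  (h < k0)%N -> (forall q, (q < 2 ^ h)%N -> (nmod N c q < 2 ^ k0)%N) ->
  reg s 1 = (2 ^ h)%N%:Z -> reg s 3 = k0%:Z ->
  runs (leaf_loop N c cp) s (C * (2 ^ h * (k0 * (k0 * bits k0))))
    (fun s' => same (iota 0 6) s s' /\
       forall q, (q < 2 ^ h)%N -> node_ok h k0 (nmod N c) (leaf N cp) s' (2 ^ h + q)).
Proof.
move=> eN oc; have [C hC] := leaf_body_runs cp eN oc.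
pose l0 := [:: Const 4 0; Add 4 4 1]; pose e0 : env := [:: (1, Bits 1)].
exists (bcoef ea1 l0 e0 + (C + 4))%N => h k0 s hk hn h1 h3.
have k00 : (0 < k0)%N by apply: leq_ltn_trans hk.
have hpow : (2 ^ h < 2 ^ k0)%N by rewrite ltn_exp2l.
have p0 : (0 < 2 ^ h)%N by rewrite expn_gt0.
rewrite mulnDl; apply: (@runs_seq _ _ _ _ _ (fun s1 =>
  reg s1 4 = (2 ^ h)%N%:Z /\ same (iota 0 6) s s1)).
  apply: runs_weaken (_ : runs _ _ (bcoef ea1 l0 e0 * (k0 * bits k0)) _) _ (fun s1 => id).
    apply: runs_abs => //.
      by apply: env_allP; split=> //; rewrite h1; apply: sat1_nat.
    split; first by rewrite /= h1 add0r.
    by split=> //= [[|[|[|[|r]]]]].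
  by rewrite leq_mul2l -[X in (X <= _)%N]mul1n leq_mul ?leq_pmull ?orbT.
move=> s1 [h4 sm].
pose I j s' := [/\ (j <= 2 ^ h)%N, reg s' 4 = j%:Z, same (iota 0 6) s s' &
  forall q, (j <= q < 2 ^ h)%N -> node_ok h k0 (nmod N c) (leaf N cp) s' (2 ^ h + q)].
apply: runs_weaken (@runs_while 4 _ I (fun=> C * (k0 * (k0 * bits k0)))%N (2 * k0) (2 ^ h) s1 _ _ _) _ _.
- move=> j s' [jk -> _ _]; apply: (@sat_bitlen _ (Bits 1)) => //; apply: sat1_nat.
  exact: leq_ltn_trans hpow.
- move=> [|j] s' [jh r4 sm' ok]; rewrite r4 // => _; exists j => //.
  have [r _ _] := sm'.
  apply: runs_weaken (hC h k0 j s' hk hn jh _ _ r4) (leqnn _) _; rewrite ?r //.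
  move=> s2 [r4' fr ok']; split=> //; first exact: ltnW.
    by apply: same_trans sm' (frame_at_same fr).
  move=> q /andP[]; rewrite leq_eqVlt => /orP[/eqP<- _ //|jq qh].
  apply: node_ok_frame fr (ok _ _); last by rewrite jq.
  by move=> e; move: jq; lia.
- by split=> // q /andP[hq /(leq_ltn_trans hq)]; rewrite ltnn.
- rewrite sum_nat_const card_ord; move: (bits k0) (bits_gt0 k0) => b b0.
  have e1 : (k0 <= k0 * (k0 * b))%N by rewrite leq_pmulr // muln_gt0 k00.
  have e2 : (k0 <= 2 ^ h * (k0 * (k0 * b)))%N by apply: leq_trans e1 _; rewrite leq_pmull.
  have e3 : (2 ^ h * k0 <= 2 ^ h * (k0 * (k0 * b)))%N by rewrite leq_mul2l e1 orbT.
  by rewrite mulnDr mulnCA mulnDl -addnA leq_add2l mulnCA; lia.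
- move=> s' [[|j] [jh r4 sm' ok]]; rewrite r4 // => _; split=> // q qh.
Qed.

(** Per leaf, moduli have [b0] bits and triples fewer than [a0]. On the way down, a child of width w
    must reduce a value bounded by its parent's modulus, of 2 b0 w bits, times a triple of its
    sibling, of a0 w bits; Montgomery reduction with exponent k0 w needs the product below 2^(k0 w),
    hence the condition 2 b0 + a0 <= k0. *)
Definition tree_ok h k0 b0 a0 (n_ : nat -> nat) (M : nat -> tri int) : Prop :=
  [/\ (h < k0)%N, (b0 + b0 + a0 <= k0)%N, (0 < a0)%N,
   forall q, odd (n_ q) /\ ((q < 2 ^ h)%N -> (n_ q < 2 ^ b0)%N) &
   forall q, (q < 2 ^ h)%N ->
     [/\ `|(M q).1.1| < 2 ^ a0.-1, `|(M q).1.2| < 2 ^ a0.-1 & `|(M q).2| < 2 ^ a0.-1]%N].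

Lemma node_size h k0 b0 a0 n_ M s i : tree_ok h k0 b0 a0 n_ M -> (0 < i < 2 ^ h.+1)%N ->
  node_ok h k0 n_ M s i ->
  (forall a, (a < 6)%N -> a != 2%N -> `|arr s a i%:Z| < 2 ^ (k0 * 2 ^ hgt h i))%N.
Proof.
move=> [_ hk a00 hn hM] hi [e0 _ _ /absz_lt h1 h3].
have [t1 t2 t3] := tri_prod_bound a00 hM hi.
have le e : (e <= k0 * 2 ^ hgt h i)%N -> forall x, (x < 2 ^ e)%N -> (x < 2 ^ (k0 * 2 ^ hgt h i))%N.
  by move=> ee x hx; apply: leq_trans hx _; rewrite leq_exp2l.
have lea : ((a0 * 2 ^ hgt h i).-1 <= k0 * 2 ^ hgt h i)%N.
  apply: leq_trans (leq_pred _) _; rewrite leq_mul2r; apply/orP; right.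
  by apply: leq_trans hk; rewrite leq_addl.
have leb : (b0 * 2 ^ hgt h i <= k0 * 2 ^ hgt h i)%N.
  rewrite leq_mul2r; apply/orP; right; apply: leq_trans hk; rewrite -addnA leq_addr //.
move: h3; case e: (node_prod h (@tmul int) M i) t1 t2 t3 => [[f g] k] /= t1 t2 t3 [e3 e4 e5].
move=> [|[|[|[|[|[|a]]]]]] // _ _; rewrite ?e3 ?e4 ?e5; try exact: le lea _ _.
rewrite e0; apply: le leb _ _; apply: (node_prod_lt _ hi) => q qh; have [_] := hn q; exact.
Qed.

(** * The upward sweep: products and inverses at all nodes *)

Definition up_body : seq instr :=
  [:: Add 5 4 4; Const 7 1; Add 6 5 7;
      ReadArr 8 0 5; ReadArr 9 0 6; ReadArr 10 1 5; ReadArr 11 1 6; ReadArr 12 2 5;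
      ReadArr 13 3 5; ReadArr 14 4 5; ReadArr 15 5 5;
      ReadArr 16 3 6; ReadArr 17 4 6; ReadArr 18 5 6;
      Mul 8 8 9; Mul 9 10 11; Add 12 12 12;
      Const 10 2; Mul 11 8 9; Diff 11 10 11; Mul 9 9 11; Shr 11 9 12; Shl 11 11 12; Diff 9 9 11;
      Mul 19 13 16; Mul 20 13 17; Mul 21 14 18; Add 20 20 21; Mul 21 15 18;
      WriteArr 0 4 8; WriteArr 1 4 9; WriteArr 2 4 12;
      WriteArr 3 4 19; WriteArr 4 4 20; WriteArr 5 4 21; Diff 4 4 7].

Definition up_loop : program :=
  Seq (block [:: Const 7 1; Diff 4 1 7]) (While 4 (block up_body)).

Definition eaK : nat -> bnd := fun a => if a == 2%N then Mag 1 else Bits 1.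
Definition up_env : env := [:: (4, Bits 1)].

(** The product of the children's inverses inverts the new modulus to the children's precision;
    since the exponent exactly doubles from child to parent, a single Newton step restores full
    precision. *)
Lemma up_body_runs h k0 b0 a0 n_ M s i : tree_ok h k0 b0 a0 n_ M -> (0 < i < 2 ^ h)%N ->
  reg s 4 = i%:Z -> node_ok h k0 n_ M s (2 * i) -> node_ok h k0 n_ M s (2 * i + 1) ->
  runs (block up_body) s
    (bcoef eaK up_body up_env * (k0 * 2 ^ hgt h i * bits (k0 * 2 ^ hgt h i)))
    (fun s' => [/\ reg s' 4 = i%:Z - 1, frame_at 6 i s s' & node_ok h k0 n_ M s' i]).
Proof.
move=> tok hi r4 ok0 ok1; set K := (k0 * 2 ^ hgt h i)%N.
have [hk _ _ _ _] := tok.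
have hi0 : (0 < 2 * i < 2 ^ h.+1)%N by rewrite expnS; lia.
have hi1 : (0 < 2 * i + 1 < 2 ^ h.+1)%N by rewrite expnS; lia.
have eh1 := hgt_child hi (isT : (1 < 2)%N).
have eh0 := hgt_child hi (isT : (0 < 2)%N); rewrite addn0 in eh0.
have e01 : hgt h (2 * i + 1) = hgt h (2 * i) by lia.
have eK : K = (2 * (k0 * 2 ^ hgt h (2 * i)))%N by rewrite /K eh0 expnS mulnCA.
have k00 : (0 < k0)%N by apply: leq_ltn_trans hk.
have K0 : (0 < K)%N by rewrite muln_gt0 k00 expn_gt0.
have kK : (2 ^ h < 2 ^ K)%N.
  by rewrite ltn_exp2l // (leq_trans hk) // leq_pmulr // expn_gt0.
have Kle x : (x < 2 ^ (k0 * 2 ^ hgt h (2 * i)))%N -> (`|x| < 2 ^ K)%N.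
  by move=> hx; apply: leq_trans hx _; rewrite leq_exp2l // eK leq_pmull.
have E0 : i%:Z + i%:Z = (2 * i)%N%:Z by lia.
have E1 : (2 * i)%N%:Z + 1 = (2 * i + 1)%N%:Z by lia.
have z := node_size tok hi1 ok1; have y := node_size tok hi0 ok0; rewrite e01 in z.
have [n0 k_0 v0 b_0 t0] := ok0; have [n1 k_1 v1 b_1 t1] := ok1.
apply: runs_abs => //.
- apply: env_allP; split=> //; rewrite r4; apply: sat1_nat.
  by case/andP: hi => _ /ltn_trans; apply.
- rewrite /= r4 E0 E1 !mul1n k_0 absz_nat eK leq_pmull // -eK.
  by do ![split; [apply: Kle; rewrite ?y ?z|]]; split=> //; do ![split; [apply: Kle; rewrite ?y ?z|]].
split.
- by rewrite /= r4.
- split=> [r hr||a k].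
  + by case: r hr => [|[|[|[|r]]]].
  + by [].
  + rewrite /= r4; case: (k == _); rewrite ?andbF // !andbT.
    by case: a => [|[|[|[|[|[|a]]]]]].
rewrite /node_ok /= r4 !eqxx E0 E1 k_0 n0 n1 -!PoszM.
have eKK : (k0 * 2 ^ hgt h (2 * i))%N%:Z + (k0 * 2 ^ hgt h (2 * i))%N%:Z = K by rewrite eK; lia.
rewrite eKK absz_nat -/K -/(newton _ _ _) !(node_prod_node _ _ hi) -t0 -t1.
rewrite e01 in v1.
have [|v2 b2] := newtonP (leqnn K) _ (inv2M v0 v1); first by rewrite eK; lia.
by split.
Qed.

(** Bounds the logarithmic factor of the multiplications uniformly over the nodes, so that it leaves
    the sum and [sum_hgt] applies. *)
Lemma hgt_bits h k0 i : (0 < i < 2 ^ h.+1)%N ->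
  (k0 * 2 ^ hgt h i * bits (k0 * 2 ^ hgt h i) <= 2 ^ hgt h i * (k0 * (bits k0 + h.+1)))%N.
Proof.
move=> hi; rewrite -mulnA mulnCA leq_mul2l leq_mul2l; do 2!(apply/orP; right).
apply: leq_trans (bits_mul _ _) _; rewrite leq_add2l /bits trunc_expnK // ltnS.
by rewrite /hgt leq_subr.
Qed.

Lemma up_loop_runs : exists C, forall h k0 b0 a0 n_ M s, tree_ok h k0 b0 a0 n_ M ->
  reg s 1 = (2 ^ h)%N%:Z -> (forall q, (q < 2 ^ h)%N -> node_ok h k0 n_ M s (2 ^ h + q)) ->
  runs up_loop s (C * (h.+1 * 2 ^ h * (k0 * (bits k0 + h.+1))))
    (fun s' => same (iota 0 6) s s' /\
       forall i, (0 < i < 2 ^ h.+1)%N -> node_ok h k0 n_ M s' i).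
Proof.
pose l0 := [:: Const 7 1; Diff 4 1 7]; pose e0 : env := [:: (1, Bits 1)].
exists (bcoef ea1 l0 e0 + (bcoef eaK up_body up_env + 4))%N => h k0 b0 a0 n_ M s tok h1 okl.
have [hk _ _ _ _] := tok; have k00 : (0 < k0)%N by apply: leq_ltn_trans hk.
have p0 : (0 < 2 ^ h)%N by rewrite expn_gt0.
set E := (k0 * (bits k0 + h.+1))%N; have E0 : (k0 <= E)%N by rewrite /E leq_pmulr // addnS.
have kE : (k0 * bits k0 <= E)%N by rewrite leq_mul2l leq_addr orbT.
rewrite mulnDl; apply: (@runs_seq _ _ _ _ _ (fun s1 =>
  reg s1 4 = (2 ^ h)%N%:Z - 1 /\ [/\ same (iota 0 6) s s1 & arr s1 = arr s])).
  apply: runs_weaken (_ : runs _ _ (bcoef ea1 l0 e0 * (k0 * bits k0)) _) _ (fun s1 => id).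
    apply: runs_abs => //.
      by apply: env_allP; split=> //; rewrite h1; apply: sat1_nat; rewrite ltn_exp2l.
    split; first by rewrite /= h1.
    by split=> //; split=> //= [[|[|[|[|r]]]]].
  by rewrite leq_mul2l (leq_trans kE) ?orbT // leq_pmull // muln_gt0.
move=> s1 [h4 [sm ea]].
pose I j s' := [/\ (j < 2 ^ h)%N, reg s' 4 = j%:Z, same (iota 0 6) s s' &
  forall i, (j < i < 2 ^ h.+1)%N -> node_ok h k0 n_ M s' i].
pose T j := (bcoef eaK up_body up_env * (2 ^ hgt h j.+1 * E))%N.
apply: runs_weaken (@runs_while 4 _ I T (2 * k0) (2 ^ h - 1) s1 _ _ _) _ _.
- move=> j s' [jk -> _ _]; apply: (@sat_bitlen _ (Bits 1)) => //; apply: sat1_nat.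
  by apply: ltn_trans jk _; rewrite ltn_exp2l.
- move=> [|j] s' [jh r4 sm' ok]; rewrite r4 // => _; exists j => //.
  have hj : (0 < j.+1 < 2 ^ h)%N by [].
  apply: runs_weaken (up_body_runs tok hj r4 _ _) _ _.
  + by apply: ok; rewrite expnS; lia.
  + by apply: ok; rewrite expnS; lia.
  + by rewrite leq_mul2l hgt_bits ?orbT //= expnS; lia.
  move=> s2 [r4' fr ok']; split; first exact: ltnW.
  + by rewrite r4'; lia.
  + by apply: same_trans sm' (frame_at_same fr).
  move=> i /andP[]; rewrite leq_eqVlt => /orP[/eqP<- _ //|ji ih].
  apply: node_ok_frame fr (ok _ _); last by rewrite ji.
  by move=> e; move: ji; rewrite e ltnn.
- split=> //; first by rewrite subn1 prednK.
    by rewrite h4; lia.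
  move=> i hi; apply: (@node_ok_ext _ _ _ _ s); first by rewrite ea.
  have -> : i = (2 ^ h + (i - 2 ^ h))%N by lia.
  by apply: okl; move: hi; rewrite expnS; lia.
- rewrite big_split /= sum_nat_const card_ord -big_distrr /= -big_distrl /= sum_hgt //.
  have e1 : (h * 2 ^ h * E <= h.+1 * 2 ^ h * E)%N by rewrite !leq_mul2r leqnSn !orbT.
  have e2 : ((2 ^ h - 1) * (2 * k0) + 2 * k0 <= 4 * (h.+1 * 2 ^ h * E))%N.
    have: (2 ^ h * k0 <= h.+1 * 2 ^ h * E)%N.
      by rewrite -mulnA (leq_trans (leq_mul (leqnn _) E0)) // leq_pmull.
    have: (2 * k0 <= 2 ^ h * (2 * k0))%N by rewrite leq_pmull.
    rewrite mulnBl; lia.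
  rewrite mulnDl -addnA; apply: leq_add e2; by rewrite leq_mul2l e1 orbT.
- move=> s' [[|j] [jh r4 sm' ok]]; rewrite r4 // => _; split=> // q qh.
Qed.

(** * The downward sweep: prefix products modulo the modulus of each node *)

Definition down_ok h (n_ : nat -> nat) (M : nat -> tri int) (s : state) (i : nat) : Prop :=
  let v := (arr s 6 i%:Z, arr s 7 i%:Z, arr s 8 i%:Z) in
  [/\ 0 <= v.1.1 <= (node_prod h muln n_ i)%:Z, 0 <= v.1.2 <= (node_prod h muln n_ i)%:Z,
      0 <= v.2 <= (node_prod h muln n_ i)%:Z &
      peq (node_prod h muln n_ i) v (prefix_prod h (@tmul int) M i)].

Definition redc_block (t n J k a dst : nat) : seq instr :=
  [:: Mul 30 t J; Shr 31 30 k; Shl 31 31 k; Diff 30 30 31; Mul 30 30 n; Diff 30 30 t;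
      Shr 30 30 k; WriteArr a dst 30].

Definition down_body : seq instr :=
  [:: Add 6 5 5; Const 7 1; Add 8 6 7;
      ReadArr 9 0 6; ReadArr 10 1 6; ReadArr 11 2 6; ReadArr 12 0 8; ReadArr 13 1 8;
      ReadArr 14 6 5; ReadArr 15 7 5; ReadArr 16 8 5;
      ReadArr 17 3 6; ReadArr 18 4 6; ReadArr 19 5 6] ++
  redc_block 14 9 10 11 6 6 ++ redc_block 15 9 10 11 7 6 ++ redc_block 16 9 10 11 8 6 ++
  [:: Mul 20 14 17; Mul 21 14 18; Mul 22 15 19; Add 21 21 22; Mul 22 16 19] ++
  redc_block 20 12 13 11 6 8 ++ redc_block 21 12 13 11 7 8 ++ redc_block 22 12 13 11 8 8 ++
  [:: Add 5 5 7; Diff 4 4 7].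

Definition down_env : env := [:: (4, Bits 1); (5, Bits 1)].

Lemma absz_le_nat (v : int) n B : 0 <= v <= n%:Z -> (n < B)%N -> (`|v| < B)%N.
Proof. lia. Qed.

Lemma tmul_bound (a b : tri int) A B : 
  (`|a.1.1| < A)%N -> (`|a.1.2| < A)%N -> (`|a.2| < A)%N ->
  (`|b.1.1| < B)%N -> (`|b.1.2| < B)%N -> (`|b.2| < B)%N ->
  let c := tmul a b in
  [/\ (`|c.1.1| < 2 * (A * B))%N, (`|c.1.2| < 2 * (A * B))%N & (`|c.2| < 2 * (A * B))%N].
Proof.
move=> a1 a2 a3 b1 b2 b3; rewrite /tmul /=.
have tr (x y : int) : (`|(x + y)%R| <= `|x| + `|y|)%N by lia.
split; rewrite ?abszM.
- by apply: leq_trans (ltn_mul a1 b1) _; rewrite leq_pmull.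
- apply: leq_ltn_trans (tr _ _) _; rewrite !abszM [(2 * (A * B))%N]mul2n -addnn -addSn.
  by apply: leq_add; [|apply: ltnW]; apply: ltn_mul.
- by apply: leq_trans (ltn_mul a3 b3) _; rewrite leq_pmull.
Qed.

Lemma ltz_pow2 (v : int) k : (`|v| < 2 ^ k)%N -> `|v| < 2 ^+ k.
Proof. by move=> h; rewrite -pow2Z -abszE ltz_nat. Qed.

(** The left child has the same prefix as its parent, the right child the prefix extended by the
    product over the left child. Both remainders may be taken from the parent's remainder because
    the moduli of the children divide that of the parent. *)
Lemma down_body_runs h k0 b0 a0 n_ M s i : tree_ok h k0 b0 a0 n_ M -> (0 < i < 2 ^ h)%N ->
  (forall i', (0 < i' < 2 ^ h.+1)%N -> node_ok h k0 n_ M s i') ->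
  (0 <= reg s 4 <= (2 ^ h)%N%:Z) -> reg s 5 = i%:Z -> down_ok h n_ M s i ->
  runs (block down_body) s
    (bcoef eaK down_body down_env * (k0 * 2 ^ hgt h i * bits (k0 * 2 ^ hgt h i)))
    (fun s' => [/\ reg s' 4 = reg s 4 - 1 /\ reg s' 5 = i.+1%:Z, same [:: 6; 7; 8]%N s s',
       forall a k, (k != (2 * i)%N%:Z) && (k != (2 * i + 1)%N%:Z) -> arr s' a k = arr s a k,
       down_ok h n_ M s' (2 * i) & down_ok h n_ M s' (2 * i + 1)]).
Proof.
move=> tok hi ok r4 r5 dok; set K := (k0 * 2 ^ hgt h i)%N.
have [hk hk0 a00 hn hM] := tok; have hi_ : (0 < i < 2 ^ h.+1)%N by rewrite expnS; lia.
have hi0 : (0 < 2 * i < 2 ^ h.+1)%N by rewrite expnS; lia.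
have hi1 : (0 < 2 * i + 1 < 2 ^ h.+1)%N by rewrite expnS; lia.
have eh1 := hgt_child hi (isT : (1 < 2)%N).
have eh0 := hgt_child hi (isT : (0 < 2)%N); rewrite addn0 in eh0.
have e01 : hgt h (2 * i + 1) = hgt h (2 * i) by lia.
set w := (2 ^ hgt h (2 * i))%N; set k := (k0 * w)%N.
have eK : K = (2 * k)%N by rewrite /K eh0 expnS mulnCA.
have k00 : (0 < k0)%N by apply: leq_ltn_trans hk.
have w0 : (0 < w)%N by rewrite expn_gt0.
have K0 : (0 < K)%N by rewrite muln_gt0 k00 expn_gt0.
have kK : (2 ^ h < 2 ^ K)%N.
  by rewrite ltn_exp2l // (leq_trans hk) // leq_pmulr // expn_gt0.
have Kle x : (x < 2 ^ k)%N -> (`|x| < 2 ^ K)%N.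
  by move=> hx; apply: leq_trans hx _; rewrite leq_exp2l // eK leq_pmull.
have E0 : i%:Z + i%:Z = (2 * i)%N%:Z by lia.
have E1 : (2 * i)%N%:Z + 1 = (2 * i + 1)%N%:Z by lia.
have z := node_size tok hi1 (ok _ hi1); have y := node_size tok hi0 (ok _ hi0).
rewrite e01 -/w -/k in z; rewrite -/w -/k in y.
have nlt : (node_prod h muln n_ i < 2 ^ ((b0 + b0) * w))%N.
  have -> : ((b0 + b0) * w = b0 * 2 ^ hgt h i)%N by rewrite eh0 expnS addnn -mul2n mulnCA mulnA.
  by apply: (node_prod_lt _ hi_) => q qh; have [_] := hn q; exact.
have bk : ((b0 + b0) * w <= k)%N.
  by rewrite leq_mul2r; apply/orP; right; apply: leq_trans hk0; rewrite leq_addr.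
have nltk : (node_prod h muln n_ i < 2 ^ k)%N by apply: leq_trans nlt _; rewrite leq_exp2l.
have [d1 d2 d3 dp] := dok; rewrite /= in d1 d2 d3 dp.
have [n0 k_0 v0 b_0 t0] := ok _ hi0; have [n1 k_1 v1 b_1 t1] := ok _ hi1.
rewrite -/w -/k in k_0 v0 b_0; rewrite e01 -/w -/k in k_1 v1 b_1.
apply: runs_abs => //.
- apply: env_allP; split; first by apply: sat1_int; apply: absz_le_nat r4 kK.
  split=> //; rewrite r5; apply: sat1_nat.
  by case/andP: hi => _ /ltn_trans; apply.
- rewrite /= r5 E0 E1 !mul1n k_0 absz_nat.
  do 2![split; [apply: Kle; rewrite ?y ?z //|]]; split; first by rewrite eK leq_pmull.
  do 2![split; [apply: Kle; rewrite ?y ?z //|]].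
  do 3![split; [by apply: Kle; apply: absz_le_nat nltk|]].
  by do ![split; [apply: Kle; rewrite ?y ?z //|]].
have pos0 : (0 < node_prod h muln n_ (2 * i))%N.
  by apply: odd_gt0; apply: node_prod_odd => q; case: (hn q).
have pos1 : (0 < node_prod h muln n_ (2 * i + 1))%N.
  by apply: odd_gt0; apply: node_prod_odd => q; case: (hn q).
have odd0 : odd (node_prod h muln n_ (2 * i)) by apply: node_prod_odd => q; case: (hn q).
have odd1 : odd (node_prod h muln n_ (2 * i + 1)) by apply: node_prod_odd => q; case: (hn q).
have ne01 : ((2 * i)%N%:Z == (2 * i + 1)%N%:Z) = false by lia.
have ne10 : ((2 * i + 1)%N%:Z == (2 * i)%N%:Z) = false by lia.
have Epr := node_prod_node muln n_ hi.
have dv0 : (node_prod h muln n_ (2 * i) %| node_prod h muln n_ i)%N by rewrite Epr dvdn_mulr.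
have dv1 : (node_prod h muln n_ (2 * i + 1) %| node_prod h muln n_ i)%N by rewrite Epr dvdn_mull.
set V := (arr s 6 i%:Z, arr s 7 i%:Z, arr s 8 i%:Z) in dp *.
set A := (arr s 3 (2 * i)%N%:Z, arr s 4 (2 * i)%N%:Z, arr s 5 (2 * i)%N%:Z) in t0 *.
(* Here the size condition of [tree_ok] is used; the spare bit of the triples absorbs the factor 2
   of [tmul_bound]. *)
have [m1 m2 m3] : [/\ (`|(tmul V A).1.1| < 2 ^ k)%N, (`|(tmul V A).1.2| < 2 ^ k)%N & (`|(tmul V A).2| < 2 ^ k)%N].
  have [a1 a2 a3] := tri_prod_bound a00 hM hi0; rewrite -t0 -/w in a1 a2 a3.
  have [||||||c1 c2 c3] := @tmul_bound V A (2 ^ ((b0 + b0) * w)) (2 ^ (a0 * w).-1);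
    try by [|apply: absz_le_nat nlt].
  have le : (2 * (2 ^ ((b0 + b0) * w) * 2 ^ (a0 * w).-1) <= 2 ^ k)%N.
    rewrite -expnD -expnS leq_exp2l // -addnS prednK ?muln_gt0 ?a00 //.
    by rewrite -mulnDl leq_mul2r hk0 orbT.
  by split; [apply: leq_trans c1 le|apply: leq_trans c2 le|apply: leq_trans c3 le].
have [g1 g2 g3] : [/\ (`|V.1.1| < 2 ^ k)%N, (`|V.1.2| < 2 ^ k)%N & (`|V.2| < 2 ^ k)%N].
  by split; apply: absz_le_nat nltk.
have lo := redc_tri pos0 odd0 v0 (ltz_pow2 g1) (ltz_pow2 g2) (ltz_pow2 g3).
have hi' := redc_tri pos1 odd1 v1 (ltz_pow2 m1) (ltz_pow2 m2) (ltz_pow2 m3).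
have pz0 : 0 < (node_prod h muln n_ (2 * i))%:Z by [].
have pz1 : 0 < (node_prod h muln n_ (2 * i + 1))%:Z by [].
have sp0 T hT := (@redc_spec _ _ _ T pz0 v0 hT).1.
have sp1 T hT := (@redc_spec _ _ _ T pz1 v1 hT).1.
split.
- by rewrite /= r5; split=> //; lia.
- split=> [r hr||a hk'].
  + by case: r hr => [|[|[|[|r]]]].
  + by [].
  + apply/funext => kk; case: a hk' => [|[|[|[|[|[|[|[|[|a]]]]]]]]] //.
- move=> a kk /andP[/negPf e1 /negPf e2]; rewrite /= r5 E0 E1 e1 e2 !andbF //.
- rewrite /down_ok /= r5 E0 E1 ne01 eqxx k_0 n0 absz_nat; split.
  + exact: (sp0 _ (ltz_pow2 g1)).
  + exact: (sp0 _ (ltz_pow2 g2)).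
  + exact: (sp0 _ (ltz_pow2 g3)).
  rewrite (prefix_prod_left _ _ hi); exact: peq_trans lo (peq_dvd dv0 dp).
- rewrite /down_ok /= r5 E0 E1 eqxx k_0 n1 absz_nat; split.
  + exact: (sp1 _ (ltz_pow2 m1)).
  + exact: (sp1 _ (ltz_pow2 m2)).
  + exact: (sp1 _ (ltz_pow2 m3)).
  rewrite (prefix_prod_right _ _ hi) -t0.
  exact: peq_trans hi' (peqM (peq_dvd dv1 dp) (peq_refl _ _)).
Qed.

Definition down_loop : program :=
  Seq (block [:: Const 5 1; WriteArr 6 5 5; WriteArr 8 5 5; Const 7 0; WriteArr 7 5 7;
                 Diff 4 1 5]) (While 4 (block down_body)).

Lemma down_loop_runs : exists C, forall h k0 b0 a0 n_ M s, tree_ok h k0 b0 a0 n_ M ->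
  reg s 1 = (2 ^ h)%N%:Z -> (forall i, (0 < i < 2 ^ h.+1)%N -> node_ok h k0 n_ M s i) ->
  runs down_loop s (C * (h.+1 * 2 ^ h * (k0 * (bits k0 + h.+1))))
    (fun s' => same [:: 6; 7; 8]%N s s' /\
       forall q, (q < 2 ^ h)%N -> down_ok h n_ M s' (2 ^ h + q)).
Proof.
pose l0 := [:: Const 5 1; WriteArr 6 5 5; WriteArr 8 5 5; Const 7 0; WriteArr 7 5 7;
                 Diff 4 1 5]; pose e0 : env := [:: (1, Bits 1)].
exists (bcoef ea1 l0 e0 + (bcoef eaK down_body down_env + 4))%N => h k0 b0 a0 n_ M s tok h1 okn.
have [hk _ _ hn _] := tok; have k00 : (0 < k0)%N by apply: leq_ltn_trans hk.
have p0 : (0 < 2 ^ h)%N by rewrite expn_gt0.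
set E := (k0 * (bits k0 + h.+1))%N; have E0 : (k0 <= E)%N by rewrite /E leq_pmulr // addnS.
have kE : (k0 * bits k0 <= E)%N by rewrite leq_mul2l leq_addr orbT.
rewrite mulnDl; apply: (@runs_seq _ _ _ _ _ (fun s1 =>
  [/\ reg s1 4 = (2 ^ h)%N%:Z - 1, reg s1 5 = 1, same [:: 6; 7; 8]%N s s1 & down_ok h n_ M s1 1])).
  apply: runs_weaken (_ : runs _ _ (bcoef ea1 l0 e0 * (k0 * bits k0)) _) _ (fun s1 => id).
    apply: runs_abs => //.
      by apply: env_allP; split=> //; rewrite h1; apply: sat1_nat; rewrite ltn_exp2l.
    split=> //; first by rewrite /= h1.
      split=> //=; first by move=> [|[|[|[|r]]]].
      by move=> a ha; apply/funext => kk; case: a ha => [|[|[|[|[|[|[|[|[|a]]]]]]]]].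
    have n1 : (0 < node_prod h muln n_ 1)%N.
      by apply: odd_gt0; apply: node_prod_odd => q; case: (hn q).
    rewrite /down_ok /= prefix_prod_root; split=> //; exact: peq_refl.
  by rewrite leq_mul2l (leq_trans kE) ?orbT // leq_pmull // muln_gt0.
move=> s1 [r4 r5 sm ok1].
(* Nodes are treated in increasing order. When the current node is c = 2^h - j, exactly the nodes
   below c have passed values to their children, so all nodes below 2 c are filled; at j = 0 this
   includes the leaves. *)
pose I j s' := [/\ (j < 2 ^ h)%N, reg s' 4 = j%:Z /\ reg s' 5 = (2 ^ h - j)%N%:Z,
  same [:: 6; 7; 8]%N s s' &
  forall i, (0 < i < 2 * (2 ^ h - j))%N -> down_ok h n_ M s' i].
pose T j := (bcoef eaK down_body down_env * (2 ^ hgt h (2 ^ h - j.+1) * E))%N.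
apply: runs_weaken (@runs_while 4 _ I T (2 * k0) (2 ^ h - 1) s1 _ _ _) _ _.
- move=> j s' [jk [-> _] _ _]; apply: (@sat_bitlen _ (Bits 1)) => //; apply: sat1_nat.
  by apply: ltn_trans jk _; rewrite ltn_exp2l.
- move=> [|j] s' [jh [r4' r5'] sm' ok]; rewrite r4' // => _; exists j => //.
  have hj : (0 < 2 ^ h - j.+1 < 2 ^ h)%N by lia.
  have sk : forall a, (a < 6)%N -> arr s' a = arr s a.
    by case: sm' => _ _ e a a6; apply: e; case: a a6 => [|[|[|[|[|[|a]]]]]].
  apply: runs_weaken (down_body_runs tok hj _ _ r5' _) _ _.
  + by move=> i' hi'; apply: node_ok_ext (okn _ hi') => a a6; rewrite sk.
  + by rewrite r4'; lia.
  + by apply: ok; lia.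
  + by rewrite leq_mul2l hgt_bits ?orbT //= expnS; lia.
  move=> s2 [[r4'' r5''] fr hk' okl okr]; split; first exact: ltnW.
  + by rewrite r4'' r5'' r4'; split; [lia|congr Posz; lia].
  + exact: same_trans sm' fr.
  move=> i hi; have [->|n0] := eqVneq i (2 * (2 ^ h - j.+1))%N; first exact: okl.
  have [->|n1] := eqVneq i (2 * (2 ^ h - j.+1) + 1)%N; first exact: okr.
  have := ok i; rewrite /down_ok /= !hk'; try by rewrite !eqz_nat n0 n1.
  by apply; move: n0 n1 hi; lia.
- split=> //; first by rewrite subn1 prednK.
    by rewrite r4 r5; split; [lia|congr Posz; lia].
  by move=> i hi; have -> : i = 1%N by lia.
- rewrite big_split /= sum_nat_const card_ord -big_distrr /= -big_distrl /=.
  have -> : (\sum_(i < 2 ^ h - 1) 2 ^ hgt h (2 ^ h - i.+1) = h * 2 ^ h)%N.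
    rewrite -sum_hgt // (reindex_inj rev_ord_inj) /=; apply: eq_bigr => i _.
    by congr (2 ^ hgt h _)%N; have := ltn_ord i; lia.
  have e1 : (h * 2 ^ h * E <= h.+1 * 2 ^ h * E)%N by rewrite !leq_mul2r leqnSn !orbT.
  have e2 : ((2 ^ h - 1) * (2 * k0) + 2 * k0 <= 4 * (h.+1 * 2 ^ h * E))%N.
    have: (2 ^ h * k0 <= h.+1 * 2 ^ h * E)%N.
      by rewrite -mulnA (leq_trans (leq_mul (leqnn _) E0)) // leq_pmull.
    have: (2 * k0 <= 2 ^ h * (2 * k0))%N by rewrite leq_pmull.
    rewrite mulnBl; lia.
  rewrite mulnDl -addnA; apply: leq_add e2; by rewrite leq_mul2l e1 orbT.
- move=> s' [[|j] [jh [r4' r5'] sm' ok]]; rewrite r4' // => _; split=> // q qh.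
  by apply: ok; lia.
Qed.

(** * Accumulating the products of several components at the leaves *)

Definition qtri (s : state) (q : nat) : tri int :=
  (arr s 9 q%:Z, arr s 10 q%:Z, arr s 11 q%:Z).

Definition vtri (s : state) (i : nat) : tri int :=
  (arr s 6 i%:Z, arr s 7 i%:Z, arr s 8 i%:Z).

Definition tri_lt (B : nat) (a : tri int) : Prop :=
  [/\ `|a.1.1| < B, `|a.1.2| < B & `|a.2| < B]%N.

Lemma tri_lt_le B B' a : (B <= B')%N -> tri_lt B a -> tri_lt B' a.
Proof. by move=> h [h1 h2 h3]; split; [apply: leq_trans h1 h|apply: leq_trans h2 h|apply: leq_trans h3 h]. Qed.

Lemma tri_ltM a b x y : tri_lt (2 ^ x) a -> tri_lt (2 ^ y) b -> tri_lt (2 ^ (x + y).+1) (tmul a b).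
Proof.
move=> [a1 a2 a3] [b1 b2 b3]; rewrite expnS expnD.
by have [c1 c2 c3] := tmul_bound a1 a2 a3 b1 b2 b3.
Qed.

Definition acc_body (B : tri int) : seq instr :=
  [:: Const 7 1; Diff 5 4 7; Add 6 1 5; ReadArr 8 9 5; ReadArr 9 10 5; ReadArr 10 11 5;
      ReadArr 11 6 6; ReadArr 12 7 6; ReadArr 13 8 6;
      Mul 14 8 11; Mul 15 8 12; Mul 16 9 13; Add 15 15 16; Mul 16 10 13;
      Const 17 B.1.1; Const 18 B.1.2; Const 19 B.2;
      Mul 20 14 17; Mul 21 14 18; Mul 22 15 19; Add 21 21 22; Mul 22 16 19;
      WriteArr 9 5 20; WriteArr 10 5 21; WriteArr 11 5 22; Diff 4 4 7].

Definition count_up : seq instr := [:: Const 4 0; Add 4 4 1].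

(* Every loop over the leaves has this shape: register 4 holds [q + 1]. *)
Lemma leaf_loop_gen (P : program) (mods : seq nat) (J : nat -> state -> Prop) (C h k0 : nat) s :
  (h < k0)%N -> reg s 1 = (2 ^ h)%N%:Z ->
  (forall s1, same mods s s1 -> out s1 = out s -> arr s1 = arr s -> J (2 ^ h)%N s1) ->
  (forall q s1, (q < 2 ^ h)%N -> reg s1 4 = q.+1%:Z -> same mods s (State (reg s1) (arr s1) (out s)) ->
     J q.+1 s1 ->
     runs P s1 (C * (k0 * (k0 * (bits k0 + h.+1)))) (fun s2 =>
       [/\ reg s2 4 = q%:Z, same mods s (State (reg s2) (arr s2) (out s)) & J q s2])) ->
  runs (Seq (block count_up) (While 4 P)) s
    ((bcoef ea1 count_up [:: (1%N, Bits 1)] + (C + 4)) * (2 ^ h * (k0 * (k0 * (bits k0 + h.+1)))))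
    (fun s' => same mods s (State (reg s') (arr s') (out s)) /\ J 0%N s').
Proof.
move=> hk h1 J0 JS; have k00 : (0 < k0)%N by apply: leq_ltn_trans hk.
have hpow : (2 ^ h < 2 ^ k0)%N by rewrite ltn_exp2l.
have p0 : (0 < 2 ^ h)%N by rewrite expn_gt0.
set E := (k0 * (k0 * _))%N; have E0 : (k0 <= E)%N by rewrite /E leq_pmulr // addnS muln_gt0 k00.
have kE : (k0 * bits k0 <= E)%N.
  by rewrite leq_mul2l (leq_trans (leq_addr h.+1 _)) ?orbT // leq_pmull.
rewrite mulnDl; apply: (@runs_seq _ _ _ _ _ (fun s1 =>
  [/\ reg s1 4 = (2 ^ h)%N%:Z, same mods s s1, out s1 = out s & arr s1 = arr s])).
  apply: runs_weaken (_ : runs _ _ (bcoef ea1 count_up [:: (1%N, Bits 1)] * (k0 * bits k0)) _) _ (fun s1 => id).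
    apply: runs_abs => //.
      by apply: env_allP; split=> //; rewrite h1; apply: sat1_nat.
    split=> //; first by rewrite /= h1 add0r.
    by split=> //= [[|[|[|[|r]]]]].
  by rewrite leq_mul2l (leq_trans kE) ?orbT // leq_pmull.
move=> s1 [h4 sm eo ea].
pose I j s' := [/\ (j <= 2 ^ h)%N, reg s' 4 = j%:Z, same mods s (State (reg s') (arr s') (out s)) & J j s'].
apply: runs_weaken (@runs_while 4 _ I (fun=> C * E)%N (2 * k0) (2 ^ h) s1 _ _ _) _ _.
- move=> j s' [jk -> _ _]; apply: (@sat_bitlen _ (Bits 1)) => //; apply: sat1_nat.
  exact: leq_ltn_trans hpow.
- move=> [|j] s' [jh r4 sm' ok]; rewrite r4 // => _; exists j => //.
  apply: runs_weaken (JS j s' jh r4 sm' ok) (leqnn _) _ => s2 [e1 e2 e3].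
  by split=> //; exact: ltnW.
- by split=> //; [case: sm => x1 x2 x3; split|apply: J0].
- rewrite sum_nat_const card_ord.
  have e3 : (2 ^ h * k0 <= 2 ^ h * E)%N by rewrite leq_mul2l E0 orbT.
  have e2 : (k0 <= 2 ^ h * k0)%N by rewrite leq_pmull.
  by rewrite mulnDr mulnCA mulnDl -addnA leq_add2l mulnCA; lia.
- by move=> s' [[|j] [jh r4 sm' ok]]; rewrite r4.
Qed.

Definition acc_loop B : program := Seq (block count_up) (While 4 (block (acc_body B))).

Definition acc_env : env := [:: (1, Bits 1); (4, Bits 1)].

Lemma leaf_env h k0 s q : (h < k0)%N -> reg s 1 = (2 ^ h)%N%:Z -> reg s 4 = q.+1%:Z ->
  (q < 2 ^ h)%N -> sat k0 (Bits 1) (reg s 1) /\ sat k0 (Bits 1) (reg s 4).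
Proof.
move=> hk -> -> qh; have hpow : (2 ^ h < 2 ^ k0)%N by rewrite ltn_exp2l.
by split; apply: sat1_nat => //; apply: leq_ltn_trans hpow.
Qed.

Lemma acc_body_runs (B : tri int) h k0 q s : (h < k0)%N -> (q < 2 ^ h)%N ->
  reg s 1 = (2 ^ h)%N%:Z -> reg s 4 = q.+1%:Z ->
  tri_lt (2 ^ k0) (qtri s q) -> tri_lt (2 ^ k0) (vtri s (2 ^ h + q)) ->
  runs (block (acc_body B)) s (bcoef ea1 (acc_body B) acc_env * (k0 * bits k0))
    (fun s' => [/\ reg s' 4 = q%:Z, same [:: 9; 10; 11]%N s s',
      forall q', q' != q -> qtri s' q' = qtri s q' &
      qtri s' q = tmul (tmul (qtri s q) (vtri s (2 ^ h + q))) B]).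
Proof.
move=> hk qh r1 r4 [q1 q2 q3] [v1 v2 v3].
have k00 : (0 < k0)%N by apply: leq_ltn_trans hk.
have e1 : q.+1%:Z - 1 = q%:Z by lia.
have e2 : (2 ^ h)%N%:Z + q%:Z = (2 ^ h + q)%N%:Z by rewrite PoszD.
rewrite /= in q1 q2 q3 v1 v2 v3.
apply: runs_abs => //.
- by apply: env_allP; have [] := leaf_env hk r1 r4 qh.
- by rewrite /= r4 r1 e1 e2; do ![split; first exact: sat1_int]; split=> //; exact: sat1_int.
split.
- by rewrite /= r4.
- split=> [r hr||a ha].
  + by case: r hr => [|[|[|[|r]]]].
  + by [].
  by apply/funext => kk; case: a ha => [|[|[|[|[|[|[|[|[|[|[|[|a]]]]]]]]]]]].
- by move=> q' hq'; rewrite /qtri /= r4 e1 !eqz_nat (negPf hq').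
by rewrite /qtri /= r4 r1 e1 e2 !eqxx.
Qed.

Lemma acc_loop_runs (B : tri int) : exists C, forall h k0 s, (h < k0)%N ->
  reg s 1 = (2 ^ h)%N%:Z ->
  (forall q, (q < 2 ^ h)%N -> tri_lt (2 ^ k0) (qtri s q) /\ tri_lt (2 ^ k0) (vtri s (2 ^ h + q))) ->
  runs (acc_loop B) s (C * (2 ^ h * (k0 * (k0 * (bits k0 + h.+1)))))
    (fun s' => same [:: 9; 10; 11]%N s s' /\
      forall q, (q < 2 ^ h)%N ->
        qtri s' q = tmul (tmul (qtri s q) (vtri s (2 ^ h + q))) B).
Proof.
set c1 := bcoef ea1 (acc_body B) acc_env.
exists (bcoef ea1 count_up [:: (1%N, Bits 1)] + (c1 + 4))%N => h k0 s hk h1 hq.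
have k00 : (0 < k0)%N by apply: leq_ltn_trans hk.
pose J j s' := [/\ out s' = out s, forall q, (q < j)%N -> qtri s' q = qtri s q &
  forall q, (j <= q < 2 ^ h)%N -> qtri s' q = tmul (tmul (qtri s q) (vtri s (2 ^ h + q))) B].
apply: runs_weaken (@leaf_loop_gen _ [:: 9; 10; 11]%N J c1 h k0 s hk h1 _ _) (leqnn _) _.
- move=> s1 sm eo ea; split=> //; first by move=> q _; rewrite /qtri ea.
  by move=> q /andP[hq1 /(leq_ltn_trans hq1)]; rewrite ltnn.
- move=> q s1 qh r4 [sr _ sa] [eo Jl Jr]; rewrite /= in sr sa.
  have r1 : reg s1 1 = (2 ^ h)%N%:Z by rewrite sr.
  have ev : vtri s1 (2 ^ h + q) = vtri s (2 ^ h + q) by rewrite /vtri !sa.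
  have [bq bv] := hq q qh; rewrite -Jl // in bq; rewrite -ev in bv.
  apply: runs_weaken (acc_body_runs B hk qh r1 r4 bq bv) _ _.
    rewrite leq_mul2l; apply/orP; right; rewrite leq_mul2l; apply/orP; right.
    by rewrite (leq_trans (leq_addr h.+1 _)) // leq_pmull.
  move=> s2 [r4' [f1 f2 f3] hne heq]; split=> //.
    by split=> //= [r hr|a ha]; rewrite ?f1 ?sr ?f3 ?sa.
  split; first by rewrite f2.
    by move=> q' hq'; rewrite hne ?(ltn_eqF hq') // Jl // ltnW.
  move=> q' /andP[]; rewrite leq_eqVlt => /orP[/eqP<- _|qq' hq'].
    by rewrite heq ev Jl.
  by rewrite hne ?(gtn_eqF qq') // Jr // qq'.
- by move=> s' [[s1 s2 s3] [eo _ Jr]].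
Qed.

(** What is kept of a tree after its sweeps: the moduli and inverses at the leaves, which the
    primality test and the final quotients need for their own reductions. *)
Definition leaf_inv h k0 (n_ : nat -> nat) (s : state) : Prop :=
  forall q, (q < 2 ^ h)%N -> [/\ arr s 0 (2 ^ h + q)%N%:Z = (n_ q)%:Z,
    inv2 k0 (n_ q)%:Z (arr s 1 (2 ^ h + q)%N%:Z) & 0 <= arr s 1 (2 ^ h + q)%N%:Z < 2 ^+ k0].

Definition comp_prog N c cp : program :=
  Seq (leaf_loop N c cp) (Seq up_loop (Seq down_loop (acc_loop (bdry cp)))).

(** A common unit of time for everything done in one residue class: it bounds both the loops over
    leaves, of cost 2^h k0^2 bits k0, and, since h < k0, the two sweeps. For k0 proportional to h +
    1 it is O(2^h (h + 1)^3). *)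
Definition Wt (h k0 : nat) : nat := (2 ^ h * (k0 * (k0 * (bits k0 + h.+1))))%N.

Lemma Wt_gt0 h k0 : (0 < k0)%N -> (0 < Wt h k0)%N.
Proof. by move=> k00; rewrite /Wt !muln_gt0 expn_gt0 k00 addnS. Qed.

Lemma comp_prog_runs (N c : nat) (cp : component) : ~~ odd N -> odd c -> exists C, forall h k0 b0 a0 s,
  tree_ok h k0 b0 a0 (nmod N c) (leaf N cp) ->
  reg s 1 = (2 ^ h)%N%:Z -> reg s 3 = k0%:Z ->
  (forall q, (q < 2 ^ h)%N -> tri_lt (2 ^ k0) (qtri s q)) ->
  runs (comp_prog N c cp) s (C * Wt h k0)
    (fun s' => [/\ same (iota 0 12) s s', leaf_inv h k0 (nmod N c) s' &
      forall q, (q < 2 ^ h)%N -> exists2 v : tri int,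
        qtri s' q = tmul (tmul (qtri s q) v) (bdry cp) /\ tri_lt (2 ^ b0) v &
        peq (nmod N c q) v (\big[@tmul int/tone int]_(0 <= l < q) leaf N cp l)]).
Proof.
move=> eN oc; have [C1 H1] := leaf_loop_runs cp eN oc; have [C2 H2] := up_loop_runs.
have [C3 H3] := down_loop_runs; have [C4 H4] := acc_loop_runs (bdry cp).
exists (C1 + (C2 + (C3 + C4)))%N => h k0 b0 a0 s tok h1 h3 hq.
have [hk hk0 a00 hn hM] := tok; have k00 : (0 < k0)%N by apply: leq_ltn_trans hk.
have hn0 q : (q < 2 ^ h)%N -> (nmod N c q < 2 ^ b0)%N by move=> qh; case: (hn q) => _; exact.
have b0k : (b0 <= k0)%N by apply: leq_trans hk0; rewrite -addnA leq_addr.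
have W1 : (2 ^ h * (k0 * (k0 * bits k0)) <= Wt h k0)%N.
  by rewrite /Wt !leq_mul2l leq_addr !orbT.
have W2 : (h.+1 * 2 ^ h * (k0 * (bits k0 + h.+1)) <= Wt h k0)%N.
  by rewrite /Wt [(h.+1 * _)%N]mulnC -mulnA !leq_mul2l leq_mul2r hk !orbT.
rewrite mulnDl; apply: (@runs_seq _ _ _ _ _ (fun s' => same (iota 0 6) s s' /\
       forall q, (q < 2 ^ h)%N -> node_ok h k0 (nmod N c) (leaf N cp) s' (2 ^ h + q))).
  apply: runs_weaken (H1 h k0 s hk _ h1 h3) _ (fun s1 => id); last by rewrite leq_mul2l W1 orbT.
  by move=> q qh; apply: leq_trans (hn0 q qh) _; rewrite leq_exp2l.
move=> s1 [sm1 ok1]; rewrite mulnDl.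
have r11 : reg s1 1 = (2 ^ h)%N%:Z by case: sm1 => ->.
apply: (@runs_seq _ _ _ _ _ (fun s' => same (iota 0 6) s1 s' /\
       forall i, (0 < i < 2 ^ h.+1)%N -> node_ok h k0 (nmod N c) (leaf N cp) s' i)).
  by apply: runs_weaken (H2 _ _ _ _ _ _ s1 tok r11 ok1) _ (fun s1 => id); rewrite leq_mul2l W2 orbT.
move=> s2 [sm2 ok2]; rewrite mulnDl.
have r12 : reg s2 1 = (2 ^ h)%N%:Z by case: sm2 => ->.
apply: (@runs_seq _ _ _ _ _ (fun s' => same [:: 6; 7; 8]%N s2 s' /\
       forall q, (q < 2 ^ h)%N -> down_ok h (nmod N c) (leaf N cp) s' (2 ^ h + q))).
  by apply: runs_weaken (H3 _ _ _ _ _ _ s2 tok r12 ok2) _ (fun s1 => id); rewrite leq_mul2l W2 orbT.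
move=> s3 [sm3 ok3].
have r13 : reg s3 1 = (2 ^ h)%N%:Z by case: sm3 => ->.
have vlt q : (q < 2 ^ h)%N -> tri_lt (2 ^ b0) (vtri s3 (2 ^ h + q)).
  move=> qh; have [d1 d2 d3 _] := ok3 q qh; rewrite /= node_prod_leaf // in d1 d2 d3.
  by split; apply: absz_le_nat (hn0 q qh).
have qe q : qtri s3 q = qtri s q.
  case: sm1 sm2 sm3 => _ _ x1 [_ _ x2] [_ _ x3].
  by rewrite /qtri !x3 // !x2 // !x1.
apply: runs_weaken (H4 h k0 s3 hk r13 _) (leqnn _) _.
  move=> q qh; rewrite qe; split; first exact: hq.
  by apply: tri_lt_le (vlt q qh); rewrite leq_exp2l.
move=> s4 [sm4 ok4]; split.
- apply: same_trans (same_sub _ sm1) _; first by move=> x; rewrite !mem_iota; lia.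
  apply: same_trans (same_sub _ sm2) _; first by move=> x; rewrite !mem_iota; lia.
  apply: same_trans (same_sub _ sm3) (same_sub _ sm4);
    by move=> x; rewrite mem_iota !inE => /or3P[] /eqP->.
- move=> q qh; case: sm3 sm4 => _ _ x3 [_ _ x4]; rewrite !x4 // !x3 //.
  have hi : (0 < 2 ^ h + q < 2 ^ h.+1)%N.
    by have := expn_gt0 2 h; rewrite expnS; lia.
  have [e0 _ e1 e2 _] := ok2 _ hi; rewrite hgt_leaf // muln1 node_prod_leaf // in e0 e1 e2.
move=> q qh; exists (vtri s3 (2 ^ h + q)).
  by rewrite ok4 // qe; split=> //; exact: vlt.
by have [_ _ _] := ok3 q qh; rewrite /= node_prod_leaf // prefix_prod_leaf.
Qed.

Fixpoint total_tri (N : nat) (B : tri int) (cs : seq component) (q : nat) : tri int :=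
  if cs is cp :: cs' then
    total_tri N (tmul (tmul B (\big[@tmul int/tone int]_(0 <= l < q) leaf N cp l)) (bdry cp)) cs' q
  else B.

Lemma pow_h x h : (x < 2 ^ x)%N -> (x * 2 ^ h < 2 ^ (x + h))%N.
Proof. by move=> hx; rewrite expnD ltn_mul2r hx expn_gt0. Qed.

Lemma nmod_bound N c h q : (q < 2 ^ h)%N -> (nmod N c q < 2 ^ ((N + c).+1 * h.+1))%N.
Proof.
move=> qh; have [/eqP|N0] := posnP (N + c).
  by rewrite addn_eq0 => /andP[/eqP-> /eqP->]; rewrite /nmod mul0n expn_gt0.
apply: leq_trans (_ : (2 ^ (N + c + h) <= _)%N); last first.
  by rewrite leq_exp2l // mulSn mulnS; nia.
apply: leq_ltn_trans (_ : ((N + c) * 2 ^ h < _)%N); last by apply/pow_h/ltn_expl.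
by rewrite /nmod mulnDl leq_add // ?leq_mul2l ?(ltnW qh) ?orbT // leq_pmulr // expn_gt0.
Qed.

Lemma int_bound (x : int) h : (`|x| < 2 ^ (bitlen x * h.+1))%N.
Proof.
by apply: leq_trans (bits_ltn _) _; rewrite leq_exp2l // leq_pmulr.
Qed.

Lemma lin_bound N cst l : exists A, forall h q, (q < 2 ^ h)%N ->
  (`|lin N q cst l| < 2 ^ (A * h.+1))%N.
Proof.
elim: l => [|a l [A IH]].
  by exists (bitlen cst) => h q _; rewrite /lin big_nil mulr1; apply: int_bound.
exists (A + (N + `|a|).+1)%N => h q qh; rewrite /lin big_cons mulrCA mulrC abszM mulnDl expnD.
apply: ltn_mul; first exact: IH.
apply: leq_ltn_trans (nmod_bound N `|a| qh); rewrite /nmod; lia.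
Qed.

Lemma leaf_bound N cp : exists A, forall h q, (q < 2 ^ h)%N ->
  tri_lt (2 ^ (A * h.+1)) (leaf N cp q).
Proof.
have [A1 h1] := lin_bound N (numc cp) (nums cp).
have [A2 h2] := lin_bound N (denc cp) (dens cp).
exists (A1 + A2 + bitlen (wt cp))%N => h q qh; rewrite /leaf; split=> /=.
- by apply: leq_trans (h1 h q qh) _; rewrite leq_exp2l // leq_mul2r -addnA leq_addr orbT.
- apply: (@leq_trans (2 ^ (bitlen (wt cp) * h.+1) * 2 ^ (A2 * h.+1))).
    by rewrite abszM ltn_mul ?h2 ?int_bound.
  by rewrite -expnD leq_exp2l // -mulnDl leq_mul2r; apply/orP; right; lia.
- by apply: leq_trans (h2 h q qh) _; rewrite leq_exp2l // leq_mul2r; apply/orP; right; lia.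
Qed.

Lemma tri_bound (B : tri int) : exists A, forall h, tri_lt (2 ^ (A * h.+1)) B.
Proof.
exists (bitlen B.1.1 + bitlen B.1.2 + bitlen B.2)%N => h; split;
  (apply: leq_trans (int_bound _ h) _; rewrite leq_exp2l // leq_mul2r; apply/orP; right; lia).
Qed.

Fixpoint seq_prog (Ps : seq program) : program :=
  if Ps is P :: Ps' then Seq P (seq_prog Ps') else Skip.

Lemma comps_runs N c cs e : ~~ odd N -> odd c -> exists C K, forall kappa h s T, (K <= kappa)%N ->
  let k0 := (kappa * h.+1)%N in
  reg s 1 = (2 ^ h)%N%:Z -> reg s 3 = k0%:Z ->
  (forall q, (q < 2 ^ h)%N -> tri_lt (2 ^ (e * h.+1)) (qtri s q) /\ peq (nmod N c q) (qtri s q) (T q)) ->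
  runs (seq_prog [seq comp_prog N c cp | cp <- cs]) s (C * Wt h k0)
    (fun s' => [/\ same (iota 0 12) s s', leaf_inv h k0 (nmod N c) s \/ (0 < size cs)%N -> leaf_inv h k0 (nmod N c) s' &
      forall q, (q < 2 ^ h)%N -> tri_lt (2 ^ k0.-1) (qtri s' q) /\
        peq (nmod N c q) (qtri s' q) (total_tri N (T q) cs q)]).
Proof.
move=> eN oc; elim: cs e => [|cp cs IH] e.
  exists 1%N, e.+1 => kappa h s T kk k0 r1 r3 hq; rewrite mul1n.
  have k00 : (0 < k0)%N by rewrite muln_gt0 andbT; apply: leq_trans kk.
  exists 1%N, s; split; [exact: ExecSkip|exact: Wt_gt0|].
  split=> //; first by case.
  move=> q qh; have [h1 h2] := hq q qh; split=> //.
  apply: tri_lt_le h1; rewrite leq_exp2l // -ltnS prednK //.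
  by apply: leq_trans (_ : (e.+1 * h.+1 <= _)%N); rewrite ?leq_mul2r ?kk ?orbT // mulSn addnC -addn1 leq_add2l.
have [A1 hA1] := leaf_bound N cp; have [A2 hA2] := tri_bound (bdry cp).
(* The new size: old triple, reduced product, boundary triple, and one spare bit for each of the two
   calls of [tmul]. *)
pose b := (N + c).+1; pose e' := ((e + b).+1 + A2).+1.
have [C1 H1] := comp_prog_runs cp eN oc; have [C2 [K2 H2]] := IH e'.
exists (C1 + C2)%N, (K2 + b + b + A1.+1 + e + 1)%N => kappa h s T kk k0 r1 r3 hq.
have leh x y : (x <= y)%N -> (2 ^ (x * h.+1) <= 2 ^ (y * h.+1))%N.
  by move=> xy; rewrite leq_exp2l // leq_mul2r xy orbT.
have tok : tree_ok h k0 (b * h.+1) (A1.+1 * h.+1) (nmod N c) (leaf N cp).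
  split.
  - by rewrite /k0; apply: leq_pmull; lia.
  - by rewrite -!mulnDl leq_mul2r; apply/orP; right; lia.
  - by [].
  - move=> q; split; first by rewrite /nmod oddD oddM (negPf eN) oc.
    by move=> qh; apply: nmod_bound.
  move=> q qh; apply: tri_lt_le (hA1 h q qh); rewrite leq_exp2l // mulSn /= leq_addl //.
rewrite /= mulnDl; apply: runs_seq (H1 h k0 _ _ s tok r1 r3 _) _.
  move=> q qh; have [h1 _] := hq q qh; apply: tri_lt_le h1; apply: leh; lia.
move=> s1 [sm1 li ok1]; case: (sm1) => x1 x2 x3.
have r11 : reg s1 1 = (2 ^ h)%N%:Z by rewrite x1.
have r13 : reg s1 3 = k0%:Z by rewrite x1.
have kk2 : (K2 <= kappa)%N by lia.
apply: runs_weaken (H2 kappa h s1 (fun q => tmul (tmul (T q)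
    (\big[@tmul int/tone int]_(0 <= l < q) leaf N cp l)) (bdry cp)) kk2 r11 r13 _) (leqnn _) _.
  move=> q qh; have [v [-> vb] vp] := ok1 q qh; have [h1 h2] := hq q qh; split.
    apply: tri_lt_le (tri_ltM (tri_ltM h1 vb) (hA2 h)); rewrite leq_exp2l // /e'.
    rewrite !mulSn !mulnDl !mulSn mulnDl; lia.
  by apply: peqM (peqM h2 vp) (peq_refl _ _).
move=> s2 [sm2 li2 ok2]; split=> //; first exact: same_trans sm1 sm2.
by move=> _; apply: li2; left.
Qed.

Definition init_body (B : tri int) : seq instr :=
  [:: Const 7 1; Diff 5 4 7; Const 8 B.1.1; WriteArr 9 5 8; Const 8 B.1.2; WriteArr 10 5 8;
      Const 8 B.2; WriteArr 11 5 8; Diff 4 4 7].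

Definition init_loop B : program := Seq (block count_up) (While 4 (block (init_body B))).

Lemma leE_E C h k0 : (C * (k0 * bits k0) <= C * (k0 * (k0 * (bits k0 + h.+1))))%N.
Proof.
rewrite leq_mul2l; apply/orP; right; case: k0 => // k; rewrite leq_mul2l.
by rewrite (leq_trans (leq_addr h.+1 _)) ?orbT // leq_pmull.
Qed.

Lemma init_loop_runs (B : tri int) : exists C, forall h k0 s, (h < k0)%N ->
  reg s 1 = (2 ^ h)%N%:Z ->
  runs (init_loop B) s (C * Wt h k0)
    (fun s' => same [:: 9; 10; 11]%N s s' /\ forall q, (q < 2 ^ h)%N -> qtri s' q = B).
Proof.
set c1 := bcoef ea1 (init_body B) acc_env.
exists (bcoef ea1 count_up [:: (1%N, Bits 1)] + (c1 + 4))%N => h k0 s hk h1.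
have k00 : (0 < k0)%N by apply: leq_ltn_trans hk.
pose J j s' := out s' = out s /\ forall q, (j <= q < 2 ^ h)%N -> qtri s' q = B.
apply: runs_weaken (@leaf_loop_gen _ [:: 9; 10; 11]%N J c1 h k0 s hk h1 _ _) (leqnn _) _.
- move=> s1 sm eo ea; split=> //.
  by move=> q /andP[hq1 /(leq_ltn_trans hq1)]; rewrite ltnn.
- move=> q s1 qh r4 [sr _ sa] [eo Jr]; rewrite /= in sr sa.
  have r1 : reg s1 1 = (2 ^ h)%N%:Z by rewrite sr.
  have e1 : q.+1%:Z - 1 = q%:Z by lia.
  apply: runs_weaken (_ : runs _ _ (c1 * (k0 * bits k0)) _) (leE_E _ _ _) (fun s2 => id).
  apply: runs_abs => //.
    by apply: env_allP; have [] := leaf_env hk r1 r4 qh.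
  split; first by rewrite /= r4.
    split=> [r hr||a ha].
    + by case: r hr => [|[|[|[|r]]]] // hr; rewrite /= sr.
    + by [].
    rewrite -sa //; apply/funext => kk.
    by case: a ha => [|[|[|[|[|[|[|[|[|[|[|[|a]]]]]]]]]]]].
  split; first exact: eo.
  move=> q' /andP[]; rewrite leq_eqVlt => /orP[/eqP<- _|qq' hq'].
    by rewrite /qtri /= r4 e1 !eqxx; case: (B) => [[]].
  by rewrite -(Jr q') ?qq' // /qtri /= r4 e1 !eqz_nat (gtn_eqF qq').
- by move=> s' [[s1 s2 s3] [eo Jr]].
Qed.

(** * The primality test at the leaves *)

Definition pr_body : seq instr :=
  [:: Const 7 1; Diff 5 4 7; Add 6 1 5; ReadArr 8 0 6; ReadArr 9 1 6; ReadArr 10 9 5;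
      ReadArr 11 11 5; Add 10 10 11;
      Mul 30 10 9; Shr 31 30 3; Shl 31 31 3; Diff 30 30 31; Mul 30 30 8; Diff 30 30 10; Shr 30 30 3;
      Diff 11 8 30; Mul 30 30 11; WriteArr 12 5 30; Diff 4 4 7].

Definition pr_loop : program := Seq (block count_up) (While 4 (block pr_body)).

Definition pr_env : env := [:: (1, Bits 1); (3, Mag 1); (4, Bits 1)].

(** A reduced value r in [0, n] represents zero exactly for r = 0 and r = n. The product r (n - r)
    turns this into a test for positivity, the only test the machine has. *)
Lemma redc_zero (n : nat) J k T : (0 < n)%N -> odd n -> inv2 k n%:Z J -> `|T| < 2 ^+ k ->
  let r := redc n J k T in
  (0 < r * (n%:Z - r)) = ~~ (n%:Z %| T)%Z /\ (`|(r * (n%:Z - r))%R| <= n * n)%N.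
Proof.
move=> n0 on hJ hT r; have pz : 0 < n%:Z :> int by [].
have [/andP[r0 rn] e] := redc_spec pz hJ hT; rewrite -/r in r0 rn e.
split; last by nia.
have -> : (n%:Z %| T)%Z = (n%:Z %| r)%Z.
  have c2 : coprimez n%:Z (- 2 ^+ k).
    by rewrite coprimez_sym coprimezE abszN abszX coprimeXl // coprime2n.
  rewrite -(Gauss_dvdzr r c2); apply/idP/idP => hd.
    by have := rpredD e hd; rewrite subrK.
  by have := rpredB hd e; rewrite subKr.
apply/idP/idP => [h0|].
  apply/negP => /dvdzP[m em]; have : 0 < m by nia.
  have : m < 1 by nia.
  lia.
move=> nd; have rn0 : r != 0 by apply: contraNneq nd => ->; rewrite dvdz0.
have rn1 : r != n by apply: contraNneq nd => ->.
nia.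
Qed.

Lemma pr_loop_runs : exists C, forall h k0 n_ s, (h < k0)%N ->
  reg s 1 = (2 ^ h)%N%:Z -> reg s 3 = k0%:Z -> leaf_inv h k0 n_ s ->
  (forall q, (q < 2 ^ h)%N -> odd (n_ q) /\ (n_ q < 2 ^ k0)%N) ->
  (forall q, (q < 2 ^ h)%N -> tri_lt (2 ^ k0.-1) (qtri s q)) ->
  runs pr_loop s (C * Wt h k0)
    (fun s' => same [:: 12]%N s s' /\ forall q, (q < 2 ^ h)%N ->
       (0 < arr s' 12 q%:Z) = ~~ ((n_ q)%:Z %| (qtri s q).1.1 + (qtri s q).2)%Z /\
       sat k0 (Bits 2) (arr s' 12 q%:Z)).
Proof.
set c1 := bcoef ea1 pr_body pr_env.
exists (bcoef ea1 count_up [:: (1%N, Bits 1)] + (c1 + 4))%N => h k0 n_ s hk h1 h3 li hn hq.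
have k00 : (0 < k0)%N by apply: leq_ltn_trans hk.
pose J j s' := out s' = out s /\ forall q, (j <= q < 2 ^ h)%N ->
       (0 < arr s' 12 q%:Z) = ~~ ((n_ q)%:Z %| (qtri s q).1.1 + (qtri s q).2)%Z /\
       sat k0 (Bits 2) (arr s' 12 q%:Z).
apply: runs_weaken (@leaf_loop_gen _ [:: 12]%N J c1 h k0 s hk h1 _ _) (leqnn _) _.
- move=> s1 sm eo ea; split=> //.
  by move=> q /andP[hq1 /(leq_ltn_trans hq1)]; rewrite ltnn.
- move=> q s1 qh r4 [sr _ sa] [eo Jr]; rewrite /= in sr sa.
  have r1 : reg s1 1 = (2 ^ h)%N%:Z by rewrite sr.
  have r3 : reg s1 3 = k0%:Z by rewrite sr.
  have e1 : q.+1%:Z - 1 = q%:Z by lia.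
  have e2 : (2 ^ h)%N%:Z + q%:Z = (2 ^ h + q)%N%:Z by rewrite PoszD.
  have [n0 i0 b0] := li q qh; have [on nk] := hn q qh.
  have hp : (2 ^ k0.-1 + 2 ^ k0.-1 = 2 ^ k0)%N by rewrite addnn -mul2n -expnS prednK.
  have lt1 x : (x < 2 ^ k0.-1)%N -> (x < 2 ^ k0)%N by rewrite -hp; lia.
  have [q1 q2 q3] := hq q qh; rewrite /= in q1 q2 q3.
  have tb : `|(qtri s q).1.1 + (qtri s q).2| < 2 ^+ k0.
    by rewrite /=; apply: ltz_pow2; move: q1 q3; rewrite -hp; lia.
  have [z1 z2] := redc_zero (odd_gt0 on) on i0 tb.
  apply: runs_weaken (_ : runs _ _ (c1 * (k0 * bits k0)) _) (leE_E _ _ _) (fun s2 => id).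
  apply: runs_abs => //.
    apply: env_allP; have [x1 x2] := leaf_env hk r1 r4 qh; split=> //; split=> //.
    by rewrite r3; apply: sat1_mag.
    rewrite /= r4 r1 e1 e2 !sa // n0; split; first exact: sat1_nat.
    split; first by apply: sat1_int; apply: absz_lt.
    by split; first (by apply: sat1_int; apply: lt1); split=> //; apply: sat1_int; apply: lt1.
  split; first by rewrite /= r4.
    split=> [r hr||a ha].
    + by case: r hr => [|[|[|[|r]]]] // hr; rewrite /= sr.
    + by [].
    by rewrite -sa //; apply/funext => kk; rewrite /=; move: ha; rewrite inE => /negPf->.
  split; first exact: eo.
  move=> q' /andP[]; rewrite leq_eqVlt => /orP[/eqP<- _|qq' hq'].
    rewrite /= r4 r1 r3 e1 e2 !eqxx !sa // n0 absz_nat -/(redc _ _ _ _).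
    split; first exact: z1.
    rewrite /sat mul2n -addnn expnD; apply: leq_ltn_trans z2 _.
    exact: ltn_mul.
  have := Jr q'; rewrite qq' hq' => /(_ isT).
  by rewrite /= r4 e1 !eqz_nat (gtn_eqF qq').
- by move=> s' [[s1 s2 s3] [eo Jr]].
Qed.

(** * Modular quotients by the binary gcd *)

Definition swap_block : seq instr :=
  [:: Const 29 0; Add 30 20 29; Add 20 22 29; Add 22 30 29;
      Add 30 21 29; Add 21 23 29; Add 23 30 29].

Definition gcd_body : program :=
  Seq (block [:: Shr 26 20 25; Add 26 26 26; Diff 26 20 26])
  (Seq (If 26
     (Seq (block [:: Diff 27 22 20])
     (Seq (If 27 (block swap_block) Skip)
     (Seq (block [:: Diff 20 20 22; Const 28 0; Diff 21 21 23; Diff 28 28 21])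
          (If 28 (block [:: Add 21 21 24]) Skip)))) Skip)
  (Seq (block [:: Shr 20 20 25; Shr 26 21 25; Add 26 26 26; Diff 26 21 26])
  (Seq (If 26 (block [:: Add 21 21 24]) Skip)
       (block [:: Shr 21 21 25])))).

(** Registers 20 to 23 hold [u, x, v, y] with [x = u * S / G] and
    [y = v * S / G] modulo [p]. *)
Definition gcd_inv (p : nat) (S G : int) (u x v y : nat) : Prop :=
  [/\ odd v && (v <= p)%N && (u <= p)%N, coprime u v, (x < p)%N && (y < p)%N,
      eqmod p (x%:Z * G) (u%:Z * S) & eqmod p (y%:Z * G) (v%:Z * S)].

Definition gcd_reg (p : nat) (s : state) (u x v y : nat) : Prop :=
  [/\ reg s 20 = u%:Z, reg s 21 = x%:Z, reg s 22 = v%:Z, reg s 23 = y%:Z &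
      reg s 24 = p%:Z /\ reg s 25 = 1].

Definition gcd_frame (s s' : state) : Prop :=
  [/\ forall r, (r < 20)%N -> reg s' r = reg s r, arr s' = arr s & out s' = out s].

Lemma gcd_frame_trans s1 s0 s2 : gcd_frame s0 s1 -> gcd_frame s1 s2 -> gcd_frame s0 s2.
Proof.
move=> [a1 a2 a3] [b1 b2 b3]; split; rewrite ?b2 ?b3 // => r hr.
by rewrite b1 // a1.
Qed.

Lemma gcd_frame_set s x v : (20 <= x)%N -> gcd_frame s (set_reg s x v).
Proof. by move=> hx; split=> //= r hr; case: eqP hx => // <-; lia. Qed.

Lemma gcd_sub p S G u x v y : odd u -> (v <= u)%N -> gcd_inv p S G u x v y ->
  let x' := (if x < y then x + p - y else x - y)%N in
  gcd_inv p S G (u - v)%N x' v y.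
Proof.
move=> ou vu [/andP[/andP[ov vp] up] cuv /andP[xp yp] e1 e2] x'; split=> //.
- by rewrite ov vp /=; lia.
- by rewrite /coprime gcdnC -gcdnDr subnK // gcdnC.
- by rewrite /x' yp andbT; case: ifP => h; lia.
have -> : x'%:Z * G = x%:Z * G - y%:Z * G + (if x < y then p%:Z else 0)%N * G.
  by rewrite /x' -mulrBl -mulrDl; congr (_ * _); case: ifP => h; lia.
rewrite /eqmod; have -> : x%:Z * G - y%:Z * G + (if (x < y)%N then p%:Z else 0) * G - (u - v)%N%:Z * S =
   (x%:Z * G - u%:Z * S) - (y%:Z * G - v%:Z * S) + (if (x < y)%N then p%:Z else 0) * G.
  by rewrite -subzn //; ring.
apply: rpredD; first exact: rpredB.
by case: ifP => _; rewrite ?mul0r ?dvdz0 // dvdz_mulr.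
Qed.

Lemma gcd_half p S G u x v y : odd p -> ~~ odd u -> gcd_inv p S G u x v y ->
  gcd_inv p S G u./2 (if odd x then (x + p)./2 else x./2) v y.
Proof.
move=> op eu [/andP[/andP[ov vp] up] cuv /andP[xp yp] e1 e2].
have u2 : u = (2 * u./2)%N by rewrite -[LHS]odd_double_half (negPf eu) mul2n.
split=> //.
- by rewrite ov vp /=; lia.
- by move: cuv; rewrite {1}u2 coprimeMl => /andP[].
- by rewrite yp andbT; case: ifP => h; lia.
set x' := if _ then _ else _.
have ex : (2 * x'%:Z = x%:Z \/ 2 * x'%:Z = x%:Z + p%:Z).
  by rewrite /x'; case: ifP => h; [right|left]; lia.
have c2 : coprimez p%:Z 2 by rewrite coprimezE coprimen2.
rewrite /eqmod -(Gauss_dvdzr _ c2).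
have -> : 2 * (x'%:Z * G - u./2%:Z * S) = (2 * x'%:Z) * G - u%:Z * S.
  by rewrite [in RHS]u2 PoszM; ring.
case: ex => ->; first exact: e1.
rewrite mulrDl addrAC; apply: rpredD; [exact: e1|exact: dvdz_mulr].
Qed.

Lemma runs_skip s T (Q : state -> Prop) : (0 < T)%N -> Q s -> runs Skip s T Q.
Proof. by move=> T0 q; exists 1%N, s; split=> //; exact: ExecSkip. Qed.

Lemma runs_ifU (K : nat) b x P1 P2 s T (Q : state -> Prop) : (0 < K)%N ->
  sat K b (reg s x) ->
  (0 < reg s x -> runs P1 s (T * (K * bits K)) Q) ->
  (reg s x <= 0 -> runs P2 s (T * (K * bits K)) Q) ->
  runs (If x P1 P2) s (((wid b).+1 + T) * (K * bits K)) Q.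
Proof.
move=> K0 hs h1 h2; rewrite mulnDl; apply: runs_if h1 h2.
by apply: leq_trans (sat_bitlen K0 hs) _; rewrite leq_mul2l leq_pmulr ?orbT.
Qed.

Lemma gcd_inv_swap p S G u x v y : odd u -> gcd_inv p S G u x v y -> gcd_inv p S G v y u x.
Proof.
by move=> ou [/andP[/andP[ov vp] up] c /andP[xp yp] e1 e2]; split; rewrite ?ou ?vp ?up ?xp ?yp // coprime_sym.
Qed.

Definition ge5 b : env := [:: (20, Bits 1); (21, Bits b); (22, Bits 1); (23, Bits 1);
  (24, Bits 1); (25, Bits (bitlen 1)); (28, Bits 1)].

Definition gblk1 := [:: Shr 26 20 25; Add 26 26 26; Diff 26 20 26].
Definition gblk2 := [:: Diff 27 22 20].
Definition gblk3 := [:: Diff 20 20 22; Const 28 0; Diff 21 21 23; Diff 28 28 21].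
Definition gblk4 := [:: Add 21 21 24].
Definition gblk5 := [:: Shr 20 20 25; Shr 26 21 25; Add 26 26 26; Diff 26 21 26].
Definition gblk6 := [:: Shr 21 21 25].

Lemma gcd_env_ok p k0 s u x v y : (p < 2 ^ k0)%N -> (0 < k0)%N -> gcd_reg p s u x v y ->
  (u <= p)%N -> (v <= p)%N -> (x < p)%N -> (y < p)%N ->
  env_all k0 [:: (20, Bits 1); (21, Bits 1); (22, Bits 1); (23, Bits 1);
  (24, Bits 1); (25, Bits (bitlen 1))]%N (reg s).
Proof.
move=> pk k00 [r20 r21 r22 r23 [r24 r25]] up vp xp yp.
have le z : (z <= p)%N -> sat k0 (Bits 1) z%:Z by move=> zp; apply: sat1_nat; apply: leq_ltn_trans pk.
rewrite /env_all r20 r21 r22 r23 r24 r25.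
do 5![split; first by apply: le => //; exact: ltnW].
by split; first exact: sat_const.
Qed.

Lemma odd_divz (u : nat) : u%:Z - ((u%:Z %/ 2 ^+ `|1%Z|)%Z + (u%:Z %/ 2 ^+ `|1%Z|)%Z) = (odd u)%:Z.
Proof.
rewrite expr1; have -> : (u%:Z %/ 2)%Z = u./2%:Z by rewrite -divn2 divz_nat.
lia.
Qed.

Lemma half_divz (u : nat) : (u%:Z %/ 2 ^+ `|1%Z|)%Z = u./2%:Z.
Proof. by rewrite expr1 -divn2 divz_nat. Qed.

Definition high (i : instr) : bool :=
  match i with
  | Const x _ | Add x _ _ | Diff x _ _ | Mul x _ _ | Shl x _ _ | Shr x _ _ | ReadArr x _ _ => (20 <= x)%N
  | _ => false
  end.

Lemma run_high l s : all high l -> gcd_frame s (run l s).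
Proof.
elim: l s => [|i l IH] s //= /andP[hi /IH h]; apply: gcd_frame_trans (h _).
by case: i hi => //= *; apply: gcd_frame_set.
Qed.

Definition gcd_step_coef : nat :=
  let c b l := bcoef ea1 l (take 6 (ge5 b)) in
  (c 1 gblk1 + ((3 + (c 1 gblk2 + ((4 + (c 1 swap_block).+1) + (c 1 gblk3 + (2 + (c 1 gblk4).+1))))) +
   (c 1 gblk5 + ((4 + (c 1 gblk4).+1) + c 2 gblk6))))%N.

(** If u is odd, a swap makes v <= u and the difference u - v is even; then u is halved. As v stays
    odd, halving preserves coprimality, and every round at least halves the product u v. *)
Lemma gcd_body_runs p S G k0 s u x v y : odd p -> (p < 2 ^ k0)%N -> (0 < k0)%N ->
  gcd_reg p s u x v y -> gcd_inv p S G u x v y ->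
  runs gcd_body s (gcd_step_coef * (k0 * bits k0)) (fun s' => gcd_frame s s' /\
    exists u' x' v' y', [/\ gcd_reg p s' u' x' v' y', gcd_inv p S G u' x' v' y' &
      (2 * (u' * v') <= u * v)%N]).
Proof.
move=> op pk k00 gr gi; have p0 := odd_gt0 op.
have U0 T : (0 < T.+1 * (k0 * bits k0))%N by rewrite !muln_gt0 k00.
have [/andP[/andP[ov vp] up] _ /andP[xp yp] _ _] := gi.
rewrite /gcd_step_coef /= mulnDl.
apply: (@runs_seq _ _ _ _ _ (fun s1 => [/\ gcd_reg p s1 u x v y, reg s1 26 = (odd u)%:Z & gcd_frame s s1])).
  apply: runs_abs => //; first exact/env_allP/(gcd_env_ok pk k00 gr).
  have [r20 r21 r22 r23 [r24 r25]] := gr.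
  by split; [split|rewrite /= r20 r25 odd_divz|exact: run_high].
move=> s1 [gr1 r26 fr1]; rewrite mulnDl.
apply: (@runs_seq _ _ _ _ _ (fun s2 => gcd_frame s s2 /\ exists u1 x1 v1 y1, [/\ gcd_reg p s2 u1 x1 v1 y1,
    gcd_inv p S G u1 x1 v1 y1, ~~ odd u1 & (u1 * v1 <= u * v)%N])).
  apply: (runs_ifU (b := Bits 2)) => //.
  - by rewrite r26; case: (odd u) => //=; rewrite ?expn_gt0 // -{1}(expn0 2) ltn_exp2l // muln_gt0.
  - rewrite r26 => ou; have {}ou : odd u by case: (odd u) ou.
    rewrite mulnDl; apply: (@runs_seq _ _ _ _ _ (fun s2 => [/\ gcd_reg p s2 u x v y, reg s2 27 = v%:Z - u%:Z & gcd_frame s s2])).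
      apply: runs_abs => //; first exact/env_allP/(gcd_env_ok pk k00 gr1).
      have [r20 r21 r22 r23 [r24 r25]] := gr1.
      by split; [split|rewrite /= r20 r22|exact: gcd_frame_trans fr1 (run_high _ _)].
    move=> s2 [gr2 r27 fr2]; rewrite mulnDl.
    apply: (@runs_seq _ _ _ _ _ (fun s3 => gcd_frame s s3 /\ exists u1 x1 v1 y1, [/\ gcd_reg p s3 u1 x1 v1 y1,
      gcd_inv p S G u1 x1 v1 y1, odd u1, (v1 <= u1)%N & (u1 * v1 = u * v)%N])).
      apply: (runs_ifU (b := Bits 3)) => //.
      + rewrite r27 /sat; apply: (@leq_trans (2 ^ k0)); first by lia.
        by rewrite leq_exp2l // leq_pmull.
      + move=> hlt; rewrite r27 in hlt; rewrite mulSn.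
        apply: runs_weaken (_ : runs _ _ (bcoef ea1 swap_block (take 6 (ge5 1)) * (k0 * bits k0)) _) (leq_addl _ _) (fun s => id).
        apply: runs_abs => //; first exact/env_allP/(gcd_env_ok pk k00 gr2).
        have [r20 r21 r22 r23 [r24 r25]] := gr2; split.
          exact: gcd_frame_trans fr2 (run_high _ _).
        exists v, y, u, x; split=> //; last by rewrite mulnC.
          by split=> //=; rewrite ?r20 ?r21 ?r22 ?r23 ?addr0.
          exact: gcd_inv_swap.
        by lia.
      + move=> hge; rewrite r27 in hge; apply: runs_skip => //; split=> //.
        by exists u, x, v, y; split=> //; lia.
    move=> s3 [fr3 [u1 [x1 [v1 [y1 [gr3 gi3 ou1 vu1 e1]]]]]]; rewrite mulnDl.
    have [/andP[/andP[ov1 vp1] up1] _ /andP[xp1 yp1] _ _] := gi3.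
    apply: (@runs_seq _ _ _ _ _ (fun s4 => [/\ gcd_frame s s4, reg s4 20 = (u1 - v1)%N%:Z,
        reg s4 21 = x1%:Z - y1%:Z, reg s4 28 = y1%:Z - x1%:Z &
        [/\ reg s4 22 = v1%:Z, reg s4 23 = y1%:Z, reg s4 24 = p%:Z & reg s4 25 = 1]])).
      apply: runs_abs => //; first exact/env_allP/(gcd_env_ok pk k00 gr3).
      have [r20 r21 r22 r23 [r24 r25]] := gr3; split.
      + exact: gcd_frame_trans fr3 (run_high _ _).
      + by rewrite /= r20 r22; lia.
      + by rewrite /= r21 r23.
      + by rewrite /= r21 r23; lia.
      + by [].
    move=> s4 [fr4 r20 r21 r28 [r22 r23 r24 r25]].
    have fin := gcd_sub ou1 vu1 gi3.
    have ev : ~~ odd (u1 - v1) by rewrite oddB // ou1 ov1.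
    have le1 : ((u1 - v1) * v1 <= u * v)%N by rewrite -e1 leq_mul2r leq_subr orbT.
    apply: (runs_ifU (b := Bits 1)) => //.
    + by rewrite r28; apply: sat1_int; lia.
    + move=> hlt; rewrite r28 in hlt; rewrite mulSn.
      apply: runs_weaken (_ : runs _ _ (bcoef ea1 gblk4 (take 6 (ge5 1)) * (k0 * bits k0)) _) (leq_addl _ _) (fun s => id).
      apply: runs_abs => //.
        apply: env_allP; rewrite /env_all /= r20 r21 r22 r23 r24 r25.
        do 5![split; first by apply: sat1_int; lia].
        by split; first exact: sat_const.
      split.
        exact: gcd_frame_trans fr4 (run_high _ _).
      have xy : (x1 < y1)%N by lia.
      move: fin; rewrite xy => fin; exists (u1 - v1)%N, (x1 + p - y1)%N, v1, y1; split=> //.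
      split=> //=; rewrite r21 r24; lia.
    + move=> hge; rewrite r28 in hge; apply: runs_skip => //; split=> //.
      have xy : (x1 < y1)%N = false by lia.
      move: fin; rewrite xy => fin; exists (u1 - v1)%N, (x1 - y1)%N, v1, y1; split=> //.
      by split=> //; rewrite r21; lia.
  - rewrite r26 => eu; have {}eu : ~~ odd u by case: (odd u) eu.
    apply: runs_skip; last by split=> //; exists u, x, v, y.
    by rewrite addSn U0.
move=> s2 [fr2 [u1 [x1 [v1 [y1 [gr2 gi2 eu1 le1]]]]]]; rewrite mulnDl.
have [/andP[/andP[ov1 vp1] up1] _ /andP[xp1 yp1] _ _] := gi2.
apply: (@runs_seq _ _ _ _ _ (fun s3 => [/\ gcd_frame s s3, gcd_reg p s3 u1./2 x1 v1 y1 & reg s3 26 = (odd x1)%:Z])).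
  apply: runs_abs => //; first exact/env_allP/(gcd_env_ok pk k00 gr2).
  have [r20 r21 r22 r23 [r24 r25]] := gr2; split.
  - exact: gcd_frame_trans fr2 (run_high _ _).
  - by split=> //=; rewrite r20 r25 half_divz.
  - by rewrite /= r21 r25 odd_divz.
move=> s3 [fr3 [r20 r21 r22 r23 [r24 r25]] {}r26]; rewrite mulnDl.
pose x2 := (if odd x1 then x1 + p else x1)%N.
have x2b : (x2 < 2 ^ (2 * k0))%N.
  apply: (@leq_trans (2 ^ k0.+1)); first by rewrite /x2 expnS; case: ifP; lia.
  by rewrite leq_exp2l // mul2n -addnn -addn1 leq_add2l.
apply: (@runs_seq _ _ _ _ _ (fun s4 => [/\ gcd_frame s s4, reg s4 20 = u1./2%:Z, reg s4 21 = x2%:Z &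
        [/\ reg s4 22 = v1%:Z, reg s4 23 = y1%:Z, reg s4 24 = p%:Z & reg s4 25 = 1]])).
  apply: (runs_ifU (b := Bits 3)) => //.
  - by rewrite r26 /sat; case: (odd x1) => //=; rewrite ?expn_gt0 // -{1}(expn0 2) ltn_exp2l // muln_gt0.
  - rewrite r26 => ox; have {}ox : odd x1 by case: (odd x1) ox.
    rewrite mulSn; apply: runs_weaken (_ : runs _ _ (bcoef ea1 gblk4 (take 6 (ge5 1)) * (k0 * bits k0)) _) (leq_addl _ _) (fun s => id).
    apply: runs_abs => //.
      by apply/env_allP/(gcd_env_ok pk k00 (u := u1./2) (x := x1) (v := v1) (y := y1)) => //; lia.
    split=> //.
      exact: gcd_frame_trans fr3 (run_high _ _).
    by rewrite /= r21 r24 /x2 ox.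
  - rewrite r26 => ox; have {}ox : odd x1 = false by case: (odd x1) ox.
    by apply: runs_skip => //; split=> //; rewrite r21 /x2 ox.
move=> s4 [fr4 {}r20 {}r21 [{}r22 {}r23 {}r24 {}r25]].
apply: runs_abs => //.
  apply: env_allP; rewrite /env_all /= r20 r21 r22 r23 r24 r25.
  split; first by apply: sat1_nat; lia.
  split; first exact: x2b.
  do 3![split; first by apply: sat1_nat; lia].
  by split; first exact: sat_const.
split.
  exact: gcd_frame_trans fr4 (run_high _ _).
exists u1./2, x2./2, v1, y1; split.
- by split=> //=; rewrite r21 r25 half_divz.
- by have := gcd_half op eu1 gi2; rewrite /x2; case: (odd x1).
apply: leq_trans le1; rewrite mulnA leq_mul2r; apply/orP; right; lia.
Qed.

(** Initially u v < 2^(2 k0), which allows 2 k0 rounds. At the end u = 0, so coprimality forces v =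
    1 and y is the quotient S / G. *)
Lemma gcd_loop_runs : exists C, forall p S G k0 s u x v y, odd p -> (p < 2 ^ k0)%N -> (0 < k0)%N ->
  gcd_reg p s u x v y -> gcd_inv p S G u x v y ->
  runs (While 20 gcd_body) s (C * (k0 * (k0 * bits k0))) (fun s' => gcd_frame s s' /\
    exists2 y', reg s' 23 = y'%:Z & (y' < p)%N /\ eqmod p (y'%:Z * G) S).
Proof.
exists (2 * gcd_step_coef + 6)%N => p S G k0 s u x v y op pk k00 gr gi.
pose I j s' := gcd_frame s s' /\ exists u x v y, [/\ gcd_reg p s' u x v y, gcd_inv p S G u x v y &
  (u * v < 2 ^ j)%N].
apply: runs_weaken (@runs_while 20 _ I (fun=> gcd_step_coef * (k0 * bits k0))%N (2 * k0) (2 * k0) s _ _ _) _ _.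
- move=> j s' [_ [u' [x' [v' [y' [[-> _ _ _ _] [/andP[_ up] _ _ _ _] _]]]]]].
  apply: (@sat_bitlen _ (Bits 1)) => //; apply: sat1_nat; exact: leq_ltn_trans pk.
- move=> j s' [fr [u' [x' [v' [y' [gr' gi' lt]]]]]] u0.
  have [r20 _ _ _ _] := gr'; have [/andP[/andP[ov _] _] _ _ _ _] := gi'.
  case: j lt => [|j] lt; first by move: u0 lt; rewrite r20; case: (v') ov => // ? _; nia.
  exists j => //; apply: runs_weaken (gcd_body_runs op pk k00 gr' gi') (leqnn _) _.
  move=> s2 [fr2 [u2 [x2 [v2 [y2 [gr2 gi2 lt2]]]]]]; split; first exact: gcd_frame_trans fr fr2.
  exists u2, x2, v2, y2; split=> //; move: (leq_ltn_trans lt2 lt).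
  by rewrite expnS ltn_mul2l.
- split=> //; exists u, x, v, y; split=> //.
  have [/andP[/andP[_ vp] up] _ _ _ _] := gi.
  by rewrite mul2n -addnn expnD; apply: ltn_mul; apply: leq_ltn_trans pk.
- rewrite sum_nat_const card_ord; move: gcd_step_coef (bits k0) (bits_gt0 k0) => a b b0.
  have e1 : (k0 <= k0 * k0)%N by rewrite leq_pmulr.
  have e2 : (k0 * k0 <= k0 * (k0 * b))%N by rewrite leq_mul2l leq_pmulr ?orbT.
  have -> : (2 * k0 * (a * (k0 * b) + 2 * k0) + 2 * k0 =
     2 * a * (k0 * (k0 * b)) + (4 * (k0 * k0) + 2 * k0))%N by ring.
  by rewrite mulnDl leq_add2l; lia.
- move=> s' [j [fr [u' [x' [v' [y' [[r20 _ _ r23 _] [hv co /andP[_ yp] _ e2] _]]]]]]].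
  rewrite r20 => u0; split=> //; exists y' => //; split=> //.
  have u00 : u' = 0%N by lia.
  have v1 : v' = 1%N by move: co; rewrite u00 /coprime gcd0n => /eqP.
  by move: e2; rewrite v1 mul1r.
Qed.

(** * From the triple of a prime to its residue *)

Definition redc_to (t dst : nat) : seq instr :=
  [:: Mul 30 t 9; Shr 31 30 3; Shl 31 31 3; Diff 30 30 31; Mul 30 30 8; Diff 30 30 t;
      Shr dst 30 3].

Definition emit_pre : seq instr :=
  [:: ReadArr 13 10 5; ReadArr 14 11 5] ++ redc_to 13 21 ++ redc_to 14 20 ++
  [:: Const 15 0; Add 22 8 15; Const 23 0; Add 24 8 15; Const 25 1; Diff 26 8 21].

Definition emit : program :=
  Seq (block emit_pre)
  (Seq (If 26 Skip (block [:: Const 21 0]))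
  (Seq (While 20 gcd_body) (block [:: Output 8; Output 23]))).

Definition emit_env : env := [:: (3, Mag 1); (5, Bits 1); (8, Bits 1); (9, Bits 1)].
Definition fin_env : env := [:: (8, Bits 1); (23, Bits 1)].

(** The reduced values S' and G' carry the same unit, so S' G = G' S modulo p, and the gcd may start
    from u = G', x = S', v = p, y = 0. If S' = p, the other representative of zero, it is replaced
    by 0 because [gcd_inv] wants x < p; G' = p is excluded since p does not divide G. *)
Lemma emit_runs : exists C, forall p h k0 s q J, prime p -> odd p -> (p < 2 ^ k0)%N -> (0 < k0)%N ->
  (h < k0)%N -> (q < 2 ^ h)%N ->
  reg s 3 = k0%:Z -> reg s 5 = q%:Z -> reg s 8 = p%:Z -> reg s 9 = J -> inv2 k0 p%:Z J ->
  0 <= J < 2 ^+ k0 -> tri_lt (2 ^ k0) (qtri s q) -> ~~ (p%:Z %| (qtri s q).2)%Z ->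
  runs emit s (C * (k0 * (k0 * bits k0))) (fun s' =>
    [/\ forall r, (r < 8)%N -> reg s' r = reg s r, arr s' = arr s &
    exists y, [/\ out s' = rcons (rcons (out s) p%:Z) y%:Z, (y < p)%N &
      eqmod p (y%:Z * (qtri s q).2) (qtri s q).1.2]]).
Proof.
have [C1 H1] := gcd_loop_runs.
set l2 := [:: Output 8; Output 23]; set l1 := [:: Const 21 0].
exists (bcoef ea1 emit_pre emit_env + ((3 + (bcoef ea1 l1 [::]).+1) + (C1 + bcoef ea1 l2 fin_env)))%N.
move=> p h k0 s q J pp op pk k00 hk qh r3 r5 r8 r9 hJ hb [q1 q2 q3] nG.
rewrite /= in q1 q2 q3; have p0 := odd_gt0 op; have pz : 0 < p%:Z :> int by [].
set U := (k0 * (k0 * bits k0))%N.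
have UT T P s0 (Q : state -> Prop) : runs P s0 (T * (k0 * bits k0)) Q -> runs P s0 (T * U) Q.
  by move=> hr; apply: runs_weaken hr _ _ => //; rewrite leq_mul2l leq_pmull ?orbT.
have hpow : (2 ^ h < 2 ^ k0)%N by rewrite ltn_exp2l.
set S := (qtri s q).1.2; set G := (qtri s q).2 in nG *.
have [/andP[s0 sp] es] := redc_spec pz hJ (ltz_pow2 q2).
have [/andP[g0 gp] eg] := redc_spec pz hJ (ltz_pow2 q3).
set S' := redc _ _ _ _ in s0 sp es; set G' := redc _ _ _ _ in g0 gp eg.
have c2 : coprimez p%:Z (- 2 ^+ k0).
  by rewrite coprimez_sym coprimezE abszN abszX coprimeXl // coprime2n.
have cross : eqmod p (S' * G) (G' * S).
  rewrite /eqmod -(Gauss_dvdzr _ c2).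
  have -> : - 2 ^+ k0 * (S' * G - G' * S) = (- 2 ^+ k0 * S' - S) * G - (- 2 ^+ k0 * G' - G) * S by ring.
  by apply: rpredB; apply: dvdz_mulr.
have nG' : ~~ (p%:Z %| G')%Z.
  apply: contra nG => hd; have := rpredB (dvdz_mull (- 2 ^+ k0) hd) eg.
  by rewrite subKr.
rewrite mulnDl; apply: (@runs_seq _ _ _ _ _ (fun s1 =>
  [/\ [/\ reg s1 20 = G', reg s1 21 = S', reg s1 22 = p%:Z & reg s1 23 = 0],
     [/\ reg s1 24 = p%:Z, reg s1 25 = 1 & reg s1 26 = p%:Z - S'],
     forall r, (r < 13)%N -> reg s1 r = reg s r, arr s1 = arr s & out s1 = out s])).
  apply: UT; apply: runs_abs => //.
  - apply: env_allP; split; first by rewrite r3; apply: sat1_mag.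
    split; first by rewrite r5; apply: sat1_nat; apply: ltn_trans hpow.
    split; first by rewrite r8; apply: sat1_nat.
    by split=> //; rewrite r9; apply: sat1_int; apply: absz_lt.
  - by rewrite /= r5; split; [|split=> //]; apply: sat1_int.
  split=> //.
  - by rewrite /= r3 r5 r8 r9 absz_nat addr0.
  - by rewrite /= r3 r5 r8 r9 absz_nat addr0.
  by move=> r; case: r => [|[|[|[|[|[|[|[|[|[|[|[|[|r]]]]]]]]]]]]].
move=> s1 [[r20 r21 r22 r23] [r24 r25 r26] hr ha ho]; rewrite mulnDl.
apply: (@runs_seq _ _ _ _ _ (fun s2 => exists u x,
  [/\ gcd_reg p s2 u x p 0, gcd_inv p S G u x p 0, forall r, (r < 13)%N -> reg s2 r = reg s r,
     arr s2 = arr s & out s2 = out s])).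
  apply: UT; apply: (runs_ifU (b := Bits 2)) => //.
  - rewrite r26 /sat mul2n -addnn expnD; apply: (@leq_trans (2 ^ k0)); first by lia.
    by rewrite leq_pmulr // expn_gt0.
  - rewrite r26 => lt; apply: runs_skip; first by rewrite !muln_gt0 k00.
    exists `|G'|%N, `|S'|%N; split=> //; rewrite /gcd_reg /gcd_inv ?gez0_abs //; split=> //.
    + by rewrite op leqnn; lia.
    + rewrite coprime_sym prime_coprime //; by move: nG'; rewrite dvdzE.
    + by apply/andP; split; lia.
    by rewrite /eqmod mul0r sub0r rpredN dvdz_mulr.
  - rewrite r26 => ge; have eS : S' = p by lia.
    rewrite mulSn; apply: runs_weaken (_ : runs _ _ (bcoef ea1 l1 [::] * (k0 * bits k0)) _) (leq_addl _ _) (fun s => id).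
    apply: runs_abs => //; exists `|G'|%N, 0%N; split=> //; last first.
    + by move=> r; case: r => [|[|[|[|[|[|[|[|[|[|[|[|[|r]]]]]]]]]]]]] // _; rewrite /= hr.
    + split; rewrite ?gez0_abs ?op ?leqnn ?p0 //; first by lia.
      * rewrite coprime_sym prime_coprime //; by move: nG'; rewrite dvdzE.
      * rewrite mul0r; move: cross; rewrite /eqmod eS sub0r => hc.
        have := rpredB hc (dvdz_mulr G (dvdzz p)); by rewrite addrAC subrr sub0r.
      by rewrite /eqmod mul0r sub0r rpredN dvdz_mulr.
    by split; rewrite /= ?gez0_abs.
move=> s2 [u [x [gr gi hr2 ha2 ho2]]]; rewrite mulnDl.
apply: runs_seq (H1 p S G k0 s2 u x p 0%N op pk k00 gr gi) _.
move=> s3 [[f1 f2 f3] [y r23' [yp ye]]].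
have r8' : reg s3 8 = p%:Z by rewrite f1 // hr2.
apply: UT; apply: runs_abs => //.
  apply: env_allP; split; first by rewrite r8'; apply: sat1_nat.
  by split=> //; rewrite r23'; apply: sat1_nat; apply: ltn_trans pk.
split=> /=.
- by move=> r hr8; rewrite f1 ?hr2 //; lia.
- by rewrite f2.
by exists y; rewrite r8' r23' f3 ho2.
Qed.

(** * The program and its running time *)

Definition out_pre (p0 : nat) : seq instr :=
  [:: Const 7 1; Diff 5 4 7; Add 6 1 5; ReadArr 8 0 6; ReadArr 9 1 6; ReadArr 10 12 5;
      Diff 11 0 8; Add 11 11 7; Const 12 p0%:Z; Diff 12 8 12].

Definition out_body (p0 : nat) : program :=
  Seq (block (out_pre p0))
  (Seq (If 10 Skip (If 11 (If 12 emit Skip) Skip))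
       (block [:: Const 7 1; Diff 4 4 7])).

Definition out_loop p0 : program := Seq (block count_up) (While 4 (out_body p0)).

Definition pairs (ans : seq (nat * nat)) : seq int :=
  flatten [seq [:: pc.1%:Z; pc.2%:Z] | pc <- ans].

Definition residue_of (acc : tri int) (p y : nat) : Prop :=
  (y < p)%N /\ eqmod p (y%:Z * acc.2) acc.1.2.

Definition eaP : nat -> bnd := fun a => if a == 12%N then Bits 2 else Bits 1.
Definition out_env : env := [:: (0, Bits 1); (1, Bits 1); (4, Bits 1)].

Lemma out_loop_runs p0 : exists C, forall h k0 X n_ s, (h < k0)%N -> (X < 2 ^ h)%N ->
  (bitlen p0%:Z <= k0)%N ->
  reg s 0 = X%:Z -> reg s 1 = (2 ^ h)%N%:Z -> reg s 3 = k0%:Z -> leaf_inv h k0 n_ s ->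
  (forall q, (q < 2 ^ h)%N -> odd (n_ q) /\ (n_ q < 2 ^ k0)%N) ->
  (forall q, (q < 2 ^ h)%N -> (0 < arr s 12 q%:Z) = ~~ prime (n_ q) /\ sat k0 (Bits 2) (arr s 12 q%:Z)) ->
  (forall q, (q < 2 ^ h)%N -> tri_lt (2 ^ k0) (qtri s q)) ->
  (forall q, (q < 2 ^ h)%N -> prime (n_ q) -> (p0 < n_ q)%N -> ~~ ((n_ q)%:Z %| (qtri s q).2)%Z) ->
  runs (out_loop p0) s (C * Wt h k0)
    (fun s' => [/\ forall r, (r < 4)%N -> reg s' r = reg s r &
      exists ans, [/\ out s' = out s ++ pairs ans,
        unzip1 ans = [seq n_ q | q <- rev (iota 0 (2 ^ h)) & prime (n_ q) && (p0 < n_ q <= X)%N] &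
        forall p y, (p, y) \in ans -> exists q, [/\ (q < 2 ^ h)%N, p = n_ q & residue_of (qtri s q) p y]]]).
Proof.
have [C1 H1] := emit_runs.
set l2 := [:: Const 7 1; Diff 4 4 7].
set c1 := (bcoef eaP (out_pre p0) out_env +
   ((4 + (4 + (4 + C1.+1))) + bcoef ea1 l2 [:: (4%N, Bits 1)]))%N.
exists (bcoef ea1 count_up [:: (1%N, Bits 1)] + (c1 + 4))%N.
move=> h k0 X n_ s hk hX hp0 h0 h1 h3 li hn hP hq hG.
have k00 : (0 < k0)%N by apply: leq_ltn_trans hk.
have hpow : (2 ^ h < 2 ^ k0)%N by rewrite ltn_exp2l.
pose P q := prime (n_ q) && (p0 < n_ q <= X)%N.
pose J j s' := exists ans, [/\ out s' = out s ++ pairs ans,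
  unzip1 ans = [seq n_ q | q <- rev (iota j (2 ^ h - j)) & P q] &
  forall p y, (p, y) \in ans -> exists q, [/\ (q < 2 ^ h)%N, p = n_ q & residue_of (qtri s q) p y]].
apply: runs_weaken (@leaf_loop_gen _ [::] J c1 h k0 s hk h1 _ _) (leqnn _) _.
- by move=> s1 sm eo ea; exists [::]; rewrite subnn /= cats0.
- move=> q s1 qh r4 [sr _ sa] [ans [eo ea ok]]; rewrite /= in sr sa.
  set U := (k0 * (k0 * (bits k0 + h.+1)))%N.
  have U0 : (k0 * bits k0 <= U)%N by have := leE_E 1 h k0; rewrite !mul1n.
  have UT T Q s0 (R : state -> Prop) : runs Q s0 (T * (k0 * bits k0)) R -> runs Q s0 (T * U) R.
    by move=> hr; apply: runs_weaken hr _ _ => //; rewrite leq_mul2l U0 orbT.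
  have U00 : (0 < U)%N by apply: leq_trans U0; rewrite muln_gt0 k00.
  have r0 : reg s1 0 = X%:Z by rewrite sr.
  have r1 : reg s1 1 = (2 ^ h)%N%:Z by rewrite sr.
  have r3 : reg s1 3 = k0%:Z by rewrite sr.
  have e1 : q.+1%:Z - 1 = q%:Z by lia.
  have e2 : (2 ^ h)%N%:Z + q%:Z = (2 ^ h + q)%N%:Z by rewrite PoszD.
  have [n0 i0 b0] := li q qh; have [on nk] := hn q qh; have [p1 p2] := hP q qh.
  rewrite mulnDl; apply: (@runs_seq _ _ _ _ _ (fun s2 =>
    [/\ [/\ reg s2 3 = k0%:Z, reg s2 4 = q.+1%:Z, reg s2 5 = q%:Z, reg s2 8 = (n_ q)%:Z &
            reg s2 9 = arr s 1 (2 ^ h + q)%N%:Z],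
        [/\ reg s2 10 = arr s 12 q%:Z, reg s2 11 = X%:Z - (n_ q)%:Z + 1 & reg s2 12 = (n_ q)%:Z - p0%:Z],
        forall r, (r < 5)%N -> reg s2 r = reg s1 r, arr s2 = arr s1 & out s2 = out s1])).
    apply: UT; apply: runs_abs => //.
    + apply: env_allP; have [x1 x2] := leaf_env hk r1 r4 qh; split=> //.
      by rewrite r0; apply: sat1_nat; apply: ltn_trans hpow.
    + rewrite /= r4 r1 e1 e2 !sa // n0; split; first exact: sat1_nat.
      by split; first (by apply: sat1_int; apply: absz_lt); split.
    split=> //=; rewrite ?r4 ?r1 ?r0 ?e1 ?e2 ?sa // n0 //.
    by move=> r; case: r => [|[|[|[|[|r]]]]].
  move=> s2 [[r3' r4' r5 r8 r9] [r10 r11 r12] hr ha ho]; rewrite mulnDl.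
  have aq s' : arr s' = arr s1 -> qtri s' q = qtri s q by rewrite /qtri => ->; rewrite !sa.
  apply: (@runs_seq _ _ _ _ _ (fun s3 =>
    [/\ forall r, (r < 5)%N -> reg s3 r = reg s1 r, arr s3 = arr s1 &
      if P q then exists y, out s3 = out s1 ++ pairs [:: (n_ q, y)] /\ residue_of (qtri s q) (n_ q) y
      else out s3 = out s1])).
    have sk T s0 : s0 = s2 -> P q = false -> (0 < T)%N -> runs Skip s0 T (fun s3 =>
      [/\ forall r, (r < 5)%N -> reg s3 r = reg s1 r, arr s3 = arr s1 &
      if P q then exists y, out s3 = out s1 ++ pairs [:: (n_ q, y)] /\ residue_of (qtri s q) (n_ q) y
      else out s3 = out s1]).
      by move=> -> -> T0; apply: runs_skip.
    have ifU b x P1 P2 T (Q : state -> Prop) : (wid b <= 3)%N -> sat k0 b (reg s2 x) ->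
        (0 < reg s2 x -> runs P1 s2 (T * U) Q) -> (reg s2 x <= 0 -> runs P2 s2 (T * U) Q) ->
        runs (If x P1 P2) s2 ((4 + T) * U) Q.
      move=> w3 hs a1 a2; rewrite mulnDl; apply: runs_if a1 a2.
      apply: leq_trans (sat_bitlen k00 hs) _; apply: (@leq_trans (4 * (k0 * bits k0))).
        by apply: leq_mul => //; rewrite leq_pmulr.
      by rewrite leq_mul2l U0 orbT.
    apply: (ifU (Bits 2)) => //; first by rewrite r10.
      by rewrite r10 p1 => np; apply: sk; rewrite // ?/P ?(negPf np) // muln_gt0 U00.
    rewrite r10 leNgt p1 negbK => pn; apply: (ifU (Bits 2)) => //.
    + rewrite r11 /sat mul2n -addnn expnD; apply: (@leq_trans (2 ^ k0 + 2 ^ k0)); first by lia.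
      by rewrite addnn -mul2n leq_mul2r; apply/orP; right; rewrite -{1}(expn1 2) leq_exp2l.
    + rewrite r11 => ltX; have nX : (n_ q <= X)%N by lia.
      apply: (ifU (Bits 2)) => //.
      * rewrite r12 /sat mul2n -addnn expnD; apply: (@leq_trans (2 ^ k0 + 2 ^ k0)).
          have hp : (p0 < 2 ^ k0)%N by apply: leq_trans (bits_ltn p0) _; rewrite leq_exp2l.
          by lia.
        by rewrite addnn -mul2n leq_mul2r; apply/orP; right; rewrite -{1}(expn1 2) leq_exp2l.
      * rewrite r12 => lt0; have p0n : (p0 < n_ q)%N by lia.
        have Pq : P q by rewrite /P pn nX p0n.
        have nG : ~~ ((n_ q)%:Z %| (qtri s2 q).2)%Z by rewrite aq // hG.
        have bq : tri_lt (2 ^ k0) (qtri s2 q) by rewrite aq //; apply: hq.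
        apply: runs_weaken (H1 (n_ q) h k0 s2 q _ pn on nk k00 hk qh r3' r5 r8 r9 i0 b0 bq nG) _ _.
          by apply: leq_mul => //; rewrite !leq_mul2l leq_addr !orbT.
        move=> s3 [f1 f2 [y [f3 yn ye]]]; split; rewrite ?f2 //.
          by move=> r hr5; rewrite f1 ?hr // (leq_trans hr5).
        rewrite Pq; exists y; split; last by split=> //; move: ye; rewrite aq.
        by rewrite f3 ho -!cats1 -catA.
      * rewrite r12 => ge0; apply: sk => //; last by rewrite muln_gt0 U00.
        by rewrite /P pn /= (_ : (p0 < _)%N = false) //; lia.
    + rewrite r11 => geX; apply: sk => //; last by rewrite muln_gt0 U00.
      by rewrite /P pn /= (_ : (n_ q <= X)%N = false) ?andbF //; lia.
  move=> s3 [f1 f2 f3].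
  apply: UT; apply: runs_abs => //.
    apply: env_allP; have [x1 x2] := leaf_env hk r1 r4 qh; split=> //.
    by rewrite f1.
  split; first by rewrite /= f1 // r4.
    split=> [r hr4||a _]; [|by []|by rewrite /= f2 sa].
    by case: r hr4 => [|[|[|[|r]]]] // _; rewrite /= f1 ?sr.
  rewrite /J (_ : (2 ^ h - q = (2 ^ h - q.+1).+1)%N); last by lia.
  rewrite /= rev_cons filter_rcons; case: ifP f3 => Pq.
    case=> y [eo3 res]; exists (rcons ans (n_ q, y)).
    rewrite /= eo3 eo /pairs map_rcons -cats1 flatten_cat catA; split=> //.
      by rewrite /unzip1 map_rcons -/(unzip1 _) ea map_rcons.
    move=> p y'; rewrite mem_rcons inE => /orP[/eqP[-> ->]|]; last exact: ok.
    by exists q.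
  by move=> eo3; exists ans; rewrite /= eo3.
- by move=> s' [[s1 s2 s3] [ans [eo ea ok]]]; split=> //; exists ans; rewrite subn0 in ea.
Qed.

(** Its triples multiply to [(p - 1)!] modulo [p = c + N * q]. *)
Definition wilson_comp (N c : nat) : component :=
  Component 1 [seq t%:Z | t <- iota 1 N] 0 1 [::]
    (\prod_(t <- iota 1 c.-1) (t%:Z - c%:Z), 0, 1).

Lemma fact_shift m k : ((m + k)`! = m`! * \prod_(t <- iota 1 k) (m + t))%N.
Proof.
elim: k => [|k IH]; first by rewrite addn0 big_nil muln1.
rewrite -addn1 iotaD big_cat big_seq1 /= add1n addn1 addnS factS IH.
by rewrite mulnCA (mulnC _.+1).
Qed.

(** The tree supplies the factors up to N q. The last c - 1 factors N q + t are congruent to t - c,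
    which no longer involves q and can sit in the boundary triple. *)
Lemma wilson_total N c q : (0 < c)%N ->
  let T := total_tri N (tone int) [:: wilson_comp N c] q in
  eqmod (nmod N c q) T.1.1 ((nmod N c q).-1`!)%:Z /\ T.2 = 1.
Proof.
move=> c0 /=.
have -> : \big[@tmul int/tone int]_(0 <= l < q) leaf N (wilson_comp N c) l = (((N * q)`!)%:Z, 0, 1).
  elim: q => [|q IH]; first by rewrite big_geq // muln0.
  rewrite big_nat_recr //= IH /leaf /lin /= big_nil big_map mul0r mulr1.
  rewrite /tmul /= !mulr0 mul0r addr0 mul1r mulr1 mulnSr fact_shift.
  by congr (_, _, _); rewrite [RHS]PoszM (big_morph Posz PoszM (erefl 1%:Z)).
rewrite /tmul /= !mulr1 !mul1r; split=> //.
have -> : ((nmod N c q).-1 = N * q + c.-1)%N by rewrite /nmod; case: (c) c0 => //= k _; rewrite addnS.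
rewrite fact_shift PoszM; apply: eqmodM; first exact: eqmod_refl.
rewrite (big_morph Posz PoszM (erefl 1%:Z)).
elim: (iota 1 c.-1) => [|t l IH]; first by rewrite !big_nil eqmod_refl.
rewrite !big_cons; apply: eqmodM IH; rewrite /eqmod /nmod.
have -> : t%:Z - c%:Z - (N * q + t)%N%:Z = - (N * q + c)%N%:Z by lia.
by rewrite rpredN dvdzz.
Qed.

(** The factorial is known only up to a unit, but the last entry of the triple is 1 times the same
    unit. Hence the sum of the two entries is a unit times (n - 1)! + 1. *)
Lemma wilson_test N c q a : (1 < nmod N c q)%N -> (0 < c)%N ->
  peq (nmod N c q) a (total_tri N (tone int) [:: wilson_comp N c] q) ->
  ((nmod N c q)%:Z %| a.1.1 + a.2)%Z = prime (nmod N c q).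
Proof.
move=> n1 c0 [u cu [e1 _ e3]]; have [w1 w2] := wilson_total N q c0.
set n := nmod N c q in n1 cu e1 e3 w1 w2 *; rewrite w2 in e3.
rewrite Wilson // -(Gauss_dvdzr _ (_ : coprimez n u)); last by rewrite coprimez_sym.
have e : eqmod n (u * (a.1.1 + a.2)) ((n.-1`!).+1)%:Z.
  by rewrite mulrDr -addn1 PoszD; apply: eqmodD e3; apply: eqmod_trans e1 w1.
apply/idP/idP => hd.
  by have := rpredB hd e; rewrite subKr dvdzE.
by have := rpredD e (hd : (n%:Z %| (n.-1`!).+1%:Z)%Z); rewrite subrK.
Qed.

(** The trees are run on the same arrays for Wilson's test and then for the trace. The verdicts in
    array 12 survive because components touch arrays 0 to 11 only. *)
Definition class_prog (p0 kappa N c : nat) (B : tri int) (cs : seq component) : program :=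
  Seq (block [:: Const 7 kappa%:Z; Mul 3 7 2])
  (Seq (init_loop (tone int))
  (Seq (seq_prog [seq comp_prog N c cp | cp <- [:: wilson_comp N c]])
  (Seq pr_loop
  (Seq (init_loop B)
  (Seq (seq_prog [seq comp_prog N c cp | cp <- cs])
       (out_loop p0)))))).

Definition class_answers (p0 N c : nat) B cs h X (ans : seq (nat * nat)) : Prop :=
  unzip1 ans = [seq nmod N c q | q <- rev (iota 0 (2 ^ h)) & prime (nmod N c q) && (p0 < nmod N c q <= X)%N] /\
  forall p y, (p, y) \in ans -> exists q, [/\ (q < 2 ^ h)%N, p = nmod N c q & residue_of (total_tri N B cs q) p y].

Lemma Wt_bound kappa h : (0 < kappa)%N ->
  (Wt h (kappa * h.+1) <= kappa * kappa * (kappa + 2) * (2 ^ h * h.+1 ^ 3))%N.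
Proof.
move=> k0; rewrite /Wt.
have b : (bits (kappa * h.+1) + h.+1 <= (kappa + 2) * h.+1)%N.
  have h1 := bits_mul kappa h.+1; have h2 := bits_leid k0; have h3 := bits_leid (isT : (0 < h.+1)%N).
  have h4 : (kappa <= kappa * h.+1)%N by rewrite leq_pmulr.
  rewrite mulnDl mul2n -addnn addnA leq_add2r; apply: leq_trans h1 _.
  by apply: leq_add h3; apply: leq_trans h2 h4.
apply: (@leq_trans (2 ^ h * (kappa * h.+1 * (kappa * h.+1 * ((kappa + 2) * h.+1))))).
  by rewrite !leq_mul2l b !orbT.
rewrite !expnS expn0 muln1; apply: eq_leq; ring.
Qed.

Lemma class_prog_runs p0 N c B cs : ~~ odd N -> odd c -> (1 < c)%N ->
  (forall q, prime (nmod N c q) -> (p0 < nmod N c q)%N ->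
     ~~ ((nmod N c q)%:Z %| (total_tri N B cs q).2)%Z) ->
  exists P C, forall h X s, (X < 2 ^ h)%N ->
    reg s 0 = X%:Z -> reg s 1 = (2 ^ h)%N%:Z -> reg s 2 = h.+1%:Z ->
    runs P s (C * (2 ^ h * h.+1 ^ 3)) (fun s' =>
      (forall r, (r < 3)%N -> reg s' r = reg s r) /\
      exists2 ans, out s' = out s ++ pairs ans & class_answers p0 N c B cs h X ans).
Proof.
move=> eN oc c1 hG; have c0 : (0 < c)%N by apply: ltnW.
have [e1 he1] := tri_bound (tone int); have [e2 he2] := tri_bound B.
have [C1 [K1 H1]] := comps_runs [:: wilson_comp N c] e1 eN oc.
have [C2 [K2 H2]] := comps_runs cs e2 eN oc.
have [C3 H3] := init_loop_runs (tone int); have [C4 H4] := init_loop_runs B.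
have [C5 H5] := pr_loop_runs; have [C6 H6] := out_loop_runs p0.
(* [K1] and [K2] make room for the accumulated triples, [b] for the moduli and [bitlen p0%:Z] for
   the threshold; the final 1 ensures h < k0. *)
pose b := (N + c).+1; pose kappa := (K1 + K2 + b + bitlen p0%:Z + 1)%N.
set l0 := [:: Const 7 kappa%:Z; Mul 3 7 2]; pose ev0 : env := [:: (2%N, Mag 1)].
pose CW := (kappa * kappa * (kappa + 2))%N.
exists (class_prog p0 kappa N c B cs), (bcoef ea1 l0 ev0 + (C3 + (C1 + (C5 + (C4 + (C2 + C6))))) * CW)%N.
move=> h X s hX r0 r1 r2; pose k0 := (kappa * h.+1)%N.
have kap0 : (0 < kappa)%N by rewrite /kappa addn1.
have hk : (h < k0)%N by rewrite /k0 leq_pmull.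
have k00 : (0 < k0)%N by apply: leq_ltn_trans hk.
have hn q : (q < 2 ^ h)%N -> odd (nmod N c q) /\ (nmod N c q < 2 ^ k0)%N.
  move=> qh; split; first by rewrite /nmod oddD oddM (negPf eN) oc.
  apply: leq_trans (nmod_bound _ _ qh) _; rewrite leq_exp2l // leq_mul2r; apply/orP; right.
  by rewrite /kappa /b; lia.
have ltk a : tri_lt (2 ^ k0.-1) a -> tri_lt (2 ^ k0) a.
  by apply: tri_lt_le; rewrite leq_exp2l // leq_pred.
rewrite mulnDl; apply: (@runs_seq _ _ _ _ _ (fun s1 =>
  [/\ reg s1 3 = k0%:Z, forall r, (r < 3)%N -> reg s1 r = reg s r & out s1 = out s])).
  apply: runs_weaken (_ : runs _ _ (bcoef ea1 l0 ev0 * (h.+1 * bits h.+1)) _) _ (fun s1 => id).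
    apply: runs_abs => //.
      by apply: env_allP; split=> //; rewrite r2; apply: sat1_mag.
    split=> //; first by rewrite /= r2.
    by move=> r; case: r => [|[|[|r]]].
  rewrite leq_mul2l; apply/orP; right.
  have hb := bits_leid (isT : (0 < h.+1)%N).
  apply: (@leq_trans (h.+1 * h.+1)); first by rewrite leq_mul2l hb orbT.
  by rewrite !expnS expn0 muln1 mulnA leq_pmull // muln_gt0 expn_gt0.
move=> s1 [q3 qr qo]; have q0 : reg s1 0 = X%:Z by rewrite qr.
have q1 : reg s1 1 = (2 ^ h)%N%:Z by rewrite qr.
have WB T : (T * Wt h k0 <= T * CW * (2 ^ h * h.+1 ^ 3))%N.
  by rewrite -mulnA leq_mul2l Wt_bound ?orbT.
apply: runs_weaken _ (WB _) (fun s => id).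
rewrite mulnDl; apply: runs_seq (H3 h k0 s1 hk q1) _ => s2 [sm2 a2].
have [x2 o2 _] := sm2; have q12 : reg s2 1 = (2 ^ h)%N%:Z by rewrite x2.
have q32 : reg s2 3 = k0%:Z by rewrite x2.
have kk1 : (K1 <= kappa)%N by rewrite /kappa; lia.
rewrite mulnDl; apply: runs_seq (H1 kappa h s2 (fun=> tone int) kk1 q12 q32 _) _.
  by move=> q qh; rewrite a2 //; split; [exact: he1|exact: peq_refl].
move=> s3 [sm3 li3 a3]; have [x3 o3 _] := sm3.
have {}li3 : leaf_inv h k0 (nmod N c) s3 by apply: li3; right.
have q13 : reg s3 1 = (2 ^ h)%N%:Z by rewrite x3.
have q33 : reg s3 3 = k0%:Z by rewrite x3.
rewrite mulnDl; apply: runs_seq (H5 h k0 _ s3 hk q13 q33 li3 hn _) _.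
  by move=> q qh; case: (a3 q qh).
move=> s4 [sm4 a4]; have [x4 o4 ar4] := sm4.
have q14 : reg s4 1 = (2 ^ h)%N%:Z by rewrite x4.
rewrite mulnDl; apply: runs_seq (H4 h k0 s4 hk q14) _ => s5 [sm5 a5].
have [x5 o5 ar5] := sm5.
have q15 : reg s5 1 = (2 ^ h)%N%:Z by rewrite x5.
have q35 : reg s5 3 = k0%:Z by rewrite x5 // x4.
have kk2 : (K2 <= kappa)%N by rewrite /kappa; lia.
rewrite mulnDl; apply: runs_seq (H2 kappa h s5 (fun=> B) kk2 q15 q35 _) _.
  by move=> q qh; rewrite a5 //; split; [exact: he2|exact: peq_refl].
move=> s6 [sm6 li6 a6]; have [x6 o6 ar6] := sm6.
have {}li6 : leaf_inv h k0 (nmod N c) s6.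
  apply: li6; left => q qh; rewrite !ar5 // !ar4 //; exact: li3.
have xx r : (r < 4)%N -> reg s6 r = reg s1 r.
  by move=> hr; rewrite x6 // x5 // x4 // x3 // x2.
have q06 : reg s6 0 = X%:Z by rewrite xx.
have q16 : reg s6 1 = (2 ^ h)%N%:Z by rewrite xx.
have q36 : reg s6 3 = k0%:Z by rewrite xx.
apply: runs_weaken (H6 h k0 X _ s6 hk hX _ q06 q16 q36 li6 hn _ _ _) (leqnn _) _.
- by apply: leq_trans (_ : (kappa <= _)%N); [rewrite /kappa; lia|rewrite leq_pmulr].
- move=> q qh; rewrite ar6 // ar5 //; have [-> ?] := a4 q qh; split=> //.
  have n1 : (1 < nmod N c q)%N by rewrite /nmod (leq_trans c1) // leq_addl.
  by rewrite (wilson_test n1 c0) //; case: (a3 q qh).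
- by move=> q qh; case: (a6 q qh) => /ltk.
- move=> q qh pn pp; have [_ [u cu [_ _ e3]]] := a6 q qh.
  apply: contra (hG q pn pp) => hd; have := rpredB (dvdz_mull u hd) e3.
  by rewrite subKr.
move=> s7 [x7 [ans [o7 u7 hans]]]; split.
  by move=> r hr; rewrite x7 ?xx ?qr // ltnW.
exists ans; first by rewrite o7 o6 o5 o4 o3 o2 qo.
split=> // p y /hans[q [qh pq [yp ye]]]; exists q; split=> //; split=> //.
have [_ [u cu [_ u2 u3]]] := a6 q qh; rewrite -pq in u2 u3.
have h1 : eqmod p (u * (y%:Z * (qtri s6 q).2)) (u * (qtri s6 q).1.2).
  by apply: eqmodM => //; exact: eqmod_refl.
apply: eqmod_trans (eqmod_trans h1 u2).
by rewrite mulrCA; apply: eqmodM; [exact: eqmod_refl|exact: eqmod_sym].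
Qed.

(** * The height of the trees, the table of small primes, and the total time *)

Definition setup_pre : seq instr :=
  [:: Const 1 1; Const 2 1; Const 5 1; Diff 4 0 1; Add 4 4 5].
Definition setup_body : seq instr :=
  [:: Add 1 1 1; Add 2 2 5; Diff 4 0 1; Add 4 4 5].
Definition setup : program := Seq (block setup_pre) (While 4 (block setup_body)).

Definition setup_env : env :=
  [:: (0, Bits 1); (1, Bits 1); (2, Mag 1); (5, Bits (bitlen 1)); (4, Bits 1)].

(** Doubling stops at the first power of 2 above X, so there are at most 2 X leaves, or one leaf for
    X = 0; the bound 2 X + 1 covers both cases. *)
Lemma setup_runs : exists C, forall X s, reg s 0 = X%:Z ->
  runs setup s (C * (bits X).+1 ^ 3) (fun s' => out s' = out s /\ exists h,
    [/\ reg s' 0 = X%:Z, reg s' 1 = (2 ^ h)%N%:Z, reg s' 2 = h.+1%:Z, (X < 2 ^ h <= 2 * X + 1)%N &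
        (h <= bits X)%N]).
Proof.
pose c0 := bcoef ea1 setup_pre [:: (0%N, Bits 1)]; pose c1 := bcoef ea1 setup_body setup_env.
exists (c0 + (c1 + 4))%N => X s r0; set K := (bits X).+1.
have K0 : (0 < K)%N by [].
have XK : (X < 2 ^ bits X)%N by exact: bits_ltn.
have KK : (2 ^ K = 2 ^ bits X + 2 ^ bits X)%N by rewrite /K expnS mul2n addnn.
have bK : (K * bits K <= K ^ 2)%N by rewrite expnS expn1 leq_mul2l bits_leid.
have bK3 : (K * bits K <= K ^ 3)%N by apply: leq_trans bK _; rewrite leq_exp2l //; lia.
pose I j s' := exists d, [/\ [/\ reg s' 0 = X%:Z, reg s' 1 = (2 ^ d)%N%:Z, reg s' 2 = d.+1%:Z & reg s' 5 = 1],
  reg s' 4 = X%:Z - (2 ^ d)%N%:Z + 1, out s' = out s, (d + j = bits X)%N & (2 ^ d <= 2 * X + 1)%N].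
rewrite mulnDl; apply: (@runs_seq _ _ _ _ _ (I (bits X))).
  apply: runs_weaken (_ : runs _ _ (c0 * (K * bits K)) _) _ (fun s => id); last by rewrite leq_mul2l bK3 orbT.
  apply: runs_abs => //.
    by apply: env_allP; split=> //; rewrite r0; apply: sat1_nat; lia.
  by exists 0%N; rewrite /= r0; split=> //; lia.
move=> s1 hI.
apply: runs_weaken (@runs_while 4 _ I (fun=> c1 * (K * bits K))%N (2 * K) (bits X) s1 _ _ hI) _ _.
- move=> j s' [d [_ r4 _ dj dX]]; apply: (@sat_bitlen _ (Bits 1)) => //; apply: sat1_int.
  rewrite r4; have : (2 ^ d <= 2 ^ bits X)%N by rewrite leq_exp2l //; lia.
  by have := expn_gt0 2 d; lia.
- move=> j s' [d [[q0 q1 q2 q5] r4 qo dj dX]]; rewrite r4 => hpos.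
  have dle : (2 ^ d <= X)%N by lia.
  have dlt : (d < bits X)%N by rewrite -(@ltn_exp2l 2) //; apply: leq_ltn_trans XK.
  have d2 : (2 ^ d.+1 = 2 ^ d + 2 ^ d)%N by rewrite expnS mul2n addnn.
  case: j dj => [|j] dj; first by lia.
  exists j => //; apply: runs_abs => //.
    apply: env_allP; rewrite /env_all /setup_env q0 q1 q2 q5 r4.
    split; first by apply: sat1_nat; lia.
    split; first by apply: sat1_nat; lia.
    split; first by apply: sat1_mag; lia.
    split; first exact: sat_const.
    by split=> //; apply: sat1_int; have := expn_gt0 2 d; lia.
  exists d.+1; split=> //=; rewrite ?q0 ?q1 ?q2 ?q5 ?d2; try lia.
  by split=> //; lia.
- rewrite sum_nat_const card_ord.
  have e1 : (bits X <= K)%N by [].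
  have e2 : (bits X * (c1 * (K * bits K)) <= c1 * K ^ 3)%N.
    by rewrite mulnCA leq_mul2l (expnS K 2) leq_mul ?orbT.
  have e3 : (bits X * (2 * K) + 2 * K <= 4 * K ^ 3)%N.
    have h2 : (2 * (K * K) <= 2 * K ^ 3)%N by rewrite !expnS expn0 muln1 leq_mul2l [(K * (K * K))%N]mulnC leq_pmulr.
    have h3 : (2 * K <= 2 * (K * K))%N by rewrite leq_mul2l leq_pmulr.
    have h4 : (bits X * (2 * K) <= 2 * (K * K))%N by rewrite mulnCA leq_mul2l leq_mul2r e1 !orbT.
    by lia.
  by rewrite mulnDr mulnDl -addnA leq_add.
- move=> s' [j [d [[q0 q1 q2 q5] r4 qo dj dX]]]; rewrite r4 => hneg; split=> //.
  by exists d; split=> //; lia.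
Qed.

Fixpoint table (tab : seq (nat * nat)) : program :=
  if tab is pc :: tab' then
    Seq (block [:: Const 5 pc.1%:Z; Diff 6 0 5; Const 7 1; Add 6 6 7])
    (Seq (If 6 (block [:: Const 7 pc.2%:Z; Output 5; Output 7]) Skip) (table tab'))
  else Skip.

Lemma table_runs tab : exists C, forall X s, reg s 0 = X%:Z ->
  runs (table tab) s (C * (bits X).+1 ^ 3) (fun s' => 
    (forall r, (r < 3)%N -> reg s' r = reg s r) /\
    out s' = out s ++ pairs [seq pc <- tab | (pc.1 <= X)%N]).
Proof.
elim: tab => [|[p c] tab [C IH]].
  exists 1%N => X s r0; apply: runs_skip; first by rewrite mul1n expn_gt0.
  by rewrite /= cats0.
set l0 := [:: Const 5 p%:Z; Diff 6 0 5; Const 7 1; Add 6 6 7].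
set l1 := [:: Const 7 c%:Z; Output 5; Output 7].
set w := (bitlen p%:Z + 1)%N.
pose c0 := bcoef ea1 l0 [:: (0%N, Bits 1)]; pose c1 := bcoef ea1 l1 [:: (5%N, Bits w)].
exists (c0 + ((w.+2 + c1.+1) + C))%N => X s r0; set K := (bits X).+1.
have K0 : (0 < K)%N by [].
have XK : (X < 2 ^ bits X)%N by exact: bits_ltn.
have bK : (K * bits K <= K ^ 2)%N by rewrite expnS expn1 leq_mul2l bits_leid.
have bK3 : (K * bits K <= K ^ 3)%N by apply: leq_trans bK _; rewrite leq_exp2l //; lia.
have UT T P s0 (Q : state -> Prop) : runs P s0 (T * (K * bits K)) Q -> runs P s0 (T * K ^ 3) Q.
  by move=> hr; apply: runs_weaken hr _ _ => //; rewrite leq_mul2l bK3 orbT.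
have pK : (p < 2 ^ (bitlen p%:Z * K))%N by apply: leq_trans (bits_ltn p) _; rewrite leq_exp2l // leq_pmulr.
have XK' : (X < 2 ^ K)%N by apply: ltn_trans XK _; rewrite ltn_exp2l.
have e1 : (2 ^ (bitlen p%:Z * K) <= 2 ^ (w * K))%N by rewrite leq_exp2l // leq_mul2r leq_addr orbT.
have e2 : (2 ^ K * 2 ^ K <= 2 ^ (w.+1 * K))%N.
  by rewrite -expnD leq_exp2l // addnn -mul2n leq_mul2r; apply/orP; right; rewrite /w addn1 !ltnS.
have e3 : (2 ^ (w * K) * 2 ^ K = 2 ^ (w.+1 * K))%N by rewrite -expnD mulSn addnC.
have e4 : (2 <= 2 ^ K)%N by rewrite -{1}(expn1 2) leq_exp2l.
rewrite mulnDl; change (table ((p, c) :: tab)) with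
  (Seq (block l0) (Seq (If 6 (block l1) Skip) (table tab))).
apply: (@runs_seq _ _ _ _ _ (fun s1 =>
  [/\ reg s1 5 = p%:Z, reg s1 6 = X%:Z - p%:Z + 1, forall r, (r < 3)%N -> reg s1 r = reg s r & out s1 = out s])).
  apply: UT; apply: runs_abs => //.
    by apply: env_allP; split=> //; rewrite r0; apply: sat1_nat.
  by split=> //=; [rewrite r0|move=> r; case: r => [|[|[|r]]]].
move=> s1 [q5 q6 qr qo]; rewrite mulnDl; apply: (@runs_seq _ _ _ _ _ (fun s2 =>
  (forall r, (r < 3)%N -> reg s2 r = reg s r) /\ out s2 = out s ++ (if (p <= X)%N then [:: p%:Z; c%:Z] else [::]))).
  apply: UT; apply: (runs_ifU (b := Bits w.+1)) => //.
  - rewrite q6 /sat -e3; have := expn_gt0 2 (w * K); nia.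
  - rewrite q6 => h1; have -> : (p <= X)%N by lia.
    rewrite mulSn; apply: runs_weaken (_ : runs _ _ (c1 * (K * bits K)) _) (leq_addl _ _) (fun s => id).
    apply: runs_abs => //.
      by apply: env_allP; split=> //; rewrite q5; apply: leq_trans pK _.
    split; first by move=> r hr; rewrite -qr //; case: r hr => [|[|[|r]]].
    by rewrite /= q5 qo -!cats1 -catA.
  - rewrite q6 => h1; have -> : (p <= X)%N = false by lia.
    apply: runs_skip; first by rewrite !muln_gt0 K0.
    by rewrite cats0 qo; split.
move=> s2 [qr2 qo2]; apply: runs_weaken (IH X s2 _) (leqnn _) _; first by rewrite qr2.
move=> s3 [qr3 qo3]; split; first by move=> r hr; rewrite qr3 ?qr2.
by rewrite qo3 qo2 -catA /=; case: ifP.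
Qed.

Lemma classes_runs p0 N (cl : seq nat) (Bf : nat -> tri int) (cf : nat -> seq component) :
  ~~ odd N -> (forall c, c \in cl -> [/\ odd c, (1 < c)%N & forall q, prime (nmod N c q) ->
     (p0 < nmod N c q)%N -> ~~ ((nmod N c q)%:Z %| (total_tri N (Bf c) (cf c) q).2)%Z]) ->
  exists P C, forall h X s, (X < 2 ^ h)%N ->
    reg s 0 = X%:Z -> reg s 1 = (2 ^ h)%N%:Z -> reg s 2 = h.+1%:Z ->
    runs P s (C * (2 ^ h * h.+1 ^ 3)) (fun s' => exists ans, [/\ out s' = out s ++ pairs ans,
      unzip1 ans = flatten [seq [seq nmod N c q | q <- rev (iota 0 (2 ^ h)) &
        prime (nmod N c q) && (p0 < nmod N c q <= X)%N] | c <- cl] &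
      forall p y, (p, y) \in ans -> exists c q, [/\ c \in cl, p = nmod N c q &
        residue_of (total_tri N (Bf c) (cf c) q) p y]]).
Proof.
move=> eN; elim: cl => [|c cl IH] hcl.
  exists Skip, 1%N => h X s _ _ _ _; apply: runs_skip; first by rewrite !muln_gt0 !expn_gt0.
  by exists [::]; rewrite /= cats0.
have [oc c1 hG] : [/\ odd c, (1 < c)%N & forall q, prime (nmod N c q) ->
     (p0 < nmod N c q)%N -> ~~ ((nmod N c q)%:Z %| (total_tri N (Bf c) (cf c) q).2)%Z].
  by apply: hcl; rewrite inE eqxx.
have [P1 [C1 H1]] := class_prog_runs eN oc c1 hG.
have [|P2 [C2 H2]] := IH; first by move=> c' hc'; apply: hcl; rewrite inE hc' orbT.
exists (Seq P1 P2), (C1 + C2)%N => h X s hX r0 r1 r2.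
rewrite mulnDl; apply: runs_seq (H1 h X s hX r0 r1 r2) _ => s1 [qr [ans1 o1 [u1 a1]]].
apply: runs_weaken (H2 h X s1 hX _ _ _) (leqnn _) _; rewrite ?qr //.
move=> s2 [ans2 [o2 u2 a2]]; exists (ans1 ++ ans2); split.
- by rewrite o2 o1 /pairs map_cat flatten_cat catA.
- by rewrite /unzip1 map_cat -!/(unzip1 _) u1 u2.
move=> p y; rewrite mem_cat => /orP[/a1[q [_ e1 e2]]|/a2[c' [q [e1 e2 e3]]]].
  by exists c, q; rewrite inE eqxx.
by exists c', q; rewrite inE e1 orbT.
Qed.

Lemma algorithm p0 N (tab : seq (nat * nat)) (cl : seq nat) (Bf : nat -> tri int)
    (cf : nat -> seq component) :
  ~~ odd N -> (forall c, c \in cl -> [/\ odd c, (1 < c)%N & forall q, prime (nmod N c q) ->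
     (p0 < nmod N c q)%N -> ~~ ((nmod N c q)%:Z %| (total_tri N (Bf c) (cf c) q).2)%Z]) ->
  exists P C, forall X, exists t s h ans, [/\ exec P (init X) t s,
    (2 <= X)%N -> (t <= C * (X * trunc_log 2 X ^ 3))%N, (X < 2 ^ h)%N,
    out s = pairs ([seq pc <- tab | (pc.1 <= X)%N] ++ ans) &
    unzip1 ans = flatten [seq [seq nmod N c q | q <- rev (iota 0 (2 ^ h)) &
        prime (nmod N c q) && (p0 < nmod N c q <= X)%N] | c <- cl] /\
    forall p y, (p, y) \in ans -> exists c q, [/\ c \in cl, p = nmod N c q &
        residue_of (total_tri N (Bf c) (cf c) q) p y]].
Proof.
move=> eN hcl; have [C1 H1] := setup_runs; have [C2 H2] := table_runs tab.
have [P3 [C3 H3]] := classes_runs eN hcl.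
exists (Seq setup (Seq (table tab) P3)), (27 * (C1 + C2) + 81 * C3)%N => X.
have : runs (Seq setup (Seq (table tab) P3)) (init X)
  (C1 * (bits X).+1 ^ 3 + (C2 * (bits X).+1 ^ 3 + C3 * ((2 * X + 1) * (bits X).+1 ^ 3)))
  (fun s => exists h ans, [/\ (X < 2 ^ h)%N, out s = pairs ([seq pc <- tab | (pc.1 <= X)%N] ++ ans) &
    unzip1 ans = flatten [seq [seq nmod N c q | q <- rev (iota 0 (2 ^ h)) &
        prime (nmod N c q) && (p0 < nmod N c q <= X)%N] | c <- cl] /\
    forall p y, (p, y) \in ans -> exists c q, [/\ c \in cl, p = nmod N c q &
        residue_of (total_tri N (Bf c) (cf c) q) p y]]).
  apply: runs_seq (H1 X (init X) erefl) _ => s1 [o1 [h [r0 r1 r2 /andP[hX hX2] hb]]].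
  apply: runs_seq (H2 X s1 r0) _ => s2 [x2 o2].
  have := H3 h X s2 hX; rewrite !x2 // => /(_ r0 r1 r2) h3.
  apply: runs_weaken h3 _ _.
    by rewrite leq_mul2l; apply/orP; right; rewrite leq_mul // leq_exp2r.
  move=> s3 [ans [o3 u3 a3]]; exists h, ans; split=> //.
  by rewrite o3 o2 o1 /= /pairs map_cat flatten_cat.
case=> t [s [ex tT [h [ans [hX ho hans]]]]]; exists t, s, h, ans; split=> // X2.
apply: leq_trans tT _; set l := trunc_log 2 X.
have l1 : (0 < l)%N by rewrite /l trunc_log_gt0.
(* For X >= 2 one has bits X + 1 = l + 2 <= 3 l, whence 27 = 3^3; the number of leaves contributes 2
   X + 1 <= 3 X, whence 81. *)
have b3 : ((bits X).+1 ^ 3 <= 27 * l ^ 3)%N.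
  rewrite -[27%N]/(3 ^ 3)%N -expnMn leq_exp2r //; rewrite /bits -/l; lia.
have B : (27 * l ^ 3 <= 27 * (X * l ^ 3))%N by rewrite leq_mul2l leq_pmull ?orbT //; lia.
have e1 : (C1 * (bits X).+1 ^ 3 <= C1 * (27 * (X * l ^ 3)))%N by rewrite leq_mul2l (leq_trans b3 B) orbT.
have e2 : (C2 * (bits X).+1 ^ 3 <= C2 * (27 * (X * l ^ 3)))%N by rewrite leq_mul2l (leq_trans b3 B) orbT.
have e3 : (C3 * ((2 * X + 1) * (bits X).+1 ^ 3) <= C3 * (81 * (X * l ^ 3)))%N.
  rewrite leq_mul2l; apply/orP; right; apply: (@leq_trans (3 * X * (27 * l ^ 3))).
    by apply: leq_mul b3; lia.
  by rewrite mulnACA.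
apply: leq_trans (leq_add e1 (leq_add e2 e3)) _.
by apply: eq_leq; ring.
Qed.

(** * Reduction of Z_p modulo p *)

Section Residue.
Context (p : nat) (hp : prime p).
Local Notation Zp := (padic_int hp).
Implicit Types x y : Zp.

Definition phi (x : Zp) : 'F_p := (x 1%N)%:R.

Lemma res1E x : (x 1%N < p)%N.
Proof. by rewrite -(res_mod x 1) expn1 ltn_pmod // prime_gt0. Qed.

Lemma natr_Fp0 n : (n%:R == 0 :> 'F_p) = (p %| n)%N.
Proof. by rewrite -(dvdn_pcharf (pchar_Fp hp)). Qed.

Lemma natr_Fp_mod n : (n %% p)%N%:R = n%:R :> 'F_p.
Proof. by rewrite Fp_nat_mod. Qed.

Fact phi_nmod : nmod_morphism phi.
Proof.
split=> [|x y]; first by rewrite /phi res0.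
by rewrite /phi -natrD -(natr_Fp_mod (x 1%N + y 1%N)) /= expn1.
Qed.
HB.instance Definition _ := GRing.isNmodMorphism.Build Zp 'F_p phi phi_nmod.

Fact phi_monoid : monoid_morphism phi.
Proof.
split=> [|x y]; first by rewrite /phi /= expn1 natr_Fp_mod.
by rewrite /phi -natrM -(natr_Fp_mod (x 1%N * y 1%N)) /= expn1.
Qed.
HB.instance Definition _ := GRing.isMonoidMorphism.Build Zp 'F_p phi phi_monoid.

Lemma padic_natE k : padic_nat hp k = k%:R.
Proof.
elim: k => [|k IH]; first exact/esym/padicP.
rewrite -addn1 natrD -IH; apply: padicP => n /=.
by rewrite modnDm.
Qed.

Lemma res_natr k n : (k%:R : Zp) n = (k %% p ^ n)%N.
Proof. by rewrite -padic_natE. Qed.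

Lemma phi_coprime x n : phi x != 0 -> coprime (x n) (p ^ n).
Proof.
case: n => [|n] hx; first by rewrite expn0 coprimen1.
rewrite coprime_sym coprimeXl // prime_coprime //; move: hx; rewrite natr_Fp0.
by apply: contra => hd; rewrite -(resD x 1 n) expn1 add1n /dvdn modn_mod.
Qed.

(** By Euler's theorem a power of the n-th residue inverts it modulo p^n. These powers are
    compatible because inverses modulo p^n are unique. *)
Lemma phi_unit x : phi x != 0 -> x \is a GRing.unit.
Proof.
move=> hx; pose f n := (x n ^ (totient (p ^ n)).-1)%N.
have fx n : (f n * x n = 1 %[mod p ^ n])%N.
  rewrite /f mulnC -expnS prednK; first exact/Euler_exp_totient/phi_coprime.
  by rewrite totient_gt0 expn_gt0 prime_gt0.
have comp n : (f n.+1 = f n %[mod p ^ n])%N.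
  have e : (f n.+1 * x n = 1 %[mod p ^ n])%N.
    rewrite -(resS x n) modnMmr -(modn_dvdm _ (dvdn_exp2l p (leqnSn n))) fx.
    by rewrite modn_dvdm // dvdn_exp2l.
  have e2 : (f n.+1 * x n * f n = f n %[mod p ^ n])%N by rewrite -modnMml e modnMml mul1n.
  have e3 : (f n.+1 * (f n * x n) = f n.+1 %[mod p ^ n])%N by rewrite -modnMmr fx modnMmr muln1.
  by rewrite -e3 -e2 -mulnA (mulnC (x n)).
apply/asboolP; exists (mk_padic hp comp); apply: padicP => n.
by rewrite resM -[1]/(1%:R) res_natr /= modnMml fx.
Qed.

Lemma phi_inv x : phi x != 0 -> phi x^-1 = (phi x)^-1.
Proof. by move=> /phi_unit ux; rewrite rmorphV. Qed.

(** All residues from index 1 on are divisible by p; the quotient takes its n-th residue from index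
    n + 1 of x. *)
Lemma phi0_dvd x : phi x = 0 -> exists u, x = p%:R * u.
Proof.
move=> /eqP; rewrite natr_Fp0 => /dvdn_leq; have := res1E x.
case: (posnP (x 1%N)) => [x0 _ _|x1 lt /(_ isT)]; last by rewrite leqNgt lt.
have dv n : (p %| x n.+1)%N.
  by have := resD x 1 n; rewrite add1n x0 expn1 => /eqP.
have comp n : (x n.+2 %/ p = x n.+1 %/ p %[mod p ^ n])%N.
  have e := resS x n.+1.
  have -> : x n.+1 = ((x n.+2 %/ p %% p ^ n) * p)%N.
    by rewrite muln_modl divnK ?dv // -expnSr e.
  by rewrite mulnK ?prime_gt0 // modn_mod.
exists (mk_padic hp comp); apply: padicP => n; rewrite resM res_natr /= modnMm.
by rewrite mulnC divnK ?dv // resS.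
Qed.

End Residue.

(** * Morita's gamma function modulo p *)

Section MoritaGamma.
Context (p : nat) (hp : prime p) (op : odd p).
Local Notation Zp := (padic_int hp).
Implicit Types x y : Zp.

Definition cong k x y : Prop := exists u, x - y = p%:R ^+ k * u.

Lemma cong_refl k x : cong k x x.
Proof. by exists 0; rewrite subrr mulr0. Qed.

Lemma cong_trans k y x z : cong k x y -> cong k y z -> cong k x z.
Proof. by move=> [u hu] [v hv]; exists (u + v); rewrite -(subrKA y) hu hv mulrDr. Qed.

Lemma congM k x y x' y' : cong k x y -> cong k x' y' -> cong k (x * x') (y * y').
Proof.
move=> [u hu] [v hv]; exists (x * v + u * y').
have -> : x * x' - y * y' = x * (x' - y') + (x - y) * y' by ring.
by rewrite hu hv; ring.
Qed.

Lemma congX k x y n : cong k x y -> cong k (x ^+ n) (y ^+ n).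
Proof.
by move=> h; elim: n => [|n IH]; [exact: cong_refl | rewrite !exprS; exact: congM].
Qed.

Lemma cong_weaken j k x y : (j <= k)%N -> cong k x y -> cong j x y.
Proof.
move=> jk [u hu]; exists (p%:R ^+ (k - j) * u).
by rewrite mulrA -exprD subnKC.
Qed.

Lemma cong_res k x y : cong k x y -> x k = y k.
Proof.
move=> [u hu]; have -> : x = y + p%:R ^+ k * u by rewrite -hu addrC subrK.
change ((y k + (p%:R ^+ k * u)%R k) %% p ^ k = y k)%N.
rewrite resM -natrX res_natr modnn mul0n mod0n addn0; exact: res_mod.
Qed.

Lemma cong1_phi x y : cong 1 x y -> phi x = phi y.
Proof. by move=> /cong_res e; rewrite /phi e. Qed.

(** In y^p - 1 = (y - 1) (1 + y + ... + y^(p-1)) the second factor is a sum of p terms congruent to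
    1, so each p-th power gains a factor p. *)
Lemma cong_pexp x j : phi x = 1 -> cong j.+1 (x ^+ (p ^ j)) 1.
Proof.
move=> hx; elim: j => [|j [u hu]].
  have [|u hu] := @phi0_dvd _ hp (x - 1); first by rewrite rmorphB rmorph1 /= hx subrr.
  by exists u; rewrite expn0 !expr1.
set y := x ^+ (p ^ j) in hu; rewrite expnSr exprM -/y.
have hy : phi y = 1 by rewrite /y rmorphXn /= hx expr1n.
have [|v hv] := @phi0_dvd _ hp (\sum_(i < p) y ^+ i).
  rewrite rmorph_sum /= (eq_bigr (fun=> 1)) => [|i _]; last by rewrite rmorphXn /= hy expr1n.
  by rewrite sumr_const card_ord; apply/eqP; rewrite (natr_Fp0 hp).
by exists (u * v); rewrite subrX1 hu hv (exprSr _ j.+1); ring.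
Qed.

Definition unit_part (i : nat) : Zp := if coprime i p then i%:R else 1.

Fixpoint gseq (n : nat) : Zp := if n is m.+1 then - (unit_part m * gseq m) else 1.

Lemma gseqS n : gseq n.+1 = - (unit_part n * gseq n).
Proof. by []. Qed.

Lemma gseqE n : gseq n.+1 = (-1) ^+ n.+1 * \prod_(1 <= i < n.+1 | coprime i p) i%:R.
Proof.
elim: n => [|n IH].
  rewrite /= big_geq // mulr1 expr1 mulr1 /unit_part /coprime gcd0n.
  by rewrite gtn_eqF // prime_gt1.
rewrite [LHS](gseqS n.+1) IH [in RHS]big_mkcond big_nat_recr //=.
rewrite -big_mkcond /= (exprS _ n.+1) /unit_part; case: ifP => _; ring.
Qed.

Lemma unit_part_cong k i : (0 < k)%N -> cong k (unit_part (i + p ^ k)) (unit_part i).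
Proof.
move=> k0; rewrite /unit_part.
have -> : coprime (i + p ^ k) p = coprime i p.
  by rewrite /coprime gcdnC -(prednK k0) expnSr addnC gcdnMDl gcdnC.
case: ifP => _; last exact: cong_refl.
by exists 1; rewrite natrD addrC addKr natrX mulr1.
Qed.

Lemma congN k x y : cong k x y -> cong k (- x) (- y).
Proof. by move=> h; rewrite -(mulN1r x) -(mulN1r y); apply: congM h; apply: cong_refl. Qed.

Lemma gseq_block k n : (0 < k)%N -> cong k (gseq (n + p ^ k)) (gseq n * gseq (p ^ k)).
Proof.
move=> k0; elim: n => [|n IH]; first by rewrite mul1r; exact: cong_refl.
rewrite addSn /= mulNr -mulrA; apply: congN.
by apply: congM IH; apply: unit_part_cong.
Qed.

Lemma gseq_blocks k n t : (0 < k)%N -> cong k (gseq (n + t * p ^ k)) (gseq n * gseq (p ^ k) ^+ t).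
Proof.
move=> k0; elim: t => [|t IH]; first by rewrite addn0 mulr1; exact: cong_refl.
rewrite mulSn addnCA addnC exprSr mulrA; apply: cong_trans (gseq_block _ k0) _.
by apply: congM IH (cong_refl _ _).
Qed.

Lemma phi_gseq_p : phi (gseq p) = 1.
Proof.
have p0 := prime_gt0 hp.
have e n : (0 < n)%N -> gseq n = (-1) ^+ n * \prod_(1 <= i < n | coprime i p) i%:R.
  by case: n => // n _; exact: gseqE.
rewrite e //.
rewrite rmorphM rmorphXn rmorphN rmorph1 /= -signr_odd op expr1 big_nat_cond.
rewrite (eq_bigl (fun i => (1 <= i < p)%N && true)) => [|i]; last first.
  case h: (1 <= i < p)%N => //=; rewrite coprime_sym prime_coprime //.
  by apply/negP => /dvdn_leq; case/andP: h => h1 h2 /(_ h1); rewrite leqNgt h2.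
rewrite -big_nat_cond -natr_prod rmorph_nat.
have -> : (\prod_(1 <= i < p) i = (p.-1)`!)%N by rewrite fact_prod prednK.
have := Wilson (prime_gt1 hp); rewrite hp => /esym.
rewrite -(natr_Fp0 hp) -natr1 addr_eq0 => /eqP ->.
by rewrite mulN1r opprK.
Qed.

Lemma phi_gseq_mod n : phi (gseq n) = phi (gseq (n %% p)).
Proof.
rewrite {1}(divn_eq n p) addnC -[X in (_ * X)%N]expn1.
rewrite (cong1_phi (@gseq_blocks 1 _ _ isT)) rmorphM rmorphXn /= expn1 phi_gseq_p.
by rewrite expr1n mulr1.
Qed.

(** A shift by p^k multiplies [gseq] by the constant [gseq (p ^ k)] modulo p^k. Wilson's theorem
    shows this constant to be 1 modulo p, hence its p^k-th power is 1 modulo p^k, and p^k shifts by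
    p^k return to the start. For this reason [gmor] reads component 2 k of its argument to define
    component k of its value. *)
Lemma gseq_period k n m : cong k (gseq (n + m * p ^ (2 * k))) (gseq n).
Proof.
case: k => [|k]; first by eexists; rewrite expr0 mul1r.
rewrite mul2n -addnn expnD mulnA; apply: cong_trans (@gseq_blocks k.+1 _ _ isT) _.
have h1 : phi (gseq (p ^ k.+1)) = 1.
  by rewrite phi_gseq_mod expnS modnMr /= rmorph1.
have := cong_pexp k.+1 h1; rewrite mulnC exprM => h2.
have h3 := congX m (cong_weaken (leqnSn _) h2); rewrite expr1n in h3.
have := congM (cong_refl k.+1 (gseq n)) h3; rewrite mulr1; exact.
Qed.

Lemma phi_gseq_neq0 n : phi (gseq n) != 0.
Proof.
elim: n => [|n IH] /=; first by rewrite rmorph1 oner_neq0.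
rewrite rmorphN rmorphM oppr_eq0 mulf_neq0 //= /unit_part.
case: ifP => h; last by rewrite rmorph1 oner_neq0.
by rewrite rmorph_nat (natr_Fp0 hp) -prime_coprime // coprime_sym.
Qed.

Lemma gmor_comp x k :
  (gseq (x (2 * k.+1)%N) k.+1 = gseq (x (2 * k)%N) k %[mod p ^ k])%N.
Proof.
rewrite res_mod resS; have e := resD x (2 * k) 2.
rewrite mulnSr {1}(divn_eq (x (2 * k + 2)%N) (p ^ (2 * k))) e addnC.
exact: cong_res (gseq_period _ _ _).
Qed.

Definition gmor x : Zp := mk_padic hp (gmor_comp x).

Lemma gmor_res x k : gmor x k = gseq (x (2 * k)%N) k.
Proof. exact: res_mod. Qed.

Lemma gmor_morita : is_morita_gamma gmor.
Proof.
split.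
- by move=> x k; exists (2 * k)%N => y e; rewrite !gmor_res e.
- move=> x; apply: phi_unit; rewrite /phi gmor_res; exact: phi_gseq_neq0.
move=> n; rewrite -gseqE; apply: padicP => k; rewrite gmor_res res_natr.
rewrite [in RHS](divn_eq n.+1 (p ^ (2 * k))) addnC; apply/esym/cong_res.
exact: gseq_period.
Qed.

Lemma morita_gammaP : is_morita_gamma (morita_gamma hp).
Proof. exact: (@xgetI _ (fun=> 1) [set f | is_morita_gamma f] gmor gmor_morita). Qed.

Lemma phi_morita x : phi (morita_gamma hp x) = phi (gseq (x 1%N)).
Proof.
have [cont _ val] := morita_gammaP; have [n hn] := cont x 1%N.
(* A positive integer, as the values of Gamma_p are prescribed there, close enough to x for
   continuity; index n + 1 instead of n makes it congruent to x modulo p also when n = 0. *)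
pose m := (x n.+1 + p ^ n.+1)%N.
have m0 : (0 < m)%N by rewrite addn_gt0 expn_gt0 (prime_gt0 hp) orbT.
have hm : (m%:R : Zp) n = x n.
  by rewrite res_natr -(resS x n) /m expnS addnC modnMDl.
have val' n' : (0 < n')%N -> morita_gamma hp n'%:R = gseq n'.
  by case: n' => // n' _; rewrite val -gseqE.
rewrite /phi -(hn _ hm) val' // -/(phi _) phi_gseq_mod.
congr (phi (gseq _)).
rewrite /m expnSr addnC modnMDl.
by have := resD x 1 n; rewrite add1n expn1.
Qed.

Definition gam (a : 'F_p) : 'F_p := phi (gseq a).

(** The factor in the functional equation Gamma_p(x + 1) = - x Gamma_p(x), where x is to be replaced
    by 1 if p divides it. *)
Definition pz (R : comNzRingType) (y : R) : R := if y == 0 then 1 else y.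

Lemma gamE x : phi (morita_gamma hp x) = gam (phi x).
Proof.
rewrite phi_morita /gam /phi; congr ((gseq _ 1%N)%:R).
by rewrite val_Fp_nat // modn_small // res1E.
Qed.

Lemma gamS (a : 'F_p) : gam (a + 1) = - (pz a * gam a).
Proof.
have e n : gam n%:R = phi (gseq n).
  by rewrite /gam val_Fp_nat // -phi_gseq_mod.
have [n ->] : exists n, a = n%:R by exists (a : nat); rewrite natr_Zp.
rewrite natr1 !e /= rmorphN rmorphM; congr (- (_ * _)).
rewrite /unit_part /pz (natr_Fp0 hp) coprime_sym prime_coprime //.
by case: (p %| n)%N; rewrite /= ?rmorph1 ?rmorph_nat.
Qed.

Lemma gam_neq0 a : gam a != 0.
Proof. exact: phi_gseq_neq0. Qed.

End MoritaGamma.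

(** * Rational numbers and Teichmueller representatives modulo p *)

Section Rationals.
Context (p : nat) (hp : prime p).
Local Notation Zp := (padic_int hp).

Lemma intr_Fp0 (n : int) : (n%:~R == 0 :> 'F_p) = (p%:Z %| n)%Z.
Proof. by rewrite -(dvdz_pcharf (pchar_Fp hp)). Qed.

Lemma phi_intr (n : int) : phi (n%:~R : Zp) = n%:~R.
Proof. by rewrite rmorph_int. Qed.

(** Allows any denominator prime to p: the reduced one divides it. *)
Lemma phi_ratr (x : rat) (d n : int) : x * d%:~R = n%:~R -> ~~ (p%:Z %| d)%Z ->
  phi (ratr x : Zp) * d%:~R = n%:~R.
Proof.
move=> e pd.
have num : numq x * d = n * denq x.
  apply/(@intr_inj rat); rewrite !rmorphM /= -e mulrAC; congr (_ * _).
  by rewrite -{2}(divq_num_den x) divfK // intr_eq0 denq_neq0.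
have dd : (denq x %| d)%Z.
  rewrite -(Gauss_dvdzr _ (_ : coprimez (denq x) (numq x))).
    by rewrite num dvdz_mull.
  by rewrite coprimez_sym coprimezE coprime_num_den.
have d0 : phi ((denq x)%:~R : Zp) != 0.
  rewrite phi_intr intr_Fp0; apply: contra pd => pd; exact: dvdz_trans pd dd.
have d0' := d0; rewrite phi_intr in d0'.
rewrite /ratr rmorphM /= (phi_inv d0) !phi_intr -[RHS](mulfK d0') -mulrA.
rewrite -!(rmorphM intr) /= [_^-1 * _]mulrC mulrA -!(rmorphM intr) /=; by rewrite num.
Qed.

Lemma resX (x : Zp) n k : (x ^+ n) k = (x k ^ n %% p ^ k)%N.
Proof.
elim: n => [|n IH]; first by rewrite expr0 expn0 -[1]/(1%:R) res_natr.
by rewrite exprS resM IH modnMmr expnS.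
Qed.

(** The limit of the powers a^(p^k), where a is the residue of z modulo p. Euler's theorem modulo
    p^(k+1) yields both the compatibility of these powers and the root of unity. *)
Lemma teich_exists z : phi (ratr z : Zp) != 0 -> exists t : Zp, is_teichmuller z t.
Proof.
set a := (ratr z : Zp) 1%N => hz.
have ca : coprime a p by have := phi_coprime 1 hz; rewrite expn1.
have fl k : (a ^ (p ^ k * p.-1) = 1 %[mod p ^ k.+1])%N.
  by rewrite mulnC -(totient_pfactor hp (isT : (0 < k.+1)%N)) Euler_exp_totient ?coprimeXr.
have st k : (a ^ (p ^ k.+1) = a ^ (p ^ k) %[mod p ^ k.+1])%N.
  have {1}-> : (p ^ k.+1 = p ^ k * p.-1 + p ^ k)%N.
    by rewrite expnSr -{2}(prednK (prime_gt0 hp)) mulnS addnC.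
  by rewrite expnD -(modnMml (a ^ (p ^ k * p.-1))) fl modnMml mul1n.
have comp k : (a ^ (p ^ k.+1) = a ^ (p ^ k) %[mod p ^ k])%N.
  by rewrite -(modn_dvdm _ (dvdn_exp2l p (leqnSn k))) st modn_dvdm // dvdn_exp2l.
exists (mk_padic hp comp); split.
  apply: padicP => k; rewrite resX -[1]/(1%:R) res_natr /= modnXm -expnM.
  by rewrite -(modn_dvdm _ (dvdn_exp2l p (leqnSn k))) fl modn_dvdm // dvdn_exp2l.
rewrite /= (st 0%N) expn0 expn1 -/a modn_small // expn1; exact: res1E.
Qed.

Lemma phi_teich z : phi (ratr z : Zp) != 0 -> phi (teichmuller hp z) = phi (ratr z : Zp).
Proof.
move=> /teich_exists[t ht]; rewrite /phi; congr (_%:R).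
have [_ //] : is_teichmuller z (teichmuller hp z).
exact: (@xgetI _ 0 [set t | is_teichmuller z t] t ht).
Qed.

Lemma residue_phi (H : padic hp) (h : Zp) (c : nat) : H = h%:Qp -> (c < p)%N ->
  phi h = c%:R -> is_residue H c.
Proof.
move=> -> cp hc; split=> //; have [|u hu] := @phi0_dvd _ hp (h - c%:R).
  by rewrite rmorphB /= hc rmorph_nat subrr.
by exists u; rewrite -!(rmorph_nat (@FracField.tofrac _)) -rmorphB -rmorphM hu.
Qed.

Lemma natr_padic_neq0 : (p%:R : Zp) != 0.
Proof.
apply/eqP => /(congr1 (fun x : Zp => x 2%N)); rewrite res0 res_natr modn_small.
  by move=> e; have := prime_gt0 hp; rewrite e.
by rewrite -{1}(expn1 p) ltn_exp2l // prime_gt1.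
Qed.

Lemma unit_1Bp : phi (1 - p%:R : Zp) = 1.
Proof.
rewrite rmorphB rmorph1 rmorph_nat; apply/eqP; rewrite subr_eq addrC -subr_eq subrr.
by rewrite eq_sym natr_Fp0.
Qed.

End Rationals.

(** The entries of the datum are written [a / N] with [a] in [as_] or [bs]
    and a common denominator [N]. *)
Definition below (N P m a : nat) : bool := (a * P < N * m)%N.
Definition hits (N P m a : nat) : bool := (a * P == N * m)%N.

Definition rats (N : nat) (l : seq nat) : seq rat := [seq a%:R / N%:R | a <- l].

(** The difference eta_m(alpha) - eta_m(beta): each fractional part changes by - m / P, plus 1 if a
    / N < m / P makes it wrap, and the terms m / P cancel because both tuples have r entries. Adding
    D and xi_m yields [p_exp], the full exponent of p. *)
Definition sgn_exp N P (as_ bs : seq nat) (m : nat) : int :=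
  (count (below N P m) as_)%:Z - (count (below N P m) bs)%:Z.

Definition p_exp N P (as_ bs : seq nat) (D : int) (m : nat) : int :=
  sgn_exp N P as_ bs m + D + (count_mem 0%N bs)%:Z - (count (hits N P m) bs)%:Z.

Lemma frac_val (x y : rat) (k : int) : x = y + k%:~R -> 0 <= y < 1 -> Defs.frac x = y.
Proof.
move=> -> /andP[y0 y1]; rewrite /Defs.frac (Num.Theory.floor_def (m := k)) ?addrK //.
by rewrite lerDr y0 /= rmorphD rmorph1 [X in _ < X]addrC ltrD2r.
Qed.

Lemma frac_id (x : rat) : 0 <= x < 1 -> Defs.frac x = x.
Proof. by move=> h; apply: (frac_val (k := 0)) => //; rewrite addr0. Qed.

Lemma rat01 (N a : nat) : (a < N)%N -> 0 <= (a%:R / N%:R : rat) < 1.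
Proof.
move=> aN; have N0 : 0 < (N%:R : rat) by rewrite ltr0n; apply: leq_ltn_trans aN.
by rewrite divr_ge0 ?ler0n //= ltr_pdivrMr // mul1r ltr_nat.
Qed.

Section Frac.
Context (p N : nat) (p1 : (1 < p)%N) (N0 : (0 < N)%N).
Local Notation P := p.-1.

Let P0 : (0 < P)%N. Proof. by rewrite -ltnS prednK // ltnW. Qed.
Let PR : (P%:R : rat) != 0. Proof. by rewrite pnatr_eq0 -lt0n. Qed.
Let NR : (N%:R : rat) != 0. Proof. by rewrite pnatr_eq0 -lt0n. Qed.

Lemma mshiftE (m : nat) : mshift p m = - (m%:R / P%:R).
Proof.
have e : (p%:R : rat) = P%:R + 1 by rewrite natr1 prednK // ltnW.
by rewrite /mshift e opprD addrCA subrr addr0 invrN mulrN pmulrn.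
Qed.

Lemma frac_shift (a m : nat) : (a < N)%N -> (m < P)%N ->
  Defs.frac (a%:R / N%:R + mshift p m) = a%:R / N%:R - m%:R / P%:R + (below N P m a)%:R.
Proof.
move=> aN mP; rewrite mshiftE.
have /andP[a0 a1] := rat01 aN; have /andP[m0 m1] := rat01 mP.
have cmp : ((a%:R / N%:R : rat) < m%:R / P%:R) = below N P m a.
  rewrite /below ltr_pdivrMr ?ltr0n // mulrAC ltr_pdivlMr ?ltr0n //.
  by rewrite -!natrM ltr_nat mulnC (mulnC m) mulnC.
case: (below N P m a) cmp => cmp.
  apply: (frac_val (k := -1)); first by rewrite addrK.
  by rewrite (_ : true%:R = 1) //; lra.
apply: (frac_val (k := 0)); first by rewrite !addr0.
by rewrite addr0; move: cmp => /negbT; rewrite -leNgt; lra.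
Qed.

Lemma etaE r (x : r.-tuple rat) l (m : nat) : tval x = rats N l -> all (fun a => a < N)%N l -> (m < P)%N ->
  Defs.eta p m x = (count (below N P m) l)%:R - (size l)%:R * (m%:R / P%:R).
Proof.
move=> ex /allP hl mP.
rewrite /Defs.eta -(big_tuple _ _ x predT (fun y => Defs.frac (y + mshift p m) - Defs.frac y)) ex big_map.
rewrite big_seq (eq_bigr (fun a => (below N P m a)%:R - m%:R / P%:R)); last first.
  move=> a /hl aN; rewrite frac_shift // frac_id ?rat01 //; ring.
rewrite -big_seq sumrB; congr (_ - _).
  by rewrite -sum1_count natr_sum [RHS]big_mkcond; apply: eq_bigr => a _; case: ifP.
rewrite (mulr_natl _ (size l)); elim: (l) => [|a l' IH]; first by rewrite big_nil /= mulr0n.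
by rewrite big_cons IH -mulrS.
Qed.

Lemma xiE r (x : r.-tuple rat) l (m : nat) : tval x = rats N l ->
  Defs.xi x p m = (count_mem 0%N l)%:Z - (count (hits N P m) l)%:Z.
Proof.
move=> ex; rewrite /Defs.xi ex !count_map; congr (_%:Z - _%:Z); apply: eq_count => a /=.
  by rewrite mulf_eq0 invr_eq0 (negPf NR) orbF pnatr_eq0.
rewrite mshiftE subr_eq0 /hits -(inj_eq (mulIf NR)) divfK // mulrAC.
by rewrite -(inj_eq (mulIf PR)) divfK // -!natrM eqr_nat (mulnC m).
Qed.

Lemma etaB r (alpha beta : r.-tuple rat) as_ bs (m : nat) : tval alpha = rats N as_ -> tval beta = rats N bs ->
  all (fun a => a < N)%N as_ -> all (fun a => a < N)%N bs -> (m < P)%N ->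
  Defs.eta p m alpha - Defs.eta p m beta = (sgn_exp N P as_ bs m)%:~R.
Proof.
move=> ea eb ha hb mP; rewrite (etaE ea) // (etaE eb) //.
have -> : size as_ = size bs.
  have := size_tuple alpha; have := size_tuple beta; rewrite ea eb !size_map => -> //.
rewrite /sgn_exp rmorphB /=; rewrite !pmulrn; ring.
Qed.

End Frac.

(** * The exponents of p are nonnegative *)

Lemma denq_1B (x : rat) : denq (1 - x) = denq x.
Proof.
have -> : 1 - x = (denq x - numq x)%:~R / (denq x)%:~R.
  by rewrite rmorphB /= mulrBl divff ?intr_eq0 ?denq_neq0 // divq_num_den.
rewrite coprimeq_den ?(negPf (denq_neq0 x)) ?gtr0_norm ?denq_gt0 //.
rewrite -coprimezE coprimez_sym /coprimez gcdzDl gcdzN -/(coprimez _ _) coprimez_sym.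
by rewrite coprimezE coprime_num_den.
Qed.

Section Zigzag.
Context (r N : nat) (alpha beta : r.-tuple rat) (as_ bs : seq nat).
Hypothesis (N0 : (0 < N)%N).
Hypothesis (hab : hypergeometric_datum alpha beta) (a0 : 0 \notin alpha).
Hypothesis (ea : tval alpha = rats N as_) (eb : tval beta = rats N bs).
Hypothesis (ha : all (fun a => a < N)%N as_) (hb : all (fun b => b < N)%N bs).

Let NR : (N%:R : rat) != 0. Proof. by rewrite pnatr_eq0 -lt0n. Qed.
Let NR0 : (0 : rat) < N%:R. Proof. by rewrite ltr0n. Qed.
Lemma rats_inj : injective (fun a : nat => a%:R / N%:R : rat).
Proof.
move=> a b /(congr1 ( *%R^~ N%:R)) /=; rewrite !divfK // => /eqP.
by rewrite eqr_nat => /eqP.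
Qed.

Lemma count_rats l a : count_mem (a%:R / N%:R : rat) (rats N l) = count_mem a l.
Proof.
rewrite count_map; apply: eq_count => b /=.
by rewrite (inj_eq rats_inj).
Qed.

Definition zig (i : nat) : int :=
  (count (fun a => a <= i)%N as_)%:Z - (count (fun b => b <= i)%N bs)%:Z.

Lemma zigE i : zigzag alpha beta (i%:R / N%:R) = zig i.
Proof.
by rewrite /zigzag ea eb !count_map /zig; congr (_%:Z - _%:Z); apply: eq_count => a /=;
  rewrite ler_pM2r ?invr_gt0 // ler_nat.
Qed.

Definition refl (a : nat) : nat := if a == 0%N then 0%N else (N - a)%N.

(** Galois stability enters here: x and 1 - x have the same denominator. *)
Lemma refl_count (s : r.-tuple rat) l : tval s = rats N l -> all (fun a => a < N)%N l ->
  galois_stable s -> perm_eq [seq refl a | a <- l] l.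
Proof.
move=> es /allP hl gs; have reflK a : (a < N)%N -> refl (refl a) = a.
  rewrite /refl; case: (eqVneq a 0%N) => [->//|h]; case: (eqVneq (N - a)%N 0%N); lia.
have refllt a : (a < N)%N -> (refl a < N)%N.
  by rewrite /refl; case: (eqVneq a 0%N); lia.
apply/allP => a _; apply/eqP; have [aN|aN] := ltnP a N; last first.
  have nl l' : (forall x, x \in l' -> (x < N)%N) -> count_mem a l' = 0%N.
    move=> h; apply/count_memPn/negP => /h; lia.
  rewrite /= (nl l) => [|x hx]; last exact: (hl x hx).
  by apply: nl => x /mapP[y yl ->]; apply/refllt/(hl y yl).
rewrite /= count_map; transitivity (count_mem (refl a) l).
  apply: eq_in_count => b bl /=; have bN := hl b bl.
  by apply/eqP/eqP => [<-|->]; rewrite reflK.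
rewrite -!count_rats -es; apply: gs; rewrite ?rat01 ?refllt //.
rewrite /refl; case: eqP => [->//|a0'].
by rewrite natrB ?(ltnW aN) // mulrBl divff // denq_1B.
Qed.

(** For a different from 0, exactly one of [refl a <= i] and a <= N - 1 - i holds; for a = 0 both
    do. *)
Lemma refl_sum l i : all (fun a => a < N)%N l -> perm_eq [seq refl a | a <- l] l -> (i < N)%N ->
  (count (fun a => a <= i)%N l + count (fun a => a <= N.-1 - i)%N l = size l + count_mem 0%N l)%N.
Proof.
move=> hl /permP/(_ (fun a => a <= i)%N) <- iN; rewrite count_map.
elim: l hl => //= a l IH /andP[aN /IH h].
have e : ((refl a <= i) + (a <= N.-1 - i) = 1 + (a == 0))%N.
  by rewrite /refl; case: (eqVneq a 0%N) => [->|]; lia.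
rewrite addnACA h e; lia.
Qed.

Lemma zig_refl i : (i < N)%N -> zig i + zig (N.-1 - i) = - (count_mem 0%N bs)%:Z.
Proof.
move=> iN; have [_ _ _ ga gb] := hab.
have sa := refl_sum ha (refl_count ea ha ga) iN.
have sb := refl_sum hb (refl_count eb hb gb) iN.
have ss : size as_ = size bs.
  have := size_tuple alpha; have := size_tuple beta; rewrite ea eb !size_map => -> //.
have c0 : count_mem 0%N as_ = 0%N.
  rewrite -count_rats mul0r -ea; apply/count_memPn; exact: a0.
rewrite /zig; move: sa sb; rewrite ss c0; lia.
Qed.

(** Let c0 be the number of zeros in beta, so 2 D = max - min - c0. The reflection gives zig j = -
    c0 - zig (N - 1 - j) >= - c0 - max, and also zig j >= min; adding the two yields zig j + D + c0
    >= 0. The exponent at m has this form with j the integer part of N m / P, except if m / P is an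
    entry of alpha. *)
Lemma p_exp_ge0 : exists2 D : int, Dshift alpha beta = D%:~R &
  forall P m, (0 < P)%N -> (m < P)%N -> 0 <= p_exp N P as_ bs D m.
Proof.
have [D eD] := intrP (Dshift_int hab a0); exists D => //.
have e2 : D * 2 = zigzag_max alpha beta - zigzag_min alpha beta - (count_mem 0%N bs)%:Z.
  apply/(@intr_inj rat); rewrite rmorphM /= -eD /Dshift divfK // /Defs.weight subrK.
  by rewrite eb -(count_rats bs 0) mul0r.
have main j : (j < N)%N -> 0 <= zig j + D + (count_mem 0%N bs)%:Z.
  move=> jN; have j'N : (N.-1 - j < N)%N by lia.
  have in01 k : (k < N)%N -> 0 <= (k%:R / N%:R : rat) <= 1.
    by move=> /rat01/andP[-> /ltW].
  have [_ /(_ _ (in01 _ j'N))] := zigzag_maxP hab.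
  have [_ /(_ _ (in01 _ jN))] := zigzag_minP hab.
  rewrite !zigE; have := zig_refl jN; lia.
move=> P m P0 mP; pose i := (N * m %/ P)%N.
have iN : (i < N)%N by rewrite ltn_divLR // ltn_mul2l N0.
have le_i a : (a <= i)%N = below N P m a || hits N P m a.
  by rewrite /below /hits leq_divRL // leq_eqVlt orbC.
have cU l : (count (fun a => a <= i)%N l = count (below N P m) l + count (hits N P m) l)%N.
  elim: l => //= a l ->; rewrite le_i addnACA; congr (_ + _)%N.
  by rewrite /below /hits; case: ltngtP.
rewrite /p_exp /sgn_exp; have zi := main i iN; rewrite /zig !cU in zi.
(* If m / P is an entry of alpha, it is not 0 and not in beta, and the exponent is the expression
   for j = i - 1 instead. *)
have [/hasP[a al am]|nm] := boolP (has (hits N P m) as_); last first.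
  have c0 : count (hits N P m) as_ = 0%N by apply/eqP; rewrite -leqn0 leqNgt -has_count.
  by move: zi; rewrite c0; lia.
have ai : i = a by rewrite /i -(eqP am) mulnK.
have an0 : (0 < a)%N.
  rewrite lt0n; apply: contra a0 => /eqP a00; change (0 \in tval alpha).
  by rewrite ea; apply/mapP; exists a; rewrite // a00 mul0r.
have mb : count (hits N P m) bs = 0%N.
  apply/eqP; rewrite -leqn0 leqNgt -has_count; apply/hasP => -[b bl bm].
  have eab : b = a by apply/eqP; rewrite -(eqn_pmul2r P0) (eqP am) (eqP bm).
  have [_ _ hd _ _] := hab; have /hd/negP : a%:R / N%:R \in alpha.
    by change (a%:R / N%:R \in tval alpha); rewrite ea; apply/mapP; exists a.
  by apply; change (a%:R / N%:R \in tval beta); rewrite eb; apply/mapP; exists b; rewrite // eab.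
have lt_i l : count (fun a => a <= i.-1)%N l = count (below N P m) l.
  apply: eq_count => b /=; rewrite /below -(eqP am) ai ltn_mul2r P0 /=; lia.
have := main i.-1 (leq_ltn_trans (leq_pred i) iN); rewrite /zig !lt_i mb; lia.
Qed.

End Zigzag.

(** * The trace modulo p *)

Section TraceResidue.
Context (r N : nat) (alpha beta : r.-tuple rat) (as_ bs : seq nat) (D : int) (z : rat).
Hypothesis (N0 : (0 < N)%N).
Hypothesis (ea : tval alpha = rats N as_) (eb : tval beta = rats N bs).
Hypothesis (ha : all (fun a => a < N)%N as_) (hb : all (fun b => b < N)%N bs).
Hypothesis (eD : Dshift alpha beta = D%:~R).
Hypothesis (he : forall P m, (0 < P)%N -> (m < P)%N -> 0 <= p_exp N P as_ bs D m).
Context (p : nat) (hp : prime p).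
Local Notation Zp := (padic_int hp).
Local Notation P := p.-1.

(** The trace as an element of Z_p. The absolute values are harmless: the exponent of p is
    nonnegative, and that of -1 matters only up to parity. *)
Definition trace_int : Zp :=
  (1 - p%:R)^-1 * \sum_(m < P) ((-1) ^+ `|sgn_exp N P as_ bs m| * p%:R ^+ `|p_exp N P as_ bs D m| *
    (\prod_(j < r) (pochhammer hp m (tnth alpha j) / pochhammer hp m (tnth beta j))) *
    teichmuller hp z ^+ m).

Lemma signz (F : fieldType) (E : int) : (-1) ^ E = (-1) ^+ `|E| :> F.
Proof.
case: E => [n|n] //; change (((-1) ^+ n.+1)^-1 = (-1) ^+ n.+1 :> F).
by rewrite -exprVn invrN1.
Qed.

Lemma trace_intE : hgm_trace alpha beta hp z = trace_int%:Qp.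
Proof.
have p1 := prime_gt1 hp; have P0 : (0 < P)%N by rewrite -ltnS prednK // ltnW.
have pF : (p%:R : padic hp) != 0.
  rewrite -(rmorph_nat (@FracField.tofrac (padic_int hp))) /=.
  by rewrite tofrac_eq0 natr_padic_neq0.
rewrite /hgm_trace /trace_int rmorphM rmorph_sum /=; congr (_ * _).
  have u : (1 - p%:R : Zp) \is a GRing.unit by apply: phi_unit; rewrite unit_1Bp oner_neq0.
  by rewrite rmorphV //= rmorphB rmorph1 rmorph_nat.
apply: eq_bigr => m _; have mP := ltn_ord m.
rewrite (etaB p1 N0 ea eb) // (xiE p1 N0 _ eb) eD -rmorphD /= !intrKfloor.
rewrite !rmorphM rmorph_prod !rmorphXn /= rmorphN rmorph1 rmorph_nat; congr (_ * _ * _).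
  have -> : - p%:R = -1 * p%:R :> padic hp by rewrite mulN1r.
  rewrite expfzMl signz -mulrA -expfzDr //; congr (_ * _).
  have := he P0 mP; rewrite /p_exp addrA addrA.
  by case: (_ - _) => // n _.
by rewrite rmorph_prod.
Qed.

Hypothesis (op : odd p) (pN : ~~ (p %| N)%N) (pz : phi (ratr z : Zp) != 0).

(** The fractional part of a / N + m / (1 - p) reduced modulo p, where 1 - p becomes 1. *)
Definition yval (m a : nat) : 'F_p := a%:R / N%:R + m%:R + (below N P m a)%:R.

Lemma NF : (N%:R : 'F_p) != 0. Proof. by rewrite natr_Fp0. Qed.

Lemma phi_frac (a m : nat) : (a < N)%N -> (m < P)%N ->
  phi (ratr (Defs.frac (a%:R / N%:R + mshift p m)) : Zp) = yval m a.
Proof.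
move=> aN mP; have p1 := prime_gt1 hp.
have P0 : (0 < P)%N by rewrite -ltnS prednK // ltnW.
rewrite frac_shift //; set eps := below _ _ _ _.
have PR : (P%:R : rat) != 0 by rewrite pnatr_eq0 -lt0n.
have NR : (N%:R : rat) != 0 by rewrite pnatr_eq0 -lt0n.
have PF : (P%:R : 'F_p) = -1.
  by apply/eqP; rewrite -subr_eq0 opprK natr1 prednK ?(ltnW p1) // natr_Fp0.
have e : (a%:R / N%:R - m%:R / P%:R + eps%:R) * ((N * P)%N%:Z)%:~R =
   ((a * P)%N%:Z - (m * N)%N%:Z + (eps * (N * P))%N%:Z)%:~R :> rat.
  rewrite !(rmorphD, rmorphN) /= -!pmulrn !natrM.
  by field; rewrite PR NR.
have nd : ~~ (p%:Z %| (N * P)%N%:Z)%Z.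
  rewrite -intr_Fp0 // -pmulrn natrM PF mulrN1 oppr_eq0; exact: NF.
have := phi_ratr hp e nd; rewrite !(rmorphD, rmorphN) /= -!pmulrn !natrM PF.
set X := phi _ => hX; apply: (mulIf NF); rewrite /yval !mulrDl divfK ?NF // -/eps.
apply: oppr_inj; rewrite -mulrN1 -mulrA hX; ring.
Qed.

Lemma phi_pochhammer (a m : nat) : (a < N)%N -> (m < P)%N ->
  phi (pochhammer hp m (a%:R / N%:R)) = gam hp (yval m a) / gam hp (yval 0 a).
Proof.
move=> aN mP; rewrite /pochhammer rmorphM /= (gamE op) phi_frac //; congr (_ * _).
rewrite phi_inv; last by rewrite (gamE op) gam_neq0.
rewrite (gamE op) -(phi_frac aN (leq_ltn_trans (leq0n m) mP)); congr ((gam hp (phi (ratr (Defs.frac _))))^-1).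
by rewrite /mshift mul0r addr0.
Qed.

Definition uval (zz : 'F_p) (m : nat) : 'F_p :=
  (-1) ^+ `|sgn_exp N P as_ bs m| *
  ((\prod_(a <- as_) (gam hp (yval m a) / gam hp (yval 0 a))) /
   (\prod_(b <- bs) (gam hp (yval m b) / gam hp (yval 0 b)))) * zz ^+ m.

Lemma phi_trace : phi trace_int = \sum_(m < P) (p_exp N P as_ bs D m == 0)%:R * uval (phi (ratr z : Zp)) m.
Proof.
have u1 : phi (1 - p%:R : Zp) != 0 by rewrite unit_1Bp oner_neq0.
rewrite -(phi_teich pz) /trace_int rmorphM /= phi_inv // unit_1Bp invr1 mul1r rmorph_sum /=.
apply: eq_bigr => m _; have mP := ltn_ord m.
rewrite !rmorphM !rmorphXn /= rmorphN rmorph1 rmorph_nat.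
have -> : (p%:R : 'F_p) = 0 by apply/eqP; rewrite natr_Fp0.
rewrite expr0n absz_eq0 /uval.
have -> : phi (\prod_(j < r) (pochhammer hp m (tnth alpha j) / pochhammer hp m (tnth beta j)) : Zp) =
  (\prod_(a <- as_) (gam hp (yval m a) / gam hp (yval 0 a))) /
   (\prod_(b <- bs) (gam hp (yval m b) / gam hp (yval 0 b))).
  have pu x : x \in tval beta -> phi (pochhammer hp m x) != 0.
    rewrite eb => /mapP[b /(allP hb) bN ->]; rewrite phi_pochhammer //.
    by rewrite mulf_neq0 ?invr_neq0 ?gam_neq0.
  rewrite rmorph_prod /= (eq_bigr (fun j : 'I_r => phi (pochhammer hp m (tnth alpha j)) *
      (phi (pochhammer hp m (tnth beta j)))^-1)) => [|j _]; last first.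
    by rewrite rmorphM /= phi_inv // pu // mem_tnth.
  rewrite big_split /= prodfV; congr (_ / _).
    rewrite -(big_tuple _ _ alpha predT (fun x => phi (pochhammer hp m x))) ea big_map.
    by rewrite big_seq [RHS]big_seq; apply: eq_bigr => a /(allP ha) aN; apply: phi_pochhammer.
  rewrite -(big_tuple _ _ beta predT (fun x => phi (pochhammer hp m x))) eb big_map.
  by rewrite big_seq [RHS]big_seq; apply: eq_bigr => a /(allP hb) aN; apply: phi_pochhammer.
by rewrite [X in X * _ * _]mulrC -!mulrA.
Qed.

End TraceResidue.

Section Recursion.
Context (N : nat) (as_ bs : seq nat) (p : nat) (hp : prime p) (op : odd p) (zz : 'F_p).
Hypothesis (ss : size as_ = size bs).
Local Notation P := p.-1.
Local Notation y := (yval N p).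

(** The sign [(-1) ^ eta] is spread over the gamma factors, so that each of
    them satisfies a two-term recursion. *)
Definition psi (m a : nat) : 'F_p := (-1) ^+ below N P m a * gam hp (y m a).

(** From m to m + 1 the argument of Gamma_p grows by 1, or by 2 when m / P passes a / N; in the
    latter case the functional equation is applied twice, hence the second factor. *)
Definition step_ratio (m a : nat) : 'F_p :=
  pz (y m a) * (if below N P m.+1 a && ~~ below N P m a then pz (y m a + 1) else 1).

Lemma psi_neq0 m a : psi m a != 0.
Proof. by rewrite mulf_neq0 ?signr_eq0 ?gam_neq0. Qed.

Lemma below0 a : below N P 0 a = false.
Proof. by rewrite /below muln0. Qed.

Lemma belowS m a : below N P m a -> below N P m.+1 a.
Proof. by rewrite /below => h; apply: leq_trans h _; rewrite leq_mul2l leqnSn orbT. Qed.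

Lemma psiS m a : psi m.+1 a = - step_ratio m a * psi m a.
Proof.
rewrite /psi /step_ratio; have := @belowS m a.
have yS : y m.+1 a = y m a + (below N P m.+1 a)%:R - (below N P m a)%:R + 1.
  by rewrite /yval -natr1; ring.
case: (below N P m a) yS => yS h.
  by rewrite h // in yS *; rewrite yS addrK (gamS hp op) /=; ring.
case: (below N P m.+1 a) yS => yS /=; rewrite yS subr0.
  by rewrite (gamS hp op) (gamS hp op) /=; ring.
by rewrite addr0 (gamS hp op) /=; ring.
Qed.

Lemma uvalE m : uval N as_ bs hp zz m = (\prod_(a <- as_) (psi m a / psi 0 a)) /
  (\prod_(b <- bs) (psi m b / psi 0 b)) * zz ^+ m.
Proof.
have e l : \prod_(a <- l) (psi m a / psi 0 a) =
    (-1) ^+ count (below N P m) l * \prod_(a <- l) (gam hp (y m a) / gam hp (y 0 a)).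
  elim: l => [|a l IH]; first by rewrite !big_nil mulr1.
  by rewrite !big_cons IH /= exprD /psi below0 expr0 mul1r; ring.
rewrite /uval !e; congr (_ * _); rewrite invfM !mulrA; congr (_ / _).
rewrite mulrAC; congr (_ * _).
have -> : ((-1) ^+ count (below N P m) bs)^-1 = (-1) ^+ count (below N P m) bs :> 'F_p.
  by rewrite -exprVn invrN1.
rewrite -exprD -signr_odd -[RHS]signr_odd; congr (_ ^+ nat_of_bool _).
rewrite /sgn_exp; lia.
Qed.

Lemma uval0 : uval N as_ bs hp zz 0 = 1.
Proof.
rewrite uvalE expr0 mulr1 (eq_bigr (fun=> 1)) => [|a _]; last by rewrite divff ?psi_neq0.
rewrite [X in _ / X](eq_bigr (fun=> 1)) => [|a _]; last by rewrite divff ?psi_neq0.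
by rewrite !big1_eq divr1.
Qed.

Lemma step_ratio_neq0 m a : step_ratio m a != 0.
Proof.
by rewrite /step_ratio /pz; rewrite mulf_neq0 //; do ?[case: ifP => [_|/negbT h]]; rewrite ?oner_neq0 ?h.
Qed.

Lemma uvalS m : uval N as_ bs hp zz m.+1 * \prod_(b <- bs) step_ratio m b =
  zz * \prod_(a <- as_) step_ratio m a * uval N as_ bs hp zz m.
Proof.
have e l : \prod_(a <- l) (psi m.+1 a / psi 0 a) =
    (-1) ^+ size l * \prod_(a <- l) step_ratio m a * \prod_(a <- l) (psi m a / psi 0 a).
  elim: l => [|a l IH]; first by rewrite !big_nil !mulr1.
  by rewrite !big_cons IH psiS /= exprS; ring.
rewrite !uvalE !e ss exprS.
have rn0 : \prod_(b <- bs) step_ratio m b != 0.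
  by rewrite prodf_seq_neq0; apply/allP => b _; rewrite step_ratio_neq0.
have s0 : (-1) ^+ size bs != 0 :> 'F_p by rewrite signr_eq0.
have b0 : \prod_(b <- bs) (psi m b / psi 0 b) != 0.
  by rewrite prodf_seq_neq0; apply/allP => b _; rewrite mulf_neq0 ?invr_neq0 ?psi_neq0.
by field; rewrite rn0 s0 b0.
Qed.

End Recursion.

(** The first entry telescopes by f_n u_n = g_n u_(n+1), and G u_n times w_n g_n is the new summand
    over the enlarged denominator. *)
Lemma tri_prod_field (F : fieldType) (f g w u : nat -> F) n :
  (forall m, g m != 0) -> u 0%N = 1 -> (forall m, u m.+1 * g m = f m * u m) ->
  let G := \prod_(0 <= m < n) g m in
  \big[@tmul F/tone F]_(0 <= m < n) (f m, w m * g m, g m) =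
    (G * u n, G * \sum_(m < n) w m * u m, G).
Proof.
move=> g0 u0 uS /=; elim: n => [|n IH]; first by rewrite !big_geq // big_ord0 u0 !mulr1 mulr0.
rewrite !big_nat_recr //= IH big_ord_recr /= /tmul /=; congr (_, _, _).
  by rewrite -!mulrA [g n * _]mulrC uS [u n * _]mulrC.
ring.
Qed.

(** * Steps that are uniform in the primes of a class *)

Section Steps.
Context (N c : nat) (as_ bs : seq nat) (D zn zd : int).

(* Position [m = i * q + t] of the sum for the prime [p = c + N * q]; [num]
   represents [N * y] modulo [p], where [y] is the argument of the gamma
   factor of [a / N]. *)
Definition num (i t a e : nat) : int := a%:Z + (N * (t + e))%N%:Z - (i * c)%N%:Z.

(** [N] times the factor [y] or, when [p] divides [y], times the factor 1:
    [y] is small enough to vanish modulo [p] only if [num] is 0. *)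
Definition fac (v : int) : int := if v == 0 then N%:Z else v.

(** With m = i q + t and P = N q + c - 1, the comparison of a P with N m reads a N q + a (c - 1)
    against i N q + N t. For q large compared with c and t, a and i decide, and a tie is broken by
    the bounded terms; [hit] arises in the same way. *)
Definition bel (i t a : nat) : bool := (a < i)%N || (a == i) && (a * c.-1 < N * t)%N.

Definition hit (i t b : nat) : bool := (b == i) && (b * c.-1 == N * t)%N.

(** An integer version of N^2 times [step_ratio]. The powers of N clear denominators and cancel
    between f and g, as alpha and beta have equally many entries. *)
Definition rfac (i t a : nat) : int :=
  fac (num i t a (bel i t a)) *
  (if bel i t.+1 a && ~~ bel i t a then fac (num i t a (bel i t a) + N%:Z) else N%:Z).

Definition pex (i t : nat) : int :=
  (count (bel i t) as_)%:Z - (count (bel i t) bs)%:Z + D + (count_mem 0%N bs)%:Z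
  - (count (hit i t) bs)%:Z.

Definition step_tri (i t : nat) : tri int :=
  let g := zd * \prod_(b <- bs) rfac i t b in
  (zn * \prod_(a <- as_) rfac i t a, (pex i t == 0)%:R * g, g).

(** The first t for which m = i q + t exceeds i P / N, so that the q indices from there on lie
    strictly between i P / N and (i + 1) P / N. The value at i = N is chosen so that N q + offset N
    = P, the end of the sum. *)
Definition offset (i : nat) : nat := if (i < N)%N then (i * c.-1 %/ N).+1 else c.-1.

Definition bulk_nums (i : nat) (l : seq nat) : seq int :=
  [seq num i (offset i) a (a <= i)%N | a <- l].

Definition bulk_wt (i : nat) : int :=
  ((count (fun a => a <= i)%N as_)%:Z - (count (fun b => b <= i)%N bs)%:Z + D
    + (count_mem 0%N bs)%:Z == 0)%:R.

(** Inside an interval each entry contributes N y only, so the constants N^r supply the second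
    factor N of [rfac]. The interval ends at (i + 1) q + offset i, and the boundary triple covers
    the indices from there to the start of the next one. *)
Definition bulk (i : nat) : component :=
  Component (zn * N%:Z ^+ size as_) (bulk_nums i as_) (bulk_wt i)
    (zd * N%:Z ^+ size bs) (bulk_nums i bs)
    (\big[@tmul int/tone int]_(offset i <= t < offset i.+1) step_tri i.+1 t).

Context (p q : nat) (hp : prime p).
Hypothesis (N1 : (1 < N)%N) (c2 : (N.+1 < c)%N) (pq : p = nmod N c q) (qc : (c + 3 <= q)%N).
Hypothesis (ha : all (fun a => a < N)%N as_) (hb : all (fun b => b < N)%N bs).
Local Notation P := p.-1.
Local Notation y := (yval N p).

Definition stepF (m : nat) : tri 'F_p :=
  let g := zd%:~R * \prod_(b <- bs) (N%:R ^+ 2 * step_ratio N p m b) in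
  (zn%:~R * \prod_(a <- as_) (N%:R ^+ 2 * step_ratio N p m a),
   (p_exp N P as_ bs D m == 0)%:R * g, g).

Definition castT (a : tri int) : tri 'F_p := (a.1.1%:~R, a.1.2%:~R, a.2%:~R).

Lemma castM a b : castT (tmul a b) = tmul (castT a) (castT b).
Proof. by rewrite /castT /tmul /= rmorphD !rmorphM. Qed.

Lemma cast1 : castT (tone int) = tone 'F_p.
Proof. by rewrite /castT /tone /= rmorph0 rmorph1. Qed.

Lemma cast_big m n (M : nat -> tri int) :
  castT (\big[@tmul int/tone int]_(m <= l < n) M l) =
  \big[@tmul 'F_p/tone 'F_p]_(m <= l < n) castT (M l).
Proof. exact: (big_morph castT castM cast1). Qed.

Let PE : P = (c.-1 + N * q)%N.
Proof. by rewrite pq /nmod addnC; case: c c2. Qed.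

Let NqF : (N%:R * q%:R : 'F_p) = - c%:R.
Proof.
by apply/eqP; rewrite -addr_eq0 -natrM -natrD natr_Fp0 // {1}pq /nmod dvdnn.
Qed.

Let NF0 : (N%:R : 'F_p) != 0.
Proof.
rewrite natr_Fp0 //; apply/negP => /dvdn_leq; rewrite pq /nmod => /(_ (ltnW N1)).
by have : (N * 3 <= N * q)%N; [rewrite leq_mul2l; lia|lia].
Qed.

Lemma num_yval i t a e m : m = (i * q + t)%N -> e = below N P m a ->
  N%:R * y m a = (num i t a e)%:~R.
Proof.
move=> -> ->; rewrite /yval /num !mulrDr mulrCA divff // mulr1.
rewrite rmorphB rmorphD /= -!pmulrn !natrM !natrD natrM mulrDr.
by rewrite [N%:R * (i%:R * _)]mulrCA NqF; ring.
Qed.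

(** Being smaller than p in absolute value, [v] vanishes modulo p only if it is 0, so the test in
    [fac] does not involve p. *)
Lemma fac_cast (v : int) (x : 'F_p) : (`|v| < p)%N -> N%:R * x = v%:~R ->
  (fac v)%:~R = N%:R * pz x.
Proof.
move=> vp e; rewrite /fac /pz; case: (eqVneq v 0) => [v0|vn].
  have -> : x = 0 by move/eqP: e; rewrite v0 mulf_eq0 (negPf NF0) => /eqP.
  by rewrite eqxx mulr1 -pmulrn.
have vF : v%:~R != 0 :> 'F_p.
  rewrite intr_Fp0 // dvdzE /=; apply/negP => /dvdn_leq; rewrite absz_gt0 vn => /(_ isT).
  by rewrite leqNgt vp.
have xn : x != 0 by apply: contraNneq vF => x0; rewrite -e x0 mulr0.
by rewrite (negPf xn) e.
Qed.

Lemma bel_below i t a m : (i <= N)%N -> (t <= c.+1)%N -> (a < N)%N -> m = (i * q + t)%N ->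
  below N P m a = bel i t a.
Proof.
move=> iN tc aN ->; rewrite /below /bel PE.
have e1 : (a * (c.-1 + N * q) = a * c.-1 + a * (N * q))%N by rewrite mulnDr.
have e2 : (N * (i * q + t) = i * (N * q) + N * t)%N by rewrite mulnDr mulnCA.
have ac : (a * c.-1 < N * q)%N by apply: leq_ltn_trans (leq_mul (ltnW aN) (leqnn _)) _; rewrite ltn_mul2l; lia.
have tq : (N * t < N * q)%N by rewrite ltn_mul2l; lia.
rewrite e1 e2; move: (N * q)%N (a * c.-1)%N (N * t)%N ac tq => Q A T ac tq.
case: (ltngtP a i) => [ai|ia|->] /=.
- have h : (a.+1 * Q <= i * Q)%N by rewrite leq_mul2r ai orbT.
  by rewrite mulSn in h; lia.
- have h : (i.+1 * Q <= a * Q)%N by rewrite leq_mul2r ia orbT.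
  by rewrite mulSn in h; lia.
by rewrite addnC ltn_add2l.
Qed.

Lemma hit_hits i t b m : (i <= N)%N -> (t <= c)%N -> (b < N)%N -> m = (i * q + t)%N ->
  hits N P m b = hit i t b.
Proof.
move=> iN tc bN ->; rewrite /hits /hit PE.
have e1 : (b * (c.-1 + N * q) = b * c.-1 + b * (N * q))%N by rewrite mulnDr.
have e2 : (N * (i * q + t) = i * (N * q) + N * t)%N by rewrite mulnDr mulnCA.
have ac : (b * c.-1 < N * q)%N by apply: leq_ltn_trans (leq_mul (ltnW bN) (leqnn _)) _; rewrite ltn_mul2l; lia.
have tq : (N * t < N * q)%N by rewrite ltn_mul2l; lia.
rewrite e1 e2; move: (N * q)%N (b * c.-1)%N (N * t)%N ac tq => Q A T ac tq.
case: (ltngtP b i) => [ai|ia|->] /=.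
- have h : (b.+1 * Q <= i * Q)%N by rewrite leq_mul2r ai orbT.
  by rewrite mulSn in h; apply/negbTE; lia.
- have h : (i.+1 * Q <= b * Q)%N by rewrite leq_mul2r ia orbT.
  by rewrite mulSn in h; apply/negbTE; lia.
by rewrite addnC eqn_add2l.
Qed.

Lemma rfac_cast i t a m : (i <= N)%N -> (t <= c)%N -> (a < N)%N -> m = (i * q + t)%N ->
  (rfac i t a)%:~R = N%:R ^+ 2 * step_ratio N p m a.
Proof.
move=> iN tc aN em; have em1 : m.+1 = (i * q + t.+1)%N by rewrite em addnS.
have b1 := bel_below iN (leqW tc) aN em.
have b2 := bel_below iN (tc : (t.+1 <= c.+1)%N) aN em1.
have ny := num_yval em (esym b1); rewrite -b1 in ny.
rewrite /rfac /step_ratio -b1 -b2 rmorphM /=; set e := below N P m a in ny *.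
(* The assumption q >= c + 3 serves here: N q dominates N (t + e), i c and the additional N of a
   second shift. *)
have bound : (`|num i t a e| + N < p)%N.
  have h1 : (N * (t + e) <= N * (c + 1))%N by rewrite leq_mul2l leq_add ?orbT //; case: (e).
  have h2 : (i * c <= N * c)%N by rewrite leq_mul2r iN orbT.
  have h3 : (N * (c + 3) <= N * q)%N by rewrite leq_mul2l qc orbT.
  rewrite pq /nmod /num; move: h1 h3; rewrite !mulnDr; lia.
rewrite (fac_cast _ ny); last by lia.
rewrite expr2 -!mulrA; congr (_ * _); rewrite mulrCA; congr (_ * _).
case: ifP => _; last by rewrite mulr1 -pmulrn.
apply: fac_cast; first by lia.
by rewrite mulrDr ny mulr1 [RHS]rmorphD.
Qed.

Lemma step_cast i t m : (i <= N)%N -> (t <= c)%N -> m = (i * q + t)%N ->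
  castT (step_tri i t) = stepF m.
Proof.
move=> iN tc em.
have pr l : all (fun a => a < N)%N l ->
    (\prod_(a <- l) rfac i t a)%:~R = \prod_(a <- l) (N%:R ^+ 2 * step_ratio N p m a) :> 'F_p.
  move=> /allP hl; rewrite rmorph_prod /= big_seq [RHS]big_seq; apply: eq_bigr => a al.
  exact: rfac_cast (hl a al) em.
have cb l : all (fun a => a < N)%N l -> count (below N P m) l = count (bel i t) l.
  by move=> /allP hl; apply: eq_in_count => a al; rewrite (bel_below iN (leqW tc) (hl a al) em).
have ch l : all (fun a => a < N)%N l -> count (hits N P m) l = count (hit i t) l.
  by move=> /allP hl; apply: eq_in_count => a al; rewrite (hit_hits iN tc (hl a al) em).
have ep : p_exp N P as_ bs D m = pex i t by rewrite /p_exp /sgn_exp /pex !cb // ch.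
by rewrite /castT /step_tri /stepF /= !rmorphM /= !pr // ep rmorph_nat.
Qed.

Lemma offset_lo i : (i < N)%N -> (i * c.-1 < N * offset i)%N.
Proof. by move=> iN; rewrite /offset iN [X in (_ < X)%N]mulnC ltn_ceil // ltnW. Qed.

Lemma offset_hi i : (i < N)%N -> (N * offset i < i.+1 * c.-1)%N.
Proof.
move=> iN; rewrite /offset iN mulnS mulSn.
have h : (N * (i * c.-1 %/ N) <= i * c.-1)%N by rewrite mulnC leq_divM.
apply: leq_ltn_trans (leq_add (leqnn N) h) _; rewrite ltn_add2r.
by case: c c2.
Qed.

Lemma offset_mono i : (i < N)%N -> (offset i <= offset i.+1)%N.
Proof.
move=> iN; rewrite {1}/offset iN /offset; case: ifP => h.
  by rewrite ltnS leq_div2r // leq_mul2r leqnSn orbT.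
rewrite ltn_divLR ?(ltnW N1) // mulnC ltn_mul2l iN andbT.
by case: c c2 => [|[|?]].
Qed.

Lemma offset_le i : (offset i <= c)%N.
Proof.
rewrite /offset; case: ifP => iN; last exact: leq_pred.
rewrite ltn_divLR ?(ltnW N1) //; apply: leq_ltn_trans (leq_mul (ltnW iN) (leqnn _)) _.
by rewrite mulnC ltn_mul2r (ltnW N1) /=; case: c c2.
Qed.

End Steps.

Lemma total_rcons N B cs x q : total_tri N B (rcons cs x) q =
  tmul (tmul (total_tri N B cs q) (\big[@tmul int/tone int]_(0 <= l < q) leaf N x l)) (bdry x).
Proof. by elim: cs B => //= cp cs IH B; rewrite IH. Qed.

Lemma big_shift (T : Type) (idx : T) (op : Monoid.law idx) (F : nat -> T) s m n :
  \big[op/idx]_(m <= l < n) F (s + l)%N = \big[op/idx]_(s + m <= l < s + n) F l.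
Proof.
rewrite [in RHS](addnC s m) big_addn addKn; apply: eq_bigr => l _.
by rewrite addnC.
Qed.

(** Inside an interval p never divides N y, so the factors there are polynomial without exception.
    Write b p = b P + b: for b <= i the left-hand side is too large, for b > i too small. *)
Lemma no_multiple N P i m a b : (a < N)%N -> (i < N)%N -> (i * P < N * m)%N ->
  (N * m + N < i.+1 * P)%N -> (a + N * m + N * (a <= i) = b * P.+1)%N -> False.
Proof.
move=> aN iN h1 h2; rewrite mulnS; case: (leqP a i) => ai e; case: (leqP b i) => bi.
- have h3 : (b * P <= i * P)%N by rewrite leq_mul2r bi orbT.
  by lia.
- have h3 : (i.+1 * P <= b * P)%N by rewrite leq_mul2r bi orbT.
  by lia.
- have h3 : (b * P <= i * P)%N by rewrite leq_mul2r bi orbT.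
  by lia.
- have h3 : (i.+1 * P <= b * P)%N by rewrite leq_mul2r bi orbT.
  by lia.
Qed.

Section Assembly.
Context (N c : nat) (as_ bs : seq nat) (D zn zd : int) (p q : nat) (hp : prime p).
Hypothesis (N1 : (1 < N)%N) (c2 : (N.+1 < c)%N) (pq : p = nmod N c q) (qc : (c + 3 <= q)%N).
Hypothesis (ha : all (fun a => a < N)%N as_) (hb : all (fun b => b < N)%N bs).
Hypothesis (ss : size as_ = size bs) (op : odd p).
Local Notation P := p.-1.
Local Notation stepFp := (stepF N as_ bs D zn zd p).
Local Notation bulk := (bulk N c as_ bs D zn zd).

Let PE : P = (c.-1 + N * q)%N.
Proof. by rewrite pq /nmod addnC; case: c c2. Qed.

Let NF0 : (N%:R : 'F_p) != 0.
Proof.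
rewrite natr_Fp0 //; apply/negP => /dvdn_leq; rewrite pq /nmod => /(_ (ltnW N1)).
by have : (N * 3 <= N * q)%N; [rewrite leq_mul2l; lia|lia].
Qed.

Lemma bulk_cast i k : (i < N)%N -> (k < q)%N ->
  castT p (leaf N (bulk i) k) = stepFp (i * q + offset N c i + k)%N.
Proof.
move=> iN kq; set m := (_ + k)%N.
have em : m = (i * q + (offset N c i + k))%N by rewrite /m addnA.
have lo := offset_lo c N1 iN; have hi := offset_hi c2 iN.
have kq' : (N * k.+1 <= N * q)%N by rewrite leq_mul2l kq orbT.
have Nm : (N * m = i * (N * q) + N * offset N c i + N * k)%N.
  by rewrite em !mulnDr mulnCA addnA.
have h1 : (i * P < N * m)%N by rewrite PE Nm mulnDr; lia.
have h2 : (N * m + N < i.+1 * P)%N.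
  by rewrite PE Nm mulnDr [(i.+1 * (N * q))%N]mulSn; rewrite mulnS in kq'; lia.
have bel a : below N P m a = (a <= i)%N.
  rewrite /below; case: (leqP a i) => ai.
    by apply: leq_ltn_trans h1; rewrite leq_mul2r ai orbT.
  apply/negbTE; rewrite -leqNgt; have : (i.+1 * P <= a * P)%N by rewrite leq_mul2r ai orbT.
  by lia.
have bel1 a : below N P m.+1 a = (a <= i)%N.
  rewrite /below mulnS; case: (leqP a i) => ai.
    have : (a * P <= i * P)%N by rewrite leq_mul2r ai orbT.
    by lia.
  apply/negbTE; rewrite -leqNgt; have : (i.+1 * P <= a * P)%N by rewrite leq_mul2r ai orbT.
  by lia.
have nohit a : hits N P m a = false.
  apply/negbTE; rewrite /hits; case: (leqP a i) => ai.
    have : (a * P <= i * P)%N by rewrite leq_mul2r ai orbT.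
    by lia.
  have : (i.+1 * P <= a * P)%N by rewrite leq_mul2r ai orbT.
  by lia.
have fct a : (a < N)%N -> (((N * k)%N%:Z + num N c i (offset N c i) a (a <= i)%N) * N%:Z)%:~R =
    N%:R ^+ 2 * step_ratio N p m a.
  move=> aN; have ny := num_yval hp N1 c2 pq qc ha hb em (esym (bel a)).
  have -> : (N * k)%N%:Z + num N c i (offset N c i) a (a <= i)%N =
     num N c i (offset N c i + k) a (a <= i)%N by rewrite /num !mulnDr; lia.
  rewrite rmorphM /= -ny /step_ratio bel bel1 andbN mulr1 /pz.
  have y0 : yval N p m a != 0.
    apply/negP => /eqP y0; have : (N%:R * yval N p m a : 'F_p) == 0 by rewrite y0 mulr0.
    have -> : N%:R * yval N p m a = (a + N * m + N * (a <= i))%N%:R.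
      rewrite /yval bel !mulrDr mulrCA divff // mulr1.
      by rewrite (natrD _ (a + N * m)) (natrD _ a) !natrM.
    rewrite natr_Fp0 // => /dvdnP[b hb']; apply: (@no_multiple N P i m a b) => //.
    by rewrite hb' prednK // prime_gt0.
  by rewrite (negPf y0) -pmulrn expr2 mulrAC.
have pr l cst : all (fun a => a < N)%N l ->
   (lin N k (cst * N%:Z ^+ size l) (bulk_nums N c i l))%:~R =
   cst%:~R * \prod_(a <- l) (N%:R ^+ 2 * step_ratio N p m a) :> 'F_p.
  move=> hl; rewrite /lin -mulrA rmorphM /=; congr (_ * _).
  elim: l hl => [|a l IH] /=; first by rewrite !big_nil mulr1 expr0.
  move=> /andP[aN hl]; rewrite !big_cons -(fct _ aN) -(IH hl) -rmorphM /= exprS.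
  by congr (_%:~R); ring.
have ep : p_exp N P as_ bs D m = (count (fun a => a <= i)%N as_)%:Z -
    (count (fun b => b <= i)%N bs)%:Z + D + (count_mem 0%N bs)%:Z.
  have nh : count (hits N P m) bs = 0%N by rewrite (eq_count (a2 := pred0) nohit) count_pred0.
  by rewrite /p_exp /sgn_exp !(eq_count bel) nh subr0.
rewrite /castT /leaf /= !pr // /stepF ep; congr (_, _, _).
by rewrite rmorphM /= pr // /bulk_wt rmorph_nat.
Qed.

Lemma total_cast n : (n <= N)%N ->
  castT p (total_tri N (step_tri N c as_ bs D zn zd 0 0) [seq bulk i | i <- iota 0 n] q) =
  \big[@tmul 'F_p/tone 'F_p]_(0 <= m < n * q + offset N c n) stepFp m.
Proof.
elim: n => [|n IH] nN.
  rewrite /= /offset (ltnW N1) mul0n div0n big_nat1.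
  by apply: (step_cast D zn zd hp N1 c2 pq qc ha hb).
rewrite (_ : iota 0 n.+1 = rcons (iota 0 n) n); last by rewrite -[n.+1]addn1 iotaD cats1.
rewrite map_rcons total_rcons !castM IH ?(ltnW nN) // !cast_big.
have mono := offset_mono N1 c2 nN.
rewrite [X in tmul (tmul _ X) _](eq_big_nat _ _ (F2 := fun l => stepFp (n * q + offset N c n + l)%N)); last first.
  by move=> l /andP[_ lq]; apply: bulk_cast.
rewrite [X in tmul _ X](eq_big_nat _ _ (F2 := fun t => stepFp (n.+1 * q + t)%N)); last first.
  move=> t /andP[_ tn]; apply: (step_cast D zn zd hp N1 c2 pq qc ha hb) => //.
  by apply: ltnW; apply: leq_trans tn (offset_le N1 c2 _).
rewrite !big_shift addn0.
have -> : (n * q + offset N c n + q = n.+1 * q + offset N c n)%N by rewrite mulSn; lia.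
rewrite -big_cat_nat //; last by rewrite mulSn; lia.
by rewrite -big_cat_nat // leq_add2l.
Qed.

End Assembly.

Section BulkResidue.
Context (r N c : nat) (alpha beta : r.-tuple rat) (as_ bs : seq nat) (D : int) (z : rat).
Hypothesis (ea : tval alpha = rats N as_) (eb : tval beta = rats N bs).
Hypothesis (ha : all (fun a => a < N)%N as_) (hb : all (fun b => b < N)%N bs).
Hypothesis (eD : Dshift alpha beta = D%:~R).
Hypothesis (he : forall P m, (0 < P)%N -> (m < P)%N -> 0 <= p_exp N P as_ bs D m).
Context (p q : nat) (hp : prime p).
Hypothesis (N1 : (1 < N)%N) (c2 : (N.+1 < c)%N) (pq : p = nmod N c q) (qc : (c + 3 <= q)%N).
Hypothesis (op : odd p) (hz : p_unit p z).
Local Notation zn := (numq z).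
Local Notation zd := (denq z).

(** The step at the index m = 0, which precedes the first interval because [offset 0] is 1. *)
Definition class_boundary : tri int := step_tri N c as_ bs D zn zd 0 0.

Definition class_components : seq component :=
  [seq bulk N c as_ bs D zn zd i | i <- iota 0 N].

Let zdF : (zd%:~R : 'F_p) != 0.
Proof. by case/andP: hz => h _; rewrite intr_Fp0 // dvdzE. Qed.

Let zzE : phi (ratr z : padic_int hp) * zd%:~R = zn%:~R.
Proof.
apply: phi_ratr; last by case/andP: hz => h _; rewrite dvdzE.
by rewrite -{1}(divq_num_den z) divfK // intr_eq0 denq_neq0.
Qed.

Let zz0 : phi (ratr z : padic_int hp) != 0.
Proof.
have : (zn%:~R : 'F_p) != 0 by case/andP: hz => _ h; rewrite intr_Fp0 // dvdzE.
by rewrite -zzE mulf_eq0 (negPf zdF) orbF.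
Qed.

Let pN : ~~ (p %| N)%N.
Proof.
apply/negP => /dvdn_leq; rewrite pq /nmod => /(_ (ltnW N1)).
by have : (N * 3 <= N * q)%N; [rewrite leq_mul2l; lia|lia].
Qed.

Let ss : size as_ = size bs.
Proof. by have := size_tuple alpha; have := size_tuple beta; rewrite ea eb !size_map => -> ->. Qed.

(** G is the product of all denominators; it is nonzero since p divides neither the denominator of z
    nor N, and [step_ratio] never vanishes. *)
Lemma total_field : exists2 G : 'F_p, G != 0 &
  castT p (total_tri N class_boundary class_components q) =
  (G * uval N as_ bs hp (phi (ratr z : padic_int hp)) p.-1, G * phi (trace_int N alpha beta as_ bs D z hp), G).
Proof.
pose g m : 'F_p := zd%:~R * \prod_(b <- bs) (N%:R ^+ 2 * step_ratio N p m b).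
have g0 m : g m != 0.
  rewrite mulf_neq0 // prodf_seq_neq0; apply/allP => b _ /=.
  by rewrite mulf_neq0 ?step_ratio_neq0 // expf_neq0 // natr_Fp0.
exists (\prod_(0 <= m < p.-1) g m).
  by rewrite prodf_seq_neq0; apply/allP => m _; apply: g0.
rewrite (total_cast D zn zd hp N1 c2 pq qc ha hb ss op (leqnn N)).
have -> : (N * q + offset N c N = p.-1)%N.
  by rewrite /offset ltnn pq /nmod; case: c c2 => // c' _; rewrite addnS.
rewrite (phi_trace D (ltnW N1) ea eb ha hb op pN zz0).
pose u m := uval N as_ bs hp (phi (ratr z : padic_int hp)) m.
pose f m : 'F_p := zn%:~R * \prod_(a <- as_) (N%:R ^+ 2 * step_ratio N p m a).
have e l m : \prod_(a <- l) (N%:R ^+ 2 * step_ratio N p m a) =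
    (N%:R ^+ 2) ^+ size l * \prod_(a <- l) step_ratio N p m a :> 'F_p.
  elim: l => [|a l IH]; first by rewrite !big_nil mulr1.
  by rewrite !big_cons IH /= [(_ ^+ 2) ^+ _.+1]exprS; ring.
apply: (@tri_prod_field _ f g (fun m => (p_exp N p.-1 as_ bs D m == 0)%:R) u p.-1 g0).
  exact: uval0.
move=> m; rewrite /f /g !e ss -zzE; have := uvalS N hp op (phi (ratr z : padic_int hp)) ss m.
rewrite -/(u m) -/(u m.+1) => h.
transitivity (zd%:~R * (N%:R ^+ 2) ^+ size bs * (u m.+1 * \prod_(b <- bs) step_ratio N p m b)).
  by ring.
by rewrite h; ring.
Qed.

Lemma total_unit : ~~ (p%:Z %| (total_tri N class_boundary class_components q).2)%Z.
Proof. by have [G G0 [_ _ e]] := total_field; rewrite -(intr_Fp0 hp) e. Qed.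

Lemma total_residue y : residue_of (total_tri N class_boundary class_components q) p y ->
  is_residue (hgm_trace alpha beta hp z) y.
Proof.
move=> [yp hy]; have [G G0 [_ e1 e2]] := total_field.
apply: (residue_phi (trace_intE z (ltnW N1) ea eb ha hb eD he hp) yp).
apply: (mulfI G0); rewrite -e1 -e2.
move: hy; rewrite /eqmod -(intr_Fp0 hp) rmorphB rmorphM /= subr_eq0 => /eqP <-.
by rewrite -pmulrn mulrC.
Qed.

End BulkResidue.

(** * Dividing the primes into residue classes *)

Lemma rats_of (N : nat) (s : seq rat) : (0 < N)%N ->
  (forall x, x \in s -> 0 <= x < 1) -> (forall x, x \in s -> `|denq x| %| N)%N ->
  exists2 l, s = rats N l & all (fun a => a < N)%N l.
Proof.
move=> N0 s01 sN.
exists [seq (`|numq x| * (N %/ `|denq x|))%N | x <- s].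
  rewrite /rats -map_comp -[LHS]map_id; apply/eq_in_map => x xs /=.
  have /andP[x0 _] := s01 x xs; have /dvdnP[k Nk] := sN x xs.
  have d0 : (0 < `|denq x|)%N by rewrite absz_gt0 denq_neq0.
  have k0 : (0 < k)%N by rewrite Nk muln_gt0 in N0; case/andP: N0.
  have nE : (`|numq x|%N%:R : rat) = (numq x)%:~R by rewrite pmulrn gez0_abs // numq_ge0.
  have dE : (`|denq x|%N%:R : rat) = (denq x)%:~R by rewrite pmulrn gtz0_abs.
  rewrite Nk mulnK // !natrM nE dE -{1}(divq_num_den x).
  by field; rewrite intr_eq0 denq_neq0 pnatr_eq0 -lt0n k0.
apply/allP => _ /mapP[x xs ->].
have /andP[x0 x1] := s01 x xs; have /dvdnP[k Nk] := sN x xs.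
have d0 : (0 < `|denq x|)%N by rewrite absz_gt0 denq_neq0.
rewrite Nk mulnK // mulnC ltn_mul2l; apply/andP; split.
  by rewrite Nk muln_gt0 in N0; case/andP: N0.
rewrite -ltz_nat gez0_abs ?numq_ge0 // gtz0_abs ?denq_gt0 //.
by move: x1; rewrite -{1}(divq_num_den x) ltr_pdivrMr ?ltr0z ?denq_gt0 // mul1r ltr_int.
Qed.

Lemma uniq_flatten_map (S T : eqType) (f : S -> seq T) (g : T -> S) (s : seq S) :
  uniq s -> (forall c, c \in s -> uniq (f c)) ->
  (forall c x, c \in s -> x \in f c -> g x = c) -> uniq (flatten [seq f c | c <- s]).
Proof.
elim: s => //= c s IH /andP[cs us] uf gf; rewrite cat_uniq uf ?inE ?eqxx //=.
rewrite IH //; first last.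
- by move=> c' x hc'; apply: gf; rewrite inE hc' orbT.
- by move=> c' hc'; apply: uf; rewrite inE hc' orbT.
rewrite andbT; apply/hasPn => x /flattenP[_ /mapP[c' hc' ->] xc']; apply/negP => xc.
have e1 : g x = c by apply: gf; rewrite ?inE ?eqxx.
have e2 : g x = c' by apply: gf => //; rewrite inE hc' orbT.
by move: cs; rewrite -e1 e2 hc'.
Qed.

(** Representatives are taken from [2N, 3N) because the steps require c > N + 1. *)
Definition classes (N : nat) : seq nat := [seq c <- iota (2 * N) N | coprime c N].

Lemma classesP N c : c \in classes N -> [/\ (2 * N <= c)%N, (c < 3 * N)%N & coprime c N].
Proof. by rewrite mem_filter mem_iota => /andP[cc /andP[c1 c2]]; split=> //; lia. Qed.

Lemma in_class N p : (0 < N)%N -> (3 * N < p)%N -> coprime p N ->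
  exists2 c, c \in classes N & exists q, p = nmod N c q.
Proof.
move=> N0 pN cp; exists (2 * N + p %% N)%N.
  rewrite mem_filter mem_iota leq_addr /=; have := ltn_pmod p N0.
  by rewrite -coprime_modl modnMDl modn_mod coprime_modl cp => h; lia.
exists (p %/ N - 2)%N; rewrite /nmod; have := divn_eq p N; have := ltn_pmod p N0.
have : (2 <= p %/ N)%N by rewrite leq_divRL //; lia.
case: (p %/ N)%N => [|[|k]] // _ h e; rewrite {1}e !mulSn mulnC; lia.
Qed.

Lemma uniq_classes N p0 X h : uniq (flatten [seq [seq nmod N c q | q <- rev (iota 0 (2 ^ h)) &
   prime (nmod N c q) && (p0 < nmod N c q <= X)%N] | c <- classes N]).
Proof.
case: (posnP N) => [->|N0]; first by rewrite /classes.
(* This function recovers the class of a number, so the lists of different classes are disjoint. *)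
apply: (@uniq_flatten_map _ _ _ (fun x => 2 * N + x %% N)%N); first by rewrite filter_uniq ?iota_uniq.
  move=> c _; rewrite map_inj_uniq ?filter_uniq ?rev_uniq ?iota_uniq //.
  by move=> q q' /eqP; rewrite /nmod eqn_add2r eqn_pmul2l // => /eqP.
move=> c x /classesP[c1 c3 _] /mapP[q _ ->]; rewrite /nmod (mulnC N) modnMDl.
have -> : c = (2 * N + (c - 2 * N))%N by lia.
by rewrite modnMDl modn_small //; lia.
Qed.

Section LargePrimes.
Context (r : nat) (alpha beta : r.-tuple rat) (z : rat).

(** The factor 2 makes every c prime to N odd, hence all moduli c + N q odd, prime or not, as
    Montgomery reduction demands. *)
Definition common_den : nat := (2 * \prod_(x <- alpha ++ beta) `|denq x|)%N.

Lemma common_den_gt1 : (1 < common_den)%N.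
Proof.
have : (0 < \prod_(x <- alpha ++ beta) `|denq x|)%N.
  by rewrite prodn_gt0 // => x; rewrite absz_gt0 denq_neq0.
by rewrite /common_den; lia.
Qed.

Lemma denq_dvd x : x \in alpha ++ beta -> (`|denq x| %| common_den)%N.
Proof. by move=> hx; rewrite /common_den (big_rem x hx) /= mulnCA dvdn_mulr. Qed.

(** Above the first summand every prime of a class has q >= c + 3; the other summands make it divide
    no numerator or denominator of z and z - 1. *)
Definition threshold : nat := (9 * (common_den * common_den) +
  (`|numq z| + `|denq z| + `|numq (z - 1)| + `|denq (z - 1)|))%N.

Lemma large_p_unit p (x : rat) : x != 0 -> (`|numq x| < p)%N -> (`|denq x| < p)%N -> p_unit p x.
Proof.
move=> x0 np dp; rewrite /p_unit /p_integral; apply/andP; split; apply/negP => /dvdn_leq.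
  by rewrite absz_gt0 denq_neq0 => /(_ isT); lia.
by rewrite absz_gt0 numq_eq0 x0 => /(_ isT); lia.
Qed.

Lemma large_good p : z != 0 -> z != 1 -> (threshold < p)%N -> good_prime alpha beta z p = prime p.
Proof.
move=> hz0 hz1; rewrite /threshold => hp; rewrite /good_prime; case: (boolP (prime p)) => //= pp.
have N1 := common_den_gt1.
have NN : (common_den <= common_den * common_den)%N by rewrite leq_pmulr // ltnW.
have pN : ~~ (p %| common_den)%N by apply/negP => /dvdn_leq -/(_ (ltnW N1)); lia.
have pi x : x \in alpha ++ beta -> p_integral p x.
  by move=> /denq_dvd dx; apply: contra pN => pd; apply: dvdn_trans dx.
rewrite !large_p_unit ?subr_eq0 //; try lia.
by rewrite /=; apply/andP; split; apply/allP => x hx; apply: pi; rewrite mem_cat hx ?orbT.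
Qed.

End LargePrimes.

Theorem theorem5p26 (r : nat) (alpha beta : r.-tuple rat) (z : rat)
    (hdatum : hypergeometric_datum alpha beta) (halpha : 0 \notin alpha)
    (hz0 : z != 0) (hz1 : z != 1) :
  exists (P : program) (C : nat), forall X : nat,
    exists (t : nat) (s : state),
      [/\ exec P (init X) t s,
          correct_output alpha beta z X (out s) &
          (2 <= X)%N -> (t <= C * (X * trunc_log 2 X ^ 3))%N].
Proof.
set N := common_den alpha beta; have N1 : (1 < N)%N := common_den_gt1 alpha beta.
have [a01 b01 _ _ _] := hdatum.
have dN x : x \in alpha ++ beta -> (`|denq x| %| N)%N := @denq_dvd r alpha beta x.
have [|as_ ea ha] := rats_of (ltnW N1) a01.
  by move=> x hx; apply: dN; rewrite mem_cat hx.
have [|bs eb hb] := rats_of (ltnW N1) b01.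
  by move=> x hx; apply: dN; rewrite mem_cat hx orbT.
have [D eD he] := p_exp_ge0 (ltnW N1) hdatum halpha ea eb ha hb.
set p0 := threshold alpha beta z.
(* Residues are chosen for all primes, but only the finitely many up to [p0] are written into the
   program. *)
have [|res_ hres] := @boolp.choice nat nat (fun p c => forall hp : prime p,
    is_residue (hgm_trace alpha beta hp z) c).
  move=> p; case: (pselect (prime p)) => [hp|np]; last by exists 0%N => hp; case: np.
  exists (trace_int N alpha beta as_ bs D z hp 1%N) => hp'; rewrite (bool_irrelevance hp' hp).
  exact: (residue_phi (trace_intE z (ltnW N1) ea eb ha hb eD he hp) (res1E _)).
have bulk_ok c q : c \in classes N -> (p0 < nmod N c q)%N -> (N.+1 < c)%N /\ (c + 3 <= q)%N.
  move=> /classesP[c1 c3 _] pq; split; first by lia.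
  (* If q <= c + 2, then c < 3 N gives q <= 3 N + 1, and p = N q + c would be at most 5 N^2. *)
  rewrite leqNgt; apply/negP => qc; have : (N * q <= N * (3 * N + 1))%N by rewrite leq_mul2l; lia.
  have NN : (N * 2 <= N * N)%N by rewrite leq_mul2l N1 orbT.
  by move: pq; rewrite /p0 /threshold -/N /nmod mulnDr mulnCA; lia.
have odd_p p : prime p -> (p0 < p)%N -> odd p.
  move=> pp h; case: (even_prime pp) => // p2; move: h; rewrite p2 /p0 /threshold -/N.
  by have : (N * 2 <= N * N)%N; [rewrite leq_mul2l N1 orbT|lia].
have unit_p p : prime p -> (p0 < p)%N -> p_unit p z.
  by move=> pp h; have := large_good hz0 hz1 h; rewrite pp => /and3P[].
have [||P [C H]] := @algorithm p0 N
  [seq (p, res_ p) | p <- iota 0 p0.+1 & good_prime alpha beta z p] (classes N)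
  (fun c => class_boundary N c as_ bs D z) (fun c => class_components N c as_ bs D z).
- by rewrite /N /common_den mul2n odd_double.
- move=> c hc; have [c1 c3 cN] := classesP hc; split; last 1 first.
  + move=> q pp pq; have [c2 qc] := bulk_ok c q hc pq.
    exact: (total_unit D ea eb ha hb pp N1 c2 erefl qc (odd_p _ pp pq) (unit_p _ pp pq)).
  + have eN : ~~ odd N by rewrite /N /common_den mul2n odd_double.
    move: cN; rewrite -[odd c]negbK -dvdn2; apply: contraL => d2.
    have d2N : (2 %| N)%N by rewrite dvdn2.
    apply/negP => /eqP e; have : (2 %| gcdn c N)%N by rewrite dvdn_gcd d2.
    by rewrite e.
  + by lia.
exists P, C => X; have [t [s [h [ans [ex tT Xh ho [hu ha']]]]]] := H X.
exists t, s; split=> //.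
have mem_ans p : (p \in unzip1 ans) = [&& prime p, (p0 < p)%N & (p <= X)%N].
  rewrite hu; apply/flattenP/idP => [[_ /mapP[c hc ->] /mapP[q]]|/and3P[pp lp pX]].
    by rewrite mem_filter => /andP[/andP[pp /andP[l1 l2]] _] ->; rewrite pp l1.
  have pN : (3 * N < p)%N.
    have NN : (N * 2 <= N * N)%N by rewrite leq_mul2l N1 orbT.
    by move: lp; rewrite /p0 /threshold -/N; lia.
  have cp : coprime p N.
    rewrite prime_coprime //; apply/negP => /dvdn_leq -/(_ (ltnW N1)); lia.
  have [c hc [q pq]] := in_class (ltnW N1) pN cp.
  exists [seq nmod N c q | q <- rev (iota 0 (2 ^ h)) &
      prime (nmod N c q) && (p0 < nmod N c q <= X)%N]; first exact: map_f.
  apply/mapP; exists q => //; rewrite mem_filter -pq pp lp pX mem_rev mem_iota /=.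
  apply: leq_ltn_trans Xh; apply: leq_trans pX; rewrite pq /nmod.
  by apply: leq_trans (leq_addr _ _); rewrite leq_pmull // ltnW.
exists ([seq pc <- [seq (p, res_ p) | p <- iota 0 p0.+1 & good_prime alpha beta z p] |
  (pc.1 <= X)%N] ++ ans); split=> //.
- have e1 : unzip1 [seq pc <- [seq (p, res_ p) | p <- iota 0 p0.+1 & good_prime alpha beta z p] |
      (pc.1 <= X)%N] = [seq p <- [seq p <- iota 0 p0.+1 | good_prime alpha beta z p] | (p <= X)%N].
    by rewrite filter_map /unzip1 -map_comp map_id.
  rewrite /unzip1 map_cat -!/(unzip1 _) e1; apply: uniq_perm.
  + rewrite cat_uniq !filter_uniq ?iota_uniq // hu uniq_classes andbT -hu.
    apply/hasPn => p; rewrite mem_ans => /and3P[_ lp _].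
    by rewrite !mem_filter mem_iota add0n ltnS [(p <= p0)%N]leqNgt lp !andbF.
  + by rewrite filter_uniq ?iota_uniq.
  move=> p; rewrite mem_cat !mem_filter !mem_iota mem_ans !add0n !ltnS.
  case: (leqP p p0) => lp; last rewrite (large_good hz0 hz1 lp).
    by rewrite andbF orbF /= andbT andbC.
  by rewrite !andbF.
- move=> p c hp; rewrite mem_cat => /orP[|pc].
    by rewrite mem_filter => /andP[_ /mapP[p' _ [e1 ->]]]; rewrite -e1.
  have [c' [q [hc' pq hy]]] := ha' _ _ pc; have lp : (p0 < p)%N.
    suff : p \in unzip1 ans by rewrite mem_ans => /and3P[].
    by apply/mapP; exists (p, c).
  have [c2 qc] : (N.+1 < c')%N /\ (c' + 3 <= q)%N by apply: bulk_ok; rewrite -?pq.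
  exact: (total_residue ea eb ha hb eD he hp N1 c2 pq qc (odd_p _ hp lp) (unit_p _ hp lp) hy).
Qed.
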